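(* In a De Sitter-Schwarzschild spacetime with $m\neq0$ and in a Reissner-Nordström spacetime there are exactly two totally umbilic non-totally geodesic null hypersurfaces through each point.
   Context: Consider the family of standard static spacetimes $$\left(I\times\mathbb{S}^2\times\mathbb{R},\ \frac{1}{h(r)}dr^2+r^2g_0-h(r)dt^2\right),$$ where $I\subset\mathbb{R}$ is an open interval, $h\in C^\infty(I)$ is a positive function and $g_0$ is the canonical metric on $\mathbb{S}^2$. If $h(r)=1-\frac{m^2}{r}+\frac{c^2}{r^2}$ for certain constants $m$ and $c$, this is the Reissner-Nordström spacetime (the Schwarzschild exterior in the case $c=0$); if $h(r)=1-\frac{m^2}{r}+kr^2$ for constants $m$ and $k$, it is the De Sitter-Schwarzschild spacetime (Minkowski, De Sitter or anti-De Sitter if $m=0$ and $k=0$, $k>0$ or $k<0$ respectively). A null hypersurface $L$ of a Lorentzian manifold $(M,g)$ is a hypersurface on which the induced metric is degenerate. Given a nowhere zero null vector field $\xi\in\mathfrak{X}(L)$, the null second fundamental form is $B(X,Y)=-g(\nabla_X\xi,Y)$ for $X,Y\in\partial_t^\perp\cap TL$; $L$ is totally umbilic if $B=\rho g$ for some $\rho\in C^\infty(L)$ and totally geodesic if $B\equiv0$ (these notions do not depend on the choice of $\xi$).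
   Formalization: The Reissner-Nordström case is stated for constants m and c not both zero: for m = c = 0 the spacetime is Minkowski, where light cones give infinitely many totally umbilic non-totally geodesic null hypersurfaces through each point. *)

(* Defs.v *)
From HB Require Import structures.
From mathcomp Require Import all_boot all_order all_algebra.
From mathcomp Require Import all_classical all_reals all_analysis.
From mathcomp Require Import ring.

Set Implicit Arguments.
Unset Strict Implicit.
Unset Printing Implicit Defensive.

Import Order.TTheory GRing.Theory Num.Theory.
Import numFieldNormedType.Exports.

Local Open Scope classical_set_scope.
Local Open Scope ring_scope.

Section Smooth.
Context {R : realType} {V W : normedModType R}.

(* All iterated directional derivatives exist and are continuous on [U]; this
   is the usual C^n, V being finite dimensional in every use below. *)
Fixpoint Cn_on (n : nat) (U : set V) (f : V -> W) : Prop :=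
  match n with
  | 0 => forall x, U x -> {for x, continuous f}
  | n'.+1 => (forall x, U x -> differentiable f x) /\
             (forall v : V, Cn_on n' U ('D_v f))
  end.

Definition smooth_on (U : set V) (f : V -> W) : Prop :=
  forall n, Cn_on n U f.

End Smooth.

(* Points (r, x, t), and tangent vectors, of R x R^3 x R, in which the
   spacetime I x S^2 x R sits as the subset |x| = 1. *)
Notation pt R := (R^o * 'rV[R]_3 * R^o)%type.

Section Spacetime.
Context {R : realType}.
Implicit Types (I : set R) (h : R -> R) (p q u v w : pt R).
Implicit Types (X Y Z xi : pt R -> pt R) (L : set (pt R)).

(* The Euclidean product; the library norm of ['rV_3] is the sup norm. *)
Definition dot (x y : 'rV[R]_3) : R := \sum_i x 0 i * y 0 i.

(* [~ I 0] is implicit in the metric (1/h) dr^2 + r^2 g_0 - h dt^2, which is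
   degenerate at r = 0. *)
Definition static_data I h : Prop :=
  [/\ open I, is_interval I, ~ I 0,
      smooth_on (I : set R^o) (h : R^o -> R^o) &
      forall r, I r -> 0 < h r].

Definition spacetime I : set (pt R) :=
  [set p | I p.1.1 /\ dot p.1.2 p.1.2 = 1].

Definition tangent_space p : set (pt R) := [set v | dot p.1.2 v.1.2 = 0].

Definition metric h p u v : R :=
  u.1.1 * v.1.1 / h p.1.1 + p.1.1 ^+ 2 * dot u.1.2 v.1.2
  - h p.1.1 * u.2 * v.2.

Definition ddt : pt R := (0, 0, 1).

(* Vector fields and functions on an open part of the spacetime are
   represented by extensions to an open subset of R x R^3 x R; only their
   values on the spacetime matter below. *)
Definition field_on I (U : set (pt R)) Y : Prop :=
  smooth_on U Y /\
  forall q, U q -> spacetime I q -> tangent_space q (Y q).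

Definition field_near I p Y : Prop := exists2 U, open_nbhs p U & field_on I U Y.

Definition function_near p (f : pt R -> R^o) : Prop :=
  exists2 U, open_nbhs p U & smooth_on U f.

Definition bracket Y Z p : pt R := 'D_(Y p) Z p - 'D_(Z p) Y p.

(* [nabla p v Y] is the covariant derivative at [p] of the field [Y] in the
   direction [v]. *)
Section AffineConnection.
Variables (I : set R) (h : R -> R).
Variable nabla : pt R -> pt R -> (pt R -> pt R) -> pt R.

Definition affine_at p : Prop :=
  [/\ forall v Y, tangent_space p v -> field_near I p Y ->
        tangent_space p (nabla p v Y),
      forall (a : R) u v Y, tangent_space p u -> tangent_space p v ->
        field_near I p Y ->
        nabla p (a *: u + v) Y = a *: nabla p u Y + nabla p v Y,
      forall v Y Z, tangent_space p v ->
        field_near I p Y -> field_near I p Z ->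
        nabla p v (fun q => Y q + Z q) = nabla p v Y + nabla p v Z &
      forall v (f : pt R -> R^o) Y, tangent_space p v ->
        function_near p f -> field_near I p Y ->
        nabla p v (fun q => f q *: Y q) =
        'D_v f p *: Y p + f p *: nabla p v Y].

Definition torsion_free_at p : Prop :=
  forall Y Z, field_near I p Y -> field_near I p Z ->
  nabla p (Y p) Z - nabla p (Z p) Y = bracket Y Z p.

Definition metric_compatible_at p : Prop :=
  forall v Y Z, tangent_space p v -> field_near I p Y -> field_near I p Z ->
  'D_v (fun q => metric h q (Y q) (Z q) : R^o) p =
  metric h p (nabla p v Y) (Z p) + metric h p (Y p) (nabla p v Z).

(* Inhabited: see [levi_civita_exists]. *)
Definition levi_civita : Prop :=
  forall p, spacetime I p ->
  [/\ affine_at p, torsion_free_at p & metric_compatible_at p].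

End AffineConnection.

(* Embedded hypersurfaces: locally regular zero sets. *)
Definition hypersurface I L : Prop :=
  L `<=` spacetime I /\
  forall p, L p -> exists U (F : pt R -> R^o),
    [/\ open_nbhs p U, smooth_on U F,
        forall q, U q -> spacetime I q -> (L q <-> F q = 0) &
        exists2 v, tangent_space p v & 'D_v F p != 0].

(* Velocities at [p] of the curves lying in [L]. *)
Definition tangent_to L p : set (pt R) :=
  [set v | exists gamma : R^o -> pt R,
    [/\ gamma 0 = p, is_derive (0 : R^o) (1 : R^o) gamma v &
        \forall s \near (0 : R^o), L (gamma s)]].

Definition null_hypersurface I h L : Prop :=
  hypersurface I L /\
  forall p, L p -> exists v,
    [/\ v != 0, tangent_to L p v &
        forall w, tangent_to L p w -> metric h p v w = 0].

(* Nowhere zero null vector fields on [L], extended to a neighbourhood of [L]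
   so that [nabla] applies to them. *)
Definition null_field I h L xi : Prop :=
  (exists U, [/\ open U, L `<=` U & field_on I U xi]) /\
  forall p, L p ->
    [/\ tangent_to L p (xi p), xi p != 0 & metric h p (xi p) (xi p) = 0].

Definition screen h L p : set (pt R) :=
  [set v | tangent_to L p v /\ metric h p v ddt = 0].

Section Connection.
Variables (I : set R) (h : R -> R).
Variable nabla : pt R -> pt R -> (pt R -> pt R) -> pt R.

Definition null_second_form xi p u v : R := - metric h p (nabla p u xi) v.

Definition totally_umbilic L : Prop :=
  exists xi, null_field I h L xi /\
  exists rho : pt R -> R^o,
    (exists U, [/\ open U, L `<=` U & smooth_on U rho]) /\
    forall p u v, L p -> screen h L p u -> screen h L p v ->
      null_second_form xi p u v = rho p * metric h p u v.

Definition totally_geodesic L : Prop :=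
  exists xi, null_field I h L xi /\
  forall p u v, L p -> screen h L p u -> screen h L p v ->
    null_second_form xi p u v = 0.

Definition umbilic_not_geodesic L : Prop :=
  [/\ null_hypersurface I h L, totally_umbilic L & ~ totally_geodesic L].

Definition same_germ p (A B : set (pt R)) : Prop :=
  \forall q \near p, A q <-> B q.

(* An open piece of a hypersurface is again a hypersurface of the same kind, so
   counting is up to that: there are two connected hypersurfaces with distinct
   germs at [p], every other one through [p] coincides with one of them near
   [p], and is contained in it if connected. *)
Definition exactly_two_through p : Prop :=
  exists L1 L2 : set (pt R),
  [/\ [/\ umbilic_not_geodesic L1, connected L1 & L1 p],
      [/\ umbilic_not_geodesic L2, connected L2 & L2 p],
      ~ same_germ p L1 L2 &
      forall L, umbilic_not_geodesic L -> L p ->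
        (same_germ p L L1 /\ (connected L -> L `<=` L1)) \/
        (same_germ p L L2 /\ (connected L -> L `<=` L2))].

End Connection.

Definition de_sitter_schwarzschild (m k r : R) : R :=
  1 - m ^+ 2 / r + k * r ^+ 2.

(* Minkowski space if m = c = 0. *)
Definition reissner_nordstrom (m c r : R) : R :=
  1 - m ^+ 2 / r + c ^+ 2 / r ^+ 2.

End Spacetime.

Section Derivatives.
Context {R : realType}.
Implicit Types (V W : normedModType R).

Lemma is_derive_lin V W W' (L : W -> W') (f : V -> W) (x v : V) df :
  continuous L -> (forall k a b, L (k *: (a - b)) = k *: (L a - L b)) ->
  is_derive x v f df -> is_derive x v (L \o f) (L df).
Proof.
move=> cL lL [fd fE].
have H : (fun e : R => e^-1 *: ((L \o f) (e *: v + x) - (L \o f) x)) @ 0^' --> L df.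
  have : (L \o (fun e : R => e^-1 *: (f (e *: v + x) - f x))) @ 0^' --> L df.
    apply: cvg_comp; last exact: cL.
    rewrite -fE; exact: fd.
  by apply: cvg_trans; apply: near_eq_cvg; near=> e; rewrite /= lL.
split; first by apply/cvg_ex; exists (L df).
exact/cvg_lim.
Unshelve. all: by end_near. Qed.

Lemma is_derive_pair V W W' (f : V -> W) (g : V -> W') (x v : V) df dg :
  is_derive x v f df -> is_derive x v g dg ->
  is_derive x v (fun y => (f y, g y)) (df, dg).
Proof.
move=> [fd <-] [gd <-].
have H : (fun e : R => e^-1 *: ((fun y => (f y, g y)) (e *: v + x) - (f x, g x)))
   @ 0^' --> ('D_v f x, 'D_v g x).
  exact: cvg_pair fd gd.
split; first by apply/cvg_ex; exists ('D_v f x, 'D_v g x).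
exact: (cvg_lim (@norm_hausdorff _ (W * W')%type) H).
Qed.

Lemma is_derive_line V W (f : V -> W) (x v : V) df :
  is_derive x v f df <-> is_derive (0 : R^o) (1 : R^o) (fun s : R^o => f (s *: v + x)) df.
Proof.
have E : 'D_(1 : R^o) (fun s : R^o => f (s *: v + x)) 0 = 'D_v f x.
  apply: (congr1 (fun F : R -> W => lim (F @ 0^'))); apply/funext => s /=.
  by rewrite addr0 scale0r add0r [_%:A]mulr1.
split => -[d <-].
  by split; [exact: (iffLR (derivable1P f x v) d)|exact: E].
by split; [exact: (iffRL (derivable1P f x v) d)|rewrite -E].
Qed.

Lemma is_derive_chain V W W' (f : W -> W') (g : V -> W) (x v : V) dg :
  is_derive x v g dg -> differentiable f (g x) ->
  is_derive x v (f \o g) ('D_dg f (g x)).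
Proof.
move=> /is_derive_line dG dF; apply/is_derive_line.
set G := (fun s : R^o => g (s *: v + x)) in dG.
have G0 : G 0 = g x by rewrite /G scale0r add0r.
have dG' : differentiable G 0 by apply/derivable1_diffP; exact: ex_derive.
rewrite -G0 in dF *.
have dFG : differentiable (f \o G) 0 by exact: differentiable_comp.
split; first exact/derivable1_diffP.
rewrite deriveE // (diff_comp dG' dF) /= deriveE //; congr ('d _ _ _).
by case: dG => _ <-; rewrite deriveE.
Qed.

Lemma smooth_differentiable V W (U : set V) (f : V -> W) x :
  smooth_on U f -> U x -> differentiable f x.
Proof. by move=> /(_ 1%N)[fd _] /fd. Qed.

Lemma derive_scale W (f : R^o -> W) (x v : R^o) :
  differentiable f x -> 'D_v f x = v *: 'D_1 f x.
Proof.
move=> fd; rewrite !deriveE //.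
by rewrite -linearZ /=; congr ('d f x _); rewrite [RHS]mulr1.
Qed.

Lemma scale_quotient W (e a b : R) (A B : W) :
  (e * (a - b)) *: B + a *: (e *: (A - B)) = e *: (a *: A - b *: B).
Proof.
rewrite (scalerA a) [a * e]mulrC -!scalerA -scalerDr; congr (_ *: _).
by rewrite scalerBl scalerBr addrC subrKA.
Qed.

Lemma is_derive_scale V W (f : V -> R^o) (Y : V -> W) (x v : V) df dY :
  is_derive x v f df -> is_derive x v Y dY ->
  is_derive x v (fun q => (f q : R) *: Y q) ((df : R) *: Y x + (f x : R) *: dY).
Proof.
move=> fd Yd.
have fc : (fun e : R => f (e *: v + x)) @ 0^' --> f x.
  have /derivable1_diffP/differentiable_continuous : derivable (fun e : R^o => f (e *: v + x)) 0 1.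
    by have /is_derive_line[] := fd.
  move=> c'; have -> : f x = f ((0 : R) *: v + x) by rewrite scale0r add0r.
  apply: cvg_trans c'.
  by apply: cvg_app; exact: nbhs_dnbhs.
case: fd => fd <-; case: Yd => Yd <-.
have H : (fun e : R => e^-1 *: ((f (e *: v + x) : R) *: Y (e *: v + x) - (f x : R) *: Y x))
   @ 0^' --> ('D_v f x : R) *: Y x + (f x : R) *: 'D_v Y x.
  have K := cvgD (cvgZr_tmp (a := Y x) fd) (cvgZ fc Yd).
  apply: cvg_trans; last exact: (K _ _ _).
  apply: near_eq_cvg; near=> e.
  exact: scale_quotient.
split; first by apply/cvg_ex; eexists; exact: H.
exact: (cvg_lim (@norm_hausdorff _ W) H).
Unshelve. all: by end_near. Qed.

Lemma is_derive_affine (a b : R) (x : R^o) :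
  is_derive x (1 : R^o) (fun s : R^o => a + s * b : R^o) (b : R^o).
Proof.
have -> : (fun s : R^o => a + s * b : R^o) = cst (a : R^o) + b \*: (id : R^o -> R^o).
  by apply/funext => s; rewrite /= mulrC.
have := is_deriveD (is_derive_cst (a : R^o) x (1 : R^o)) (is_deriveZ b (is_derive_id x (1 : R^o))).
by rewrite add0r [_ *: _](mulr1 b).
Qed.

Lemma is_derive_norm (b : R) (b0 : 0 <= b) :
  is_derive (0 : R^o) (1 : R^o) (fun s : R^o => (Num.sqrt (1 + b * s ^+ 2))^-1 : R^o) 0.
Proof.
    pose g : R -> R := cst 1 + b \*: (id ^+ 2 : R -> R).
    have dg : is_derive (0 : R) (1 : R) g 0.
      apply: is_derive_eq; rewrite /= expr1 add0r.
      have -> : (2 * 0 : R) = 0 by rewrite mulr0.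
      by rewrite scale0r scaler0.
    have g0 : g 0 = 1 by rewrite /g !fctE /= expr0n /= [_ *: _](mulr0 b) addr0.
    have ds : is_derive (g 0) (1 : R) Num.sqrt (2 * Num.sqrt (g 0))^-1.
      by apply: is_derive1_sqrt; rewrite g0.
    have := is_derive1_comp ds dg; rewrite mulr0 => dsg.
    have s0 : (Num.sqrt \o g) 0 != 0 by rewrite /= g0 sqrtr1 oner_eq0.
    have := is_deriveV s0 dsg; rewrite scaler0.
    by [].
Qed.

Section comp.
Variables (V : normedModType R) (f : V -> pt R) (x v : V) (df : pt R).
Hypothesis fd : is_derive x v f df.

Lemma is_derive_r : is_derive x v (fun q => (f q).1.1 : R^o) (df.1.1 : R^o).
Proof.
apply: (@is_derive_lin _ _ _ (fun u : pt R => u.1.1 : R^o)) => // u.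
by apply: (@cvg_comp _ _ _ (fun u : pt R => u.1) fst); apply: cvg_fst.
Qed.
Lemma is_derive_t : is_derive x v (fun q => (f q).2 : R^o) (df.2 : R^o).
Proof. by apply: (@is_derive_lin _ _ _ (fun u : pt R => u.2 : R^o)) => // u; apply: cvg_snd. Qed.
Lemma is_derive_x i : is_derive x v (fun q => (f q).1.2 0 i : R^o) (df.1.2 0 i : R^o).
Proof.
apply: (@is_derive_lin _ _ _ (fun u : pt R => u.1.2 0 i : R^o)) => //.
  move=> u; apply: (@cvg_comp _ _ _ (fun u : pt R => u.1.2) (fun y : 'rV[R]_3 => y 0 i)); last exact: coord_continuous.
  by apply: (@cvg_comp _ _ _ (fun u : pt R => u.1) snd); [apply: cvg_fst|apply: cvg_snd].
by move=> k a b; rewrite !mxE.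
Qed.
End comp.

Lemma is_derive_dot V (f g : V -> pt R) (x v : V) df dg :
  is_derive x v f df -> is_derive x v g dg ->
  is_derive x v (fun q => dot (f q).1.2 (g q).1.2 : R^o)
    (dot df.1.2 (g x).1.2 + dot (f x).1.2 dg.1.2 : R^o).
Proof.
move=> fd gd.
have -> : (fun q => dot (f q).1.2 (g q).1.2 : R^o) =
  \sum_(i < 3) ((fun q => (f q).1.2 0 i : R^o) * (fun q => (g q).1.2 0 i : R^o)).
  by apply/funext => q; rewrite fct_sumE.
apply: is_derive_eq.
  by apply: is_derive_sum => i; apply: is_deriveM; apply: is_derive_x.
rewrite /dot -big_split /=; apply: eq_bigr => i _.
by rewrite [RHS]addrC; congr (_ + _); rewrite mulrC.
Qed.
End Derivatives.


Section LeviCivita.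
Context {R : realType}.
Implicit Types (I : set R) (h : R -> R) (p q u v w : pt R).
Implicit Types (X Y Z : pt R -> pt R).

Lemma dotC (x y : 'rV[R]_3) : dot x y = dot y x.
Proof. by apply: eq_bigr => i _; rewrite mulrC. Qed.
Lemma dotDl (x y z : 'rV[R]_3) : dot (x + y) z = dot x z + dot y z.
Proof. by rewrite /dot -big_split; apply: eq_bigr => i _; rewrite !mxE mulrDl. Qed.
Lemma dotZl a (x z : 'rV[R]_3) : dot (a *: x) z = a * dot x z.
Proof. by rewrite /dot mulr_sumr; apply: eq_bigr => i _; rewrite !mxE mulrA. Qed.
Lemma dotNl (x z : 'rV[R]_3) : dot (- x) z = - dot x z.
Proof. by rewrite -scaleN1r dotZl mulN1r. Qed.
Lemma dotDr (x y z : 'rV[R]_3) : dot z (x + y) = dot z x + dot z y.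
Proof. by rewrite dotC dotDl !(dotC _ z). Qed.
Lemma dotZr a (x z : 'rV[R]_3) : dot z (a *: x) = a * dot z x.
Proof. by rewrite dotC dotZl (dotC _ z). Qed.
Lemma dotNr (x z : 'rV[R]_3) : dot z (- x) = - dot z x.
Proof. by rewrite dotC dotNl (dotC _ z). Qed.
Definition dotE := (dotDl, dotDr, dotZl, dotZr, dotNl, dotNr).

Lemma is_derive_field I p v Y : field_near I p Y -> is_derive p v Y ('D_v Y p).
Proof.
move=> [U [_ Up] [sY _]]; apply: derivableP; apply: diff_derivable.
exact: smooth_differentiable sY Up.
Qed.

Definition sphere_curve p v (s : R^o) : pt R :=
  ((p.1.1 + s * v.1.1, (Num.sqrt (1 + dot v.1.2 v.1.2 * s ^+ 2))^-1 *: (p.1.2 + s *: v.1.2)), p.2 + s * v.2).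

Lemma tangent_field I p v Y : spacetime I p -> open I -> tangent_space p v -> field_near I p Y ->
  dot v.1.2 (Y p).1.2 + dot p.1.2 ('D_v Y p).1.2 = 0.
Proof.
move=> [Ip p1] oI tv fY; have dY := is_derive_field _ fY.
have [U [oU Up] [sY tY]] := fY.
have C0 : sphere_curve p v 0 = p.
  rewrite /sphere_curve !mul0r !addr0 expr0n /= mulr0 addr0 sqrtr1 invr1 scale1r scale0r addr0.
  by case: p {Ip p1 tv fY dY Up} => -[].
have b0 : 0 <= dot v.1.2 v.1.2 by apply: sumr_ge0 => i _; rewrite -expr2 sqr_ge0.
have dC : is_derive (0 : R^o) (1 : R^o) (sphere_curve p v) v.
  have dlin (a b : R) : is_derive (0 : R^o) (1 : R^o) (fun s : R^o => a + s * b : R^o) (b : R^o).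
    exact: is_derive_affine.
  have dn : is_derive (0 : R^o) (1 : R^o) (fun s : R^o => (Num.sqrt (1 + dot v.1.2 v.1.2 * s ^+ 2))^-1 : R^o) 0.
    exact: is_derive_norm.
  have -> : v = ((v.1.1, v.1.2), v.2) by case: v {tv dY b0 dlin dn C0} => -[].
  apply: (is_derive_pair _ (dlin p.2 v.2)).
  apply: (is_derive_pair (dlin p.1.1 v.1.1)).
  set c : R^o -> R^o := fun s => _^-1 in dn *.
  have dZ (y : 'rV[R]_3) (f : R^o -> R^o) (df : R^o) : is_derive (0 : R^o) (1 : R^o) f df ->
      is_derive (0 : R^o) (1 : R^o) (fun s => (f s : R) *: y) ((df : R) *: y).
    apply: (@is_derive_lin _ _ _ _ (fun a : R^o => (a : R) *: y)); first exact: scalel_continuous.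
    by move=> k a d; rewrite -scalerBl scalerA.
  have -> : (fun s : R^o => (c s : R) *: (p.1.2 + (s : R) *: v.1.2)) =
     (fun s => (c s : R) *: p.1.2) + (fun s => ((c * id) s : R) *: v.1.2).
    by apply/funext => s; rewrite scalerDr scalerA.
  have D := is_deriveD (dZ p.1.2 _ _ dn) (dZ v.1.2 _ _ (is_deriveM dn (is_derive_id (0 : R^o) (1 : R^o)))).
  apply: (is_derive_eq D).
  rewrite scale0r add0r scaler0 addr0 /c expr0n /= mulr0 addr0 sqrtr1 invr1.
  by rewrite [1%:A](scale1r (1 : R^o)) scale1r.
have dYC : is_derive (0 : R^o) (1 : R^o) (Y \o sphere_curve p v) ('D_v Y p).
  rewrite -{2}C0; apply: is_derive_chain => //; rewrite C0.
  exact: smooth_differentiable sY Up.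
have [_] := is_derive_dot dC dYC.
rewrite (_ : (Y \o sphere_curve p v) 0 = Y p) ?C0; last by rewrite -[in RHS]C0.
move=> <-.
rewrite (@near_eq_derive _ _ _ _ (cst 0)) ?derive_cst //.
have cC : sphere_curve p v @ (0 : R^o) --> p.
  rewrite -{2}C0; apply: differentiable_continuous; apply/derivable1_diffP; exact: ex_derive.
have oIp : \forall q \near p, I q.1.1.
  have /(_ I (open_nbhs_nbhs (conj oI Ip))) : (fun q : pt R => q.1.1) @ p --> p.1.1.
    by apply: (@cvg_comp _ _ _ (fun u : pt R => u.1) fst); apply: cvg_fst.
  by [].
near=> s; apply: tY.
  by near: s; apply: cC; apply: open_nbhs_nbhs.
split; first by near: s; exact: (cC _ oIp).
rewrite /sphere_curve /= !dotE p1 (dotC v.1.2) (tv : dot _ _ = 0).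
rewrite mulr0 addr0 add0r; set b := dot v.1.2 v.1.2.
have : Num.sqrt (1 + b * s ^+ 2) ^+ 2 = 1 + b * s ^+ 2.
  by rewrite sqr_sqrtr // addr_ge0 // mulr_ge0 // sqr_ge0.
have : Num.sqrt (1 + b * s ^+ 2) != 0.
  by rewrite sqrtr_eq0 -ltNge ltr_pwDl // mulr_ge0 // sqr_ge0.
set c := Num.sqrt _ => c0 cE.
apply: (@etrans _ _ (c^-1 * (c^-1 * (1 + b * s ^+ 2)))); first by field.
by rewrite -cE expr2; field.
Unshelve. all: by end_near. Qed.

(* The Levi-Civita connection of the warped metric on I x R^3 x R, followed by
   the projection to the tangent spaces of the unit sphere. *)
Definition static_connection h p v Y : pt R :=
  let w := 'D_v Y p in let y := Y p in let r := p.1.1 in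
  let H := h r in let H' := 'D_(1 : R^o) (h : R^o -> R^o) r in
  ((w.1.1 - H' / (2 * H) * v.1.1 * y.1.1 - r * H * dot v.1.2 y.1.2 + H * H' / 2 * v.2 * y.2,
    w.1.2 - dot p.1.2 w.1.2 *: p.1.2 + r^-1 *: (v.1.1 *: y.1.2 + y.1.1 *: v.1.2)),
   w.2 + H' / (2 * H) * (v.1.1 * y.2 + v.2 * y.1.1)).


Lemma pt_eq u v : u.1.1 = v.1.1 -> (forall i, u.1.2 0 i = v.1.2 0 i) -> u.2 = v.2 -> u = v.
Proof.
case: u v => [[a x] b] [[c y] d] /= -> xy ->; congr (_, _, _).
by apply/rowP => i; rewrite xy.
Qed.

Lemma ptE : (forall u v, (u + v).1.1 = u.1.1 + v.1.1) * (forall u v, (u + v).1.2 = u.1.2 + v.1.2) *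
  (forall u v, (u + v).2 = u.2 + v.2) * (forall u, (- u).1.1 = - u.1.1) * (forall u, (- u).1.2 = - u.1.2)
 * (forall u, (- u).2 = - u.2) * (forall (a : R) u, (a *: u).1.1 = a * u.1.1)
 * (forall (a : R) u, (a *: u).1.2 = a *: u.1.2) * (forall (a : R) u, (a *: u).2 = a * u.2).
Proof. by []. Qed.

Lemma scaleRE (a : R) (x : R^o) : a *: x = a * (x : R).
Proof. by []. Qed.

Lemma levi_civita_exists I h : static_data I h -> levi_civita I h (static_connection h).
Proof.
move=> [oI _ I0 sh h0] p Mp; have [Ip p1] := Mp.
have r0 : p.1.1 != 0 by apply: contra_notN I0 => /eqP <-.
have H0 : h p.1.1 != 0 by rewrite gt_eqF // h0.
have dh : differentiable (h : R^o -> R^o) p.1.1 := smooth_differentiable sh Ip.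
split; first split.
- move=> v Y tv fY; have [U [_ Up] [_ tY]] := fY.
  have := tY _ Up Mp; rewrite /tangent_space /= => ty.
  by rewrite !dotE p1 (tv : dot _ _ = 0) ty; ring.
- move=> a u v Y tu tv fY.
  have dY : differentiable Y p by case: fY => U [_ Up] [sY _]; exact: smooth_differentiable sY Up.
  rewrite /static_connection !deriveE // linearD linearZ /=.
  move: ('d Y p u) ('d Y p v) (Y p) => A B y.
  apply: pt_eq => [|i|]; rewrite !ptE /= ?ptE ?dotE ?mxE ?scaleRE; by field.
- move=> v Y Z tv fY fZ.
  have -> : (fun q => Y q + Z q) = Y + Z by [].
  rewrite /static_connection deriveD; [|by have [] := is_derive_field v fY|by have [] := is_derive_field v fZ].
  rewrite [(Y + Z) p]/(Y p + Z p).
  move: ('D_v Y p) ('D_v Z p) (Y p) (Z p) => A B y z.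
  apply: pt_eq => [|i|]; rewrite !ptE /= ?ptE ?dotE ?mxE ?scaleRE; by field.
- move=> v f Y tv [U [_ Up] sf] fY.
  have ty : dot p.1.2 (Y p).1.2 = 0 by have [U' [_ Up'] [_ /(_ p Up' Mp)]] := fY.
  have dY := is_derive_field v fY.
  have df : is_derive p v f ('D_v f p).
    by apply/derivableP/diff_derivable; exact: smooth_differentiable sf Up.
  set w := 'D_v f p in df *.
  rewrite /static_connection; have -> : 'D_v (fun q => f q *: Y q) p = w *: Y p + f p *: 'D_v Y p.
    by have [] := is_derive_scale df dY.
  move: ('D_v Y p) (Y p) (f p : R) (w : R) ty {df dY} => A y a {}w ty.
  apply: pt_eq => [|i|]; rewrite !ptE /= ?ptE ?dotE ?ty ?mxE ?scaleRE; by field.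
- move=> Y Z fY fZ.
  have tY : dot p.1.2 (Y p).1.2 = 0 by have [U [_ Up] [_ /(_ p Up Mp)]] := fY.
  have tZ : dot p.1.2 (Z p).1.2 = 0 by have [U [_ Up] [_ /(_ p Up Mp)]] := fZ.
  have := tangent_field Mp oI tY fZ; have := tangent_field Mp oI tZ fY.
  rewrite /bracket /static_connection.
  move: (Y p) (Z p) tY tZ ('D_(Y p) Z p) ('D_(Z p) Y p) => y z ty tz A B.
  rewrite (dotC z.1.2) => EB EA.
  have {}EB : dot p.1.2 B.1.2 = - dot y.1.2 z.1.2 by apply/eqP; rewrite -addr_eq0 addrC EB.
  have {}EA : dot p.1.2 A.1.2 = - dot y.1.2 z.1.2 by apply/eqP; rewrite -addr_eq0 addrC EA.
  apply: pt_eq => [|i|]; rewrite !ptE /= ?EA ?EB ?(dotC z.1.2) ?mxE ?scaleRE; by field.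
- move=> v Y Z tv fY fZ.
  have dY := is_derive_field v fY; have dZ := is_derive_field v fZ.
  have tY : dot p.1.2 (Y p).1.2 = 0 by have [U [_ Up] [_ /(_ p Up Mp)]] := fY.
  have tZ : dot p.1.2 (Z p).1.2 = 0 by have [U [_ Up] [_ /(_ p Up Mp)]] := fZ.
  have dr : is_derive p v (fun q => q.1.1 : R^o) (v.1.1 : R^o).
    exact: (@is_derive_r _ _ id _ _ _ (is_derive_id _ _)).
  have dhr : is_derive p v (fun q => h q.1.1 : R^o) (v.1.1 * 'D_(1 : R^o) (h : R^o -> R^o) p.1.1 : R^o).
    have := is_derive_chain dr dh; rewrite derive_scale //.
  have dhi : is_derive p v (fun q => (h q.1.1)^-1 : R^o)
     (- (h p.1.1) ^- 2 * (v.1.1 * 'D_(1 : R^o) (h : R^o -> R^o) p.1.1) : R^o).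
    split; first by apply: derivableV => //; exact: ex_derive.
    by rewrite deriveV // derive_val.
  have -> : (fun q => metric h q (Y q) (Z q) : R^o) =
    (((fun q => (Y q).1.1 : R^o) * (fun q => (Z q).1.1 : R^o)) * (fun q => (h q.1.1)^-1 : R^o)
    + ((fun q => q.1.1 : R^o) * (fun q => q.1.1 : R^o)) * (fun q => dot (Y q).1.2 (Z q).1.2 : R^o)
    - ((fun q => h q.1.1 : R^o) * (fun q => (Y q).2 : R^o)) * (fun q => (Z q).2 : R^o))
    by apply/funext => q; rewrite /metric expr2.
  have [_ ->] := is_deriveB (is_deriveD
      (is_deriveM (is_deriveM (is_derive_r dY) (is_derive_r dZ)) dhi)
      (is_deriveM (is_deriveM dr dr) (is_derive_dot dY dZ)))
      (is_deriveM (is_deriveM dhr (is_derive_t dY)) (is_derive_t dZ)).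
  rewrite /metric /static_connection !fctE.
  move: (Y p) (Z p) tY tZ ('D_v Y p) ('D_v Z p) ('D_(1 : R^o) (h : R^o -> R^o) p.1.1 : R) (h p.1.1 : R) H0 => y z ty tz A B h' H H0.
  rewrite /= !dotE tz (dotC y.1.2 p.1.2) ty !scaleRE (dotC v.1.2 z.1.2) (dotC y.1.2 v.1.2).
  by field; rewrite r0 H0.
Qed.

End LeviCivita.

(* Main.v *)
From HB Require Import structures.
Require Import Defs.
From mathcomp Require Import all_boot all_order all_algebra.
From mathcomp Require Import all_classical all_reals all_analysis.
From mathcomp Require Import ring lra.

Set Implicit Arguments.
Unset Strict Implicit.
Unset Printing Implicit Defensive.

Import Order.TTheory GRing.Theory Num.Theory.
Import numFieldNormedType.Exports.

Local Open Scope classical_set_scope.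
Local Open Scope ring_scope.

(** Write r for the radius, h' for the derivative of h, and let T be a primitive
of 1/h.  The hypersurfaces t - eps T(r) = constant, with eps = 1 or eps = -1, are
swept out by the radial light rays.  They are null, with normal (eps h, 0, 1), and
a direct computation gives their null second form: it is -eps h/r times the
metric on the spheres, so they are umbilic and nowhere geodesic.  Two of them pass
through each point ([leaf], [leaf_umbilic_not_geodesic], [leaf_connected],
[leaves_distinct]).

The converse rests on [weyl_eq0] : the normal of an umbilic null hypersurface L
is a principal null direction of the Weyl tensor.  Divided by r^2 the metric is the
product of the round sphere with a Lorentzian surface.  Scale the normal to the
field Z = (r^2 al, z, r^2/h), which is the affine scaling for this product, and
suppose that its spherical part z does not vanish.  The screen is spanned by a
vector W orthogonal to the plane of the light ray and a vector V in that plane.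
Umbilicity and the constraints on Z determine all the derivatives of Z along L in
terms of a single function c, the expansion of Z for the product metric.  The
brackets [Z, W] and [Z, V] are tangent to L, and computing in two ways the second
derivatives of z and of al that they govern gives two Riccati equations for c,

  Z c + c^2 = - |z|^2   and   Z c + c^2 = r^2 k' |z|^2,   k = h/r - h'/2,

one for each factor of the product: 1 is the curvature of the sphere, and the
curvature of the surface enters through - r^2 k'.  Their difference is
|z|^2 (1 + r^2 k') = 0 ([riccati_W], [riccati_V]).

For h = 1 - M/r + C/r^2 + K r^2 the function 1 + r^2 k' is 3M/r - 6C/r^2.  It may
vanish at one radius, but only to first order unless M = C = 0.  If z were
nonzero at a point of L, this function would vanish along L near that point, and
L would contain a curve on which r varies (the direction V), so that the
derivative would vanish too.  Hence z = 0 on L ([radial]).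

The tangent spaces of L are then those of the hypersurfaces t - eps T(r) =
constant, where eps is locally constant on L, and the implicit function theorem
makes L coincide near each of its points with one of them ([leaf_local]).  If L is
connected, the set of its points that lie on a given leaf with a given sign is open
and closed in L, so L is contained in that leaf ([exactly_two]). *)

(** * Smooth functions *)
Section SmoothCalculus.
Context {R : realType}.
Implicit Types (V W : normedModType R).

(** [Cn_on] refers to the values of a function outside [U] through [derive], so
rewriting a derivative on [U] needs that differentiability and derivatives are
local, and that [U] is open. *)
Lemma near_eq_differentiable V W (f g : V -> W) (x : V) :
  (\near x, f x = g x) -> differentiable f x -> differentiable g x.
Proof.
move=> fg df; have fgx : f x = g x by exact: nbhs_singleton fg.
have gE : g \o shift x = cst (g x) + 'd f x +o_ 0 id.
  apply/eqaddoP => e e0.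
  have /eqaddoP/(_ e e0) := diff_locally df.
  have : \forall h \near (0 : V), f (h + x) = g (h + x).
    by move: fg; rewrite (near_shift 0 x) /=; apply: filterS => h; rewrite /= subr0.
  apply: filterS2 => h; rewrite /= /shift /= !fctE => E.
  by rewrite /= -!fgx -E.
have dgE : 'd g x = 'd f x :> (V -> W) by apply: diff_unique => //; exact: diff_continuous.
apply/diff_locallyP; rewrite dgE; split; [exact: diff_continuous|exact: gE].
Qed.

Lemma near_open V (U : set V) x : open U -> U x -> \forall y \near x, U y.
Proof. by move=> oU Ux; exact: open_nbhs_nbhs. Qed.

Lemma Cn_on_eq n V W (U : set V) (f g : V -> W) : open U ->
  (forall x, U x -> f x = g x) -> Cn_on n U f -> Cn_on n U g.
Proof.
move=> oU; elim: n f g => [|n IH] f g fg /=.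
  move=> cf x Ux; rewrite /prop_for /continuous_at -(fg _ Ux).
  apply: cvg_trans (cf x Ux); apply: near_eq_cvg.
  by apply: filterS (near_open oU Ux) => y Uy; rewrite fg.
move=> [df Df]; split=> [x Ux|v].
  apply: near_eq_differentiable (df x Ux).
  by apply: filterS (near_open oU Ux) => y Uy; rewrite fg.
apply: IH (Df v) => x Ux; apply: near_eq_derive.
by apply: filterS (near_open oU Ux) => y Uy; rewrite fg.
Qed.

Lemma Cn_onW n V W (U : set V) (f : V -> W) : Cn_on n.+1 U f -> Cn_on n U f.
Proof.
elim: n f => [|n IH] f [df Df] /=.
  by move=> x Ux; exact: differentiable_continuous (df x Ux).
by split => // v; apply: IH.
Qed.

Lemma Cn_on_subset n V W (U U' : set V) (f : V -> W) :
  U' `<=` U -> Cn_on n U f -> Cn_on n U' f.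
Proof.
move=> sub; elim: n f => [|n IH] f /=; first by move=> cf x /sub; exact: cf.
by move=> [df Df]; split=> [x /sub|v]; [exact: df|exact: IH].
Qed.

Lemma smooth_subset V W (U U' : set V) (f : V -> W) :
  U' `<=` U -> smooth_on U f -> smooth_on U' f.
Proof. by move=> s sf n; exact: Cn_on_subset s (sf n). Qed.

Lemma smooth_eq V W (U : set V) (f g : V -> W) : open U ->
  (forall x, U x -> f x = g x) -> smooth_on U f -> smooth_on U g.
Proof. by move=> oU fg sf n; exact: Cn_on_eq oU fg (sf n). Qed.

Lemma smooth_derive V W (U : set V) (f : V -> W) v :
  smooth_on U f -> smooth_on U ('D_v f).
Proof. by move=> sf n; have [_] := sf n.+1; apply. Qed.

Lemma smooth_is_derive V W (U : set V) (f : V -> W) x v :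
  smooth_on U f -> U x -> is_derive x v f ('D_v f x).
Proof.
by move=> sf Ux; apply: derivableP; apply: diff_derivable; exact: smooth_differentiable sf Ux.
Qed.

Lemma smooth_continuous V W (U : set V) (f : V -> W) x :
  smooth_on U f -> U x -> {for x, continuous f}.
Proof. by move=> /(_ 0%N) /= + Ux; apply. Qed.

Lemma Cn_on_cst n V W (U : set V) (a : W) : Cn_on n U (fun _ : V => a).
Proof.
elim: n a => [|n IH] a /=; first by move=> x _; exact: cvg_cst.
split=> [x _|v]; first exact: differentiable_cst.
have -> : 'D_v (fun _ : V => a) = fun=> 0 by apply/funext => x; exact: derive_cst.
exact: IH.
Qed.

Lemma smooth_cst V W (U : set V) (a : W) : smooth_on U (fun _ : V => a).
Proof. by move=> n; exact: Cn_on_cst. Qed.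

Lemma Cn_on_lin n V W W' (U : set V) (L : {linear W -> W'}) (f : V -> W) :
  open U -> continuous L -> Cn_on n U f -> Cn_on n U (L \o f).
Proof.
move=> oU cL; elim: n f => [|n IH] f /=.
  by move=> cf x Ux; apply: continuous_comp; [exact: cf|exact: cL].
move=> [df Df]; split=> [x Ux|v].
  by apply: differentiable_comp; [exact: df|exact: linear_differentiable].
apply: Cn_on_eq (IH _ (Df v)) => // x Ux /=.
have [] : is_derive x v (L \o f) (L ('D_v f x)); last by move=> _ ->.
apply: is_derive_lin => //; first by move=> k a b; rewrite linearZ linearB.
by apply: derivableP; apply: diff_derivable; exact: df.
Qed.

Lemma smooth_lin V W W' (U : set V) (L : {linear W -> W'}) (f : V -> W) :
  open U -> continuous L -> smooth_on U f -> smooth_on U (L \o f).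
Proof. by move=> oU cL sf n; exact: Cn_on_lin. Qed.

Lemma smooth_id V (U : set V) : open U -> smooth_on U (id : V -> V).
Proof.
move=> oU [|n] /=; first by move=> x _; exact: cvg_id.
split=> [x _|v]; first exact: ex_diff.
have -> : 'D_v (id : V -> V) = fun=> v by apply/funext => x; exact: derive_id.
exact: Cn_on_cst.
Qed.

Lemma Cn_on_add n V W (U : set V) (f g : V -> W) : open U ->
  Cn_on n U f -> Cn_on n U g -> Cn_on n U (fun x => f x + g x).
Proof.
move=> oU; elim: n f g => [|n IH] f g /=.
  by move=> cf cg x Ux; apply: cvgD; [exact: cf|exact: cg].
move=> [df Df] [dg Dg]; split=> [x Ux|v].
  exact: differentiableD (df _ Ux) (dg _ Ux).
apply: Cn_on_eq (IH _ _ (Df v) (Dg v)) => // x Ux.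
by rewrite -deriveD //; apply: diff_derivable; [exact: df|exact: dg].
Qed.

Lemma smooth_add V W (U : set V) (f g : V -> W) : open U ->
  smooth_on U f -> smooth_on U g -> smooth_on U (fun x => f x + g x).
Proof. by move=> oU sf sg n; exact: Cn_on_add. Qed.

Lemma smooth_sum V W (U : set V) n (f : 'I_n -> V -> W) : open U ->
  (forall i, smooth_on U (f i)) -> smooth_on U (fun x => \sum_(i < n) f i x).
Proof.
move=> oU; elim: n f => [|n IH] f sf.
  apply: (smooth_eq (f := fun=> 0)) => //; last exact: smooth_cst.
  by move=> x _; rewrite big_ord0.
apply: (smooth_eq (f := fun x => \sum_(i < n) f (widen_ord (leqnSn n) i) x + f ord_max x)) => //.
  by move=> x _; rewrite big_ord_recr.
by apply: smooth_add => //; apply: IH.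
Qed.

(** Scaling is a continuous bilinear map, and those are differentiable. *)
Lemma differentiable_scale V W (f : V -> R^o) (g : V -> W) x :
  differentiable f x -> differentiable g x ->
  differentiable (fun y => (f y : R) *: g y) x.
Proof.
move=> df dg; rewrite (_ : (fun y => _) = (fun p : R^o * W => (p.1 : R) *: p.2) \o (fun y => (f y, g y))) //.
apply: differentiable_comp; first exact: differentiable_pair.
pose m (a : R^o) (w : W) : W := (a : R) *: w.
have bl : bilinear_for (GRing.Scale.Law.clone _ _ *:%R _) (GRing.Scale.Law.clone _ _ *:%R _) m.
  split=> [w a u v|a b u v]; first by rewrite /m /= scalerDl -scalerA.
  by rewrite /m /= scalerDr !scalerA mulrC.
pose bM := bilinear_isBilinear.Build R R^o W W _ _ m bl.
pose B : {bilinear R^o -> W -> W} := HB.pack m bM.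
apply: (@differentiable_bilin _ _ _ _ B (f x, g x)) => p.
exact: cvgZ cvg_fst cvg_snd.
Qed.

Lemma Cn_on_scale n V W (U : set V) (f : V -> R^o) (g : V -> W) : open U ->
  Cn_on n U f -> Cn_on n U g -> Cn_on n U (fun x => (f x : R) *: g x).
Proof.
move=> oU; elim: n f g => [|n IH] f g.
  by move=> /= cf cg x Ux; apply: cvgZ; [exact: cf|exact: cg].
move=> Cf Cg; have [df Df] := Cf; have [dg Dg] := Cg; split=> [x Ux|v].
  by apply: differentiable_scale; [exact: df|exact: dg].
apply: (@Cn_on_eq _ _ _ _ (fun x => ('D_v f x : R) *: g x + (f x : R) *: 'D_v g x)) => //.
  move=> x Ux; have [] := @is_derive_scale _ _ _ f g x v ('D_v f x) ('D_v g x); last by [].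
    by apply: derivableP; apply: diff_derivable; exact: df.
  by apply: derivableP; apply: diff_derivable; exact: dg.
apply: Cn_on_add => //; apply: IH => //; by [apply: Df|apply: Dg|apply: Cn_onW].
Qed.

Lemma smooth_scale V W (U : set V) (f : V -> R^o) (g : V -> W) : open U ->
  smooth_on U f -> smooth_on U g -> smooth_on U (fun x => (f x : R) *: g x).
Proof. by move=> oU sf sg n; exact: Cn_on_scale. Qed.

Lemma smooth_mul V (U : set V) (f g : V -> R^o) : open U ->
  smooth_on U f -> smooth_on U g -> smooth_on U (fun x => (f x : R) * g x : R^o).
Proof. exact: smooth_scale. Qed.

Lemma smooth_opp V W (U : set V) (f : V -> W) : open U ->
  smooth_on U f -> smooth_on U (fun x => - f x).
Proof.
move=> oU sf; apply: (smooth_eq (f := fun x => (-1 : R) *: f x)) => //.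
  by move=> x _; rewrite scaleN1r.
by apply: (smooth_scale (f := fun=> -1 : R^o)) => //; exact: smooth_cst.
Qed.

Lemma smooth_sub V W (U : set V) (f g : V -> W) : open U ->
  smooth_on U f -> smooth_on U g -> smooth_on U (fun x => f x - g x).
Proof. by move=> oU sf sg; apply: smooth_add => //; exact: smooth_opp. Qed.

Lemma Cn_on_pair n V W W' (U : set V) (f : V -> W) (g : V -> W') : open U ->
  Cn_on n U f -> Cn_on n U g -> Cn_on n U (fun x => (f x, g x)).
Proof.
move=> oU; elim: n f g => [|n IH] f g /=.
  by move=> cf cg x Ux; apply: cvg_pair; [exact: cf|exact: cg].
move=> [df Df] [dg Dg]; split=> [x Ux|v].
  exact: differentiable_pair (df _ Ux) (dg _ Ux).
apply: Cn_on_eq (IH _ _ (Df v) (Dg v)) => // x Ux.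
have [] := @is_derive_pair _ _ _ _ f g x v ('D_v f x) ('D_v g x); last by [].
  by apply: derivableP; apply: diff_derivable; exact: df.
by apply: derivableP; apply: diff_derivable; exact: dg.
Qed.

Lemma smooth_pair V W W' (U : set V) (f : V -> W) (g : V -> W') : open U ->
  smooth_on U f -> smooth_on U g -> smooth_on U (fun x => (f x, g x)).
Proof. by move=> oU sf sg n; exact: Cn_on_pair. Qed.

(** With a function of one variable the chain rule involves a single product, and the
induction on [n] closes on [Cn_on_scale]. *)
Lemma Cn_on_comp1 n V (U : set V) (J : set R) (phi : R^o -> R^o) (f : V -> R^o) :
  open U -> (forall x, U x -> J (f x)) ->
  Cn_on n (J : set R^o) phi -> Cn_on n U f -> Cn_on n U (phi \o f).
Proof.
move=> oU UJ; elim: n phi => [|n IH] phi.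
  by move=> /= cp cf x Ux; apply: continuous_comp; [exact: cf|apply: cp; exact: UJ].
move=> [dp Dp] Cf; have [df Df] := Cf; split=> [x Ux|v].
  by apply: differentiable_comp; [exact: df|apply: dp; exact: UJ].
apply: (@Cn_on_eq _ _ _ _ (fun x => ('D_v f x : R) *: ('D_(1 : R^o) phi \o f) x)) => //.
  move=> x Ux; have dx : is_derive x v f ('D_v f x).
    by apply: derivableP; apply: diff_derivable; exact: df.
  have dpx : differentiable phi (f x) by apply: dp; exact: UJ.
  by have [_ ->] := is_derive_chain dx dpx; rewrite (derive_scale _ dpx).
by apply: Cn_on_scale => //; [exact: Df|apply: IH; [exact: Dp|exact: Cn_onW]].
Qed.

Lemma smooth_comp1 V (U : set V) (J : set R) (phi : R^o -> R^o) (f : V -> R^o) :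
  open U -> (forall x, U x -> J (f x)) ->
  smooth_on (J : set R^o) phi -> smooth_on U f -> smooth_on U (phi \o f).
Proof. by move=> oU UJ sp sf n; exact: Cn_on_comp1 (sp n) (sf n). Qed.

Lemma open_neq0 : open ([set x | x != 0] : set R^o).
Proof.
rewrite (_ : [set x | _] = ~` [set 0]); last by apply/seteqP; split=> x /= /eqP.
by apply: closed_openC; exact: closed_eq.
Qed.

(** The derivative of the inverse is minus its square, so each further derivative
reduces to the previous one by the product rule. *)
Lemma smooth_inv1 : smooth_on ([set x | x != 0] : set R^o) ((fun x : R => x^-1) : R^o -> R^o).
Proof.
have o0 := open_neq0.
elim=> [|n IH]; first by move=> x x0; apply: (@cvgV _ _ _ _ id) => //; exact: cvg_id.
split=> [x x0|v]; first exact: differentiable_Rinv.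
apply: (@Cn_on_eq _ _ _ _ (fun x : R^o => (- v : R) *: ((x^-1 : R) *: (x^-1 : R^o)))) => //.
  move=> x x0; rewrite derive_scale; last exact: differentiable_Rinv.
  have := @deriveV _ _ (id : R^o -> R^o) x (1 : R^o) x0 (@derivable_id _ _ _ _).
  rewrite derive_id => ->.
  by rewrite !scaleRE; field.
apply: (Cn_on_scale (f := fun=> (- v : R^o))) => //; first exact: Cn_on_cst.
exact: Cn_on_scale.
Qed.

Lemma smooth_inv V (U : set V) (f : V -> R^o) : open U ->
  (forall x, U x -> f x != 0) -> smooth_on U f -> smooth_on U (fun x => (f x : R)^-1 : R^o).
Proof. by move=> oU f0 sf; apply: (smooth_comp1 oU f0 smooth_inv1 sf). Qed.

End SmoothCalculus.

(** * Symmetry of second derivatives *)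
Section Schwarz.
Context {R : realType} {V : normedModType R}.
Implicit Types (f : V -> R^o) (U : set V) (u v p : V).

Lemma derive_translate (W : normedModType R) (g : V -> W) (c w q : V) :
  'D_w (fun q => g (c + q)) q = 'D_w g (c + q).
Proof.
apply: (congr1 (fun F : R -> W => lim (F @ 0^'))); apply/funext => h /=.
by rewrite addrCA.
Qed.

Lemma is_derive_ray (W : normedModType R) (f : V -> W) (v p : V) (s : R^o) :
  differentiable f (s *: v + p) ->
  is_derive s (1 : R^o) (fun t : R^o => f ((t : R) *: v + p)) ('D_v f (s *: v + p)).
Proof.
move=> df; apply: (@is_derive_chain _ _ _ _ f (fun t : R^o => (t : R) *: v + p)) => //.
have dZ : is_derive s (1 : R^o) (fun t : R^o => (t : R) *: v) v.
  rewrite -[X in is_derive _ _ _ X](scale1r v).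
  apply: (@is_derive_lin _ _ _ _ (fun a : R^o => (a : R) *: v) id) => //.
  - exact: scalel_continuous.
  - by move=> k a b; rewrite -scalerBl scalerA.
have := is_deriveD dZ (is_derive_cst p s (1 : R^o)).
by rewrite addr0.
Qed.

Lemma MVT_ray (f : V -> R^o) U v p (d : R) : smooth_on U f -> 0 < d ->
  (forall s, 0 <= s <= d -> U (s *: v + p)) ->
  exists2 s, 0 <= s <= d & f (d *: v + p) - f p = d * 'D_v f (s *: v + p).
Proof.
move=> sf d0 hU.
have D s : 0 <= s <= d -> is_derive (s : R^o) (1 : R^o) (fun t : R^o => f ((t : R) *: v + p)) ('D_v f (s *: v + p)).
  by move=> sd; apply: is_derive_ray; apply: smooth_differentiable sf (hU _ sd).
have [s||s sd] := @MVT R (fun t : R => f (t *: v + p)) (fun s : R => 'D_v f (s *: v + p)) 0 d d0.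
- by rewrite in_itv /= => /andP[s0 sd]; apply: D; rewrite !ltW.
- apply: derivable_within_continuous => s; rewrite in_itv /= => sd.
  by have [] := D _ sd.
- rewrite scale0r add0r subr0 => ->; exists s; last by rewrite mulrC.
  by move: sd; rewrite in_itv /= => /andP[s0 sd]; rewrite !ltW.
Qed.

(** The left-hand side is symmetric in [u] and [v].  Two applications of the mean
value theorem, first along [u] to the difference in the direction [v], then along
[v], express it by the mixed derivative. *)
Lemma second_difference f U u v p (d : R) : open U -> smooth_on U f -> 0 < d ->
  (forall s t, 0 <= s <= d -> 0 <= t <= d -> U (s *: u + (t *: v + p))) ->
  exists s t, [/\ 0 <= s <= d, 0 <= t <= d &
    f (d *: u + (d *: v + p)) - f (d *: u + p) - f (d *: v + p) + f p =
    d ^+ 2 * 'D_v ('D_u f) (s *: u + (t *: v + p))].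
Proof.
move=> oU sf d0 hU.
pose U' := [set q | U q /\ U (d *: v + q)].
have oU' : open U'.
  apply: openI => //; rewrite (_ : (fun q => _) = (fun q => d *: v + q) @^-1` U) //.
  by apply: open_comp => // q _; apply: cvgD; [exact: cvg_cst|exact: cvg_id].
have sft : smooth_on U' (fun q => f (d *: v + q)).
  move=> n; elim: n (f) (sf n) => [|n IH] g.
    move=> /= cg q [_ Uq]; apply: (@continuous_comp _ _ _ (fun q => d *: v + q) g).
      by apply: cvgD; [exact: cvg_cst|exact: cvg_id].
    exact: cg.
  move=> [dg Dg]; split=> [q [_ Uq]|w].
    apply: (@differentiable_comp _ _ _ _ (fun q => d *: v + q) g); last exact: dg.
    exact: ex_diff.
  apply: (@Cn_on_eq _ _ _ _ _ (fun q => 'D_w g (d *: v + q))) (IH _ (Dg w)); first exact: oU'.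
  move=> q [_ Uq].
  by rewrite derive_translate.
have sg : smooth_on U' (fun q => f (d *: v + q) - f q : R^o).
  apply: smooth_sub => //; apply: smooth_subset sf; by move=> q [].
have dd : 0 <= d <= d by rewrite (ltW d0) lexx.
have z0 : (0 : R) <= 0 <= d by rewrite lexx (ltW d0).
have [|s sd E] := @MVT_ray (fun q => f (d *: v + q) - f q : R^o) U' u p d sg d0.
  move=> s sd; split; last by rewrite addrCA; exact: hU.
  by have := hU _ 0 sd z0; rewrite scale0r add0r.
have [|t td E2] := @MVT_ray ('D_u f) U v (s *: u + p) d (smooth_derive u sf) d0.
  by move=> t td; rewrite addrCA; exact: hU.
exists s, t; split; [exact: sd|exact: td|].
have Us : U (s *: u + p) by have := hU _ 0 sd z0; rewrite scale0r add0r.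
have Us' : U (d *: v + (s *: u + p)) by rewrite addrCA; exact: hU.
move: E; rewrite deriveB; last 2 first.
- have := smooth_differentiable sft (conj Us Us'); exact: diff_derivable.
- by apply: diff_derivable; exact: smooth_differentiable sf Us.
have -> : 'D_u (fun q => f (d *: v + q)) (s *: u + p) = 'D_u f (d *: v + (s *: u + p)).
  by rewrite derive_translate.
rewrite E2 mulrA -expr2 [in s *: u + (t *: v + p)]addrCA => <-.
by rewrite [d *: v + (d *: u + p)]addrCA; ring.
Qed.

(** Both mixed derivatives take the same value at two points of a parallelogram
with sides [d *: u] and [d *: v]; as [d] tends to 0 both points tend to [p]. *)
Lemma derive_comm f U u v p : open U -> smooth_on U f -> U p ->
  'D_u ('D_v f) p = 'D_v ('D_u f) p.
Proof.
move=> oU sf Up; set a := LHS; set b := RHS.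
apply/eqP; rewrite -subr_eq0 -normr_le0; apply/ler_addgt0Pl => e e0; rewrite addr0.
have e20 : 0 < e / 2 by rewrite divr_gt0.
have ca := smooth_continuous (smooth_derive u (smooth_derive v sf)) Up.
have cb := smooth_continuous (smooth_derive v (smooth_derive u sf)) Up.
have {}ca : \forall q \near p, `|a - 'D_u ('D_v f) q| < e / 2 by move/cvgrPdist_lt : ca; apply.
have {}cb : \forall q \near p, `|b - 'D_v ('D_u f) q| < e / 2 by move/cvgrPdist_lt : cb; apply.
have : \forall q \near p, [/\ U q, `|a - 'D_u ('D_v f) q| < e / 2 & `|b - 'D_v ('D_u f) q| < e / 2].
  by apply: filterS3 (near_open oU Up) ca cb.
move=> /nbhs_ballP[r /= r0 Br].
pose d := r / 2 / (`|u| + `|v| + 1).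
have uv0 : 0 < `|u| + `|v| + 1 by rewrite ltr_wpDl // addr_ge0.
have d0 : 0 < d by rewrite !divr_gt0.
have dE : d * (`|u| + `|v| + 1) = r / 2 by rewrite /d divfK // gt_eqF.
have N s t : 0 <= s <= d -> 0 <= t <= d -> ball p r (s *: u + (t *: v + p)).
  move=> /andP[s0 sd] /andP[t0 td]; rewrite -ball_normE /= addrA opprD addrCA subrr addr0.
  rewrite normrN; apply: (le_lt_trans (ler_normD _ _)); rewrite !normrZ !ger0_norm //.
  have su := ler_wpM2r (normr_ge0 u) sd; have tv := ler_wpM2r (normr_ge0 v) td.
  apply: (le_lt_trans (lerD su tv)); rewrite -mulrDr.
  apply: (@lt_trans _ _ (r / 2)); last by rewrite gtr_pMr ?invf_lt1 // ltr1n.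
  by rewrite -dE ltr_pM2l // ltrDl.
have hU s t : 0 <= s <= d -> 0 <= t <= d -> U (s *: u + (t *: v + p)).
  by move=> sd td; have [] := Br _ (N s t sd td).
have [s [t [sd td E]]] := second_difference oU sf d0 hU.
have hU' a1 a2 : 0 <= a1 <= d -> 0 <= a2 <= d -> U (a1 *: v + (a2 *: u + p)).
  by move=> h1 h2; rewrite addrCA; exact: hU.
have [s' [t' [sd' td' E']]] := second_difference oU sf d0 hU'.

have [_ _ Hb] := Br _ (N _ _ sd td).
have := N _ _ td' sd'; rewrite addrCA => /Br[_ Ha _].
have EE : d ^+ 2 * 'D_v ('D_u f) (s *: u + (t *: v + p)) = d ^+ 2 * 'D_u ('D_v f) (s' *: v + (t' *: u + p)).
  apply: etrans (esym E) (etrans _ E').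
  by congr (_ + _); rewrite [RHS]addrAC addrCA.
have {}EE : 'D_v ('D_u f) (s *: u + (t *: v + p)) = 'D_u ('D_v f) (s' *: v + (t' *: u + p)).
  by apply: (mulfI _ EE); rewrite expf_eq0 /= gt_eqF.
rewrite EE in Hb; set x := 'D_u _ _ in Ha Hb *.
rewrite (_ : a - b = (a - x) - (b - x)); last by ring.
apply: (le_trans (ler_normB _ _)).
have -> : e = e / 2 + e / 2 by exact: splitr.
by apply: lerD; apply: ltW; [exact: Ha|exact: Hb].
Qed.

End Schwarz.

(** * Brackets of vector fields *)
Section Bracket.
Context {R : realType}.
Implicit Types (L : set (pt R)) (p q u v w : pt R) (X Y : pt R -> pt R).

Definition e_r : pt R := (1, 0, 0).
Definition e_x (i : 'I_3) : pt R := (0, delta_mx 0 i, 0).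

Lemma pt_coords v :
  v = v.1.1 *: e_r + \sum_(i < 3) v.1.2 0 i *: e_x i + v.2 *: ddt.
Proof.
apply: pt_eq => [|j|].
- rewrite !ptE /= (big_morph (fun u : pt R => u.1.1) (fun _ _ => erefl) erefl).
  rewrite big1 => [|i _]; last by rewrite !ptE mulr0.
  by rewrite mulr1 mulr0 !addr0.
- rewrite !ptE !mxE /= !mulr0 add0r addr0.
  rewrite (big_morph (fun u : pt R => u.1.2) (fun _ _ => erefl) erefl) summxE.
  rewrite (bigD1 j) //= big1 => [|i ij]; last by rewrite !mxE eqxx (negPf (_ : j != i)) 1?eq_sym // mulr0.
  by rewrite !mxE !eqxx mulr1 addr0.
- rewrite !ptE /= (big_morph (fun u : pt R => u.2) (fun _ _ => erefl) erefl).
  rewrite big1 => [|i _]; last by rewrite !ptE mulr0.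
  by rewrite mulr1 mulr0 !add0r.
Qed.

Lemma derive_coords (f : pt R -> R^o) q v : differentiable f q ->
  'D_v f q = v.1.1 * 'D_e_r f q + \sum_(i < 3) v.1.2 0 i * 'D_(e_x i) f q + v.2 * 'D_ddt f q.
Proof.
move=> df; rewrite !deriveE // [in LHS](pt_coords v) !linearD !linearZ linear_sum /=.
congr (_ + _ + _); apply: eq_bigr => i _.
by rewrite deriveE // linearZ.
Qed.

(** The product rule for the pairing of the differential of [f] with [Y].  Expanding
[Y] in coordinates avoids the differential as an operator-valued function. *)
Lemma is_derive_along (U : set (pt R)) (f : pt R -> R^o) p u Y DY :
  open U -> smooth_on U f -> U p -> is_derive p u Y DY ->
  is_derive p u (fun q => 'D_(Y q) f q : R^o) ('D_DY f p + 'D_u ('D_(Y p) f) p).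
Proof.
move=> oU sf Up dY.
have fd q : U q -> differentiable f q by move=> Uq; exact: smooth_differentiable sf Uq.
have dd e : is_derive p u ('D_e f) ('D_u ('D_e f) p).
  exact: smooth_is_derive (smooth_derive e sf) Up.
have nearU := near_open oU Up.
have E w : 'D_u ('D_w f) p = w.1.1 * 'D_u ('D_e_r f) p +
   \sum_(i < 3) w.1.2 0 i * 'D_u ('D_(e_x i) f) p + w.2 * 'D_u ('D_ddt f) p.
  have D : is_derive p u (w.1.1 \*: 'D_e_r f + \sum_(i < 3) w.1.2 0 i \*: 'D_(e_x i) f + w.2 \*: 'D_ddt f)
      (w.1.1 *: 'D_u ('D_e_r f) p + \sum_(i < 3) w.1.2 0 i *: 'D_u ('D_(e_x i) f) p + w.2 *: 'D_u ('D_ddt f) p).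
    exact: is_deriveD (is_deriveD (is_deriveZ _ (dd _)) (is_derive_sum (fun i => is_deriveZ _ (dd _)))) (is_deriveZ _ (dd _)).
  rewrite (near_eq_derive (g := w.1.1 \*: 'D_e_r f + \sum_(i < 3) w.1.2 0 i \*: 'D_(e_x i) f + w.2 \*: 'D_ddt f)).
    by have [_ ->] := D.
  apply: filterS nearU => q Uq; rewrite derive_coords; last exact: fd.
  by rewrite !fctE fct_sumE.
have D : is_derive p u ((fun q => (Y q).1.1 : R^o) * 'D_e_r f +
    \sum_(i < 3) (fun q => (Y q).1.2 0 i : R^o) * 'D_(e_x i) f + (fun q => (Y q).2 : R^o) * 'D_ddt f)
   (((Y p).1.1 *: 'D_u ('D_e_r f) p + 'D_e_r f p *: (DY.1.1 : R^o)) +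
    \sum_(i < 3) ((Y p).1.2 0 i *: 'D_u ('D_(e_x i) f) p + 'D_(e_x i) f p *: (DY.1.2 0 i : R^o)) +
    ((Y p).2 *: 'D_u ('D_ddt f) p + 'D_ddt f p *: (DY.2 : R^o)) : R^o).
  exact: is_deriveD (is_deriveD (is_deriveM (is_derive_r dY) (dd _))
    (is_derive_sum (fun i => is_deriveM (is_derive_x dY i) (dd _)))) (is_deriveM (is_derive_t dY) (dd _)).
apply: near_eq_is_derive (is_derive_eq D _).
  apply: filterS nearU => q Uq; rewrite derive_coords; last exact: fd.
  by rewrite !fctE fct_sumE.
have -> : \sum_(i < 3) ((Y p).1.2 0 i *: 'D_u ('D_(e_x i) f) p + 'D_(e_x i) f p *: (DY.1.2 0 i : R^o)) =
    \sum_(i < 3) DY.1.2 0 i * 'D_(e_x i) f p + \sum_(i < 3) (Y p).1.2 0 i * 'D_u ('D_(e_x i) f) p.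
  by rewrite -big_split; apply: eq_bigr => i _; rewrite !scaleRE addrC [X in X + _]mulrC.
rewrite (E (Y p)) (derive_coords DY (fd _ Up)) !scaleRE.
move: (\sum_(i < 3) _) (\sum_(i < 3) _) => S1 S2.
move: ('D_e_r f p : R) ('D_u _ p : R) ('D_ddt f p : R) ('D_u _ p : R) => A1 A2 A3 A4.
ring.
Qed.

(** The terms with second derivatives of [f] cancel by [derive_comm]. *)
Lemma derive_bracket (U : set (pt R)) (f : pt R -> R^o) p X Y :
  open U -> smooth_on U f -> U p -> differentiable X p -> differentiable Y p ->
  'D_(X p) (fun q => 'D_(Y q) f q : R^o) p - 'D_(Y p) (fun q => 'D_(X q) f q : R^o) p =
  'D_(bracket X Y p) f p.
Proof.
move=> oU sf Up dX dY.
have fd : differentiable f p by exact: smooth_differentiable sf Up.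
have DY := is_derive_along oU sf Up (derivableP (diff_derivable (v := X p) dY)).
have DX := is_derive_along oU sf Up (derivableP (diff_derivable (v := Y p) dX)).
apply: (etrans (congr2 (fun a b : R => a - b) (@derive_val _ _ _ _ _ _ _ DY) (@derive_val _ _ _ _ _ _ _ DX))).
have K (a1 a2 b1 b2 : R) : b1 = b2 -> (a1 + b1) - (a2 + b2) = a1 - a2 by move=> ->; ring.
apply: etrans (K _ _ _ _ (derive_comm (X p) (Y p) oU sf Up)) _.
apply: etrans (congr2 (fun a b : R => a - b) (deriveE _ fd) (deriveE _ fd)) _.
by apply: etrans (esym (linearB _ _ _)) (esym (deriveE _ fd)).
Qed.

(** A velocity at [p] of a curve in [L] only sees the values on [L]. *)
Lemma tangent_derive_eq L p v (W : normedModType R) (f g : pt R -> W) :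
  tangent_to L p v -> (\forall q \near p, L q -> f q = g q) ->
  differentiable f p -> differentiable g p -> 'D_v f p = 'D_v g p.
Proof.
move=> [gam [g0 dg Lg]] fg df dg'.
have cg : gam @ (0 : R^o) --> p.
  rewrite -g0; apply: differentiable_continuous; apply/derivable1_diffP; exact: ex_derive.
have D (h : pt R -> W) : differentiable h p -> is_derive (0 : R^o) (1 : R^o) (h \o gam) ('D_v h p).
  by move=> dh; rewrite -g0; apply: is_derive_chain => //; rewrite g0.
have [_ <-] := D _ df; have [_ <-] := D _ dg'.
apply: near_eq_derive; have := cg _ fg; apply: filterS2 Lg => s Ls; exact.
Qed.

End Bracket.

(** * Uniqueness of the Levi-Civita connection *)
Section Koszul.
Context {R : realType}.
Implicit Types (I : set R) (h : R -> R) (p q u v w : pt R) (X Y Z : pt R -> pt R) (U : set (pt R)).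

Lemma smooth_linear (V W W' : normedModType R) (U : set V) (L : W -> W') (f : V -> W) :
  open U -> linear L -> continuous L -> smooth_on U f -> smooth_on U (L \o f).
Proof.
move=> oU lL cL; pose lM := GRing.isLinear.Build _ _ _ _ _ lL.
pose L' : {linear W -> W'} := HB.pack L lM.
exact: (smooth_lin (L := L')).
Qed.

Section Components.
Variables (V : normedModType R) (U : set V) (oU : open U).

Lemma smooth_r (Y : V -> pt R) : smooth_on U Y -> smooth_on U (fun y => (Y y).1.1 : R^o).
Proof.
apply: (@smooth_linear _ _ _ _ (fun u : pt R => u.1.1 : R^o)) => // u.
by apply: (@cvg_comp _ _ _ (fun u : pt R => u.1) fst); apply: cvg_fst.
Qed.

Lemma smooth_x (Y : V -> pt R) : smooth_on U Y -> smooth_on U (fun y => (Y y).1.2).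
Proof.
apply: (@smooth_linear _ _ _ _ (fun u : pt R => u.1.2)) => // u.
by apply: (@cvg_comp _ _ _ (fun u : pt R => u.1) snd); [apply: cvg_fst|apply: cvg_snd].
Qed.

Lemma smooth_t (Y : V -> pt R) : smooth_on U Y -> smooth_on U (fun y => (Y y).2 : R^o).
Proof.
by apply: (@smooth_linear _ _ _ _ (fun u : pt R => u.2 : R^o)) => // u; apply: cvg_snd.
Qed.

Lemma smooth_coord (f : V -> 'rV[R]_3) i : smooth_on U f -> smooth_on U (fun y => f y 0 i : R^o).
Proof.
apply: (@smooth_linear _ _ _ _ (fun x : 'rV[R]_3 => x 0 i : R^o)) => //.
  by move=> a x y; rewrite !mxE.
exact: coord_continuous.
Qed.

Lemma smooth_dot (f g : V -> 'rV[R]_3) : smooth_on U f -> smooth_on U g ->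
  smooth_on U (fun y => dot (f y) (g y) : R^o).
Proof.
move=> sf sg; apply: smooth_sum => // i; apply: smooth_mul => //; exact: smooth_coord.
Qed.

End Components.

(** A polynomial vector field, tangent to all the spheres, that extends a tangent
vector at one point. *)
Definition tangent_extension v q : pt R :=
  (v.1.1, v.1.2 - dot q.1.2 v.1.2 *: q.1.2, v.2).

Lemma tangent_extension_at p v : tangent_space p v -> tangent_extension v p = v.
Proof.
by rewrite /tangent_space /tangent_extension /= => ->; rewrite scale0r subr0; case: v => -[].
Qed.

Lemma tangent_extension_field I p v : field_near I p (tangent_extension v).
Proof.
exists setT; first by split => //; exact: openT.
split=> [|q _ [_ q1]]; last first.
  by rewrite /tangent_space /= !dotE q1 mulr1 subrr.
have oT : open [set: pt R] by exact: openT.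
have sx : smooth_on setT (fun q : pt R => q.1.2) by apply: smooth_x => //; exact: smooth_id.
apply: smooth_pair => //; last exact: smooth_cst.
apply: smooth_pair => //; first exact: smooth_cst.
apply: smooth_sub => //; first exact: smooth_cst.
by apply: smooth_scale => //; apply: smooth_dot => //; exact: smooth_cst.
Qed.

Lemma metricC h p u v : metric h p u v = metric h p v u.
Proof. by rewrite /metric (dotC u.1.2); ring. Qed.

Lemma metricBl h p u v w : metric h p (u - v) w = metric h p u w - metric h p v w.
Proof. by rewrite /metric !ptE !dotE; ring. Qed.

Lemma metricBr h p u v w : metric h p w (u - v) = metric h p w u - metric h p w v.
Proof. by rewrite metricC metricBl !(metricC h p w). Qed.

Lemma dot0r (x : 'rV[R]_3) : dot x 0 = 0.
Proof. by rewrite -(scale0r 0) dotZr mul0r. Qed.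

Lemma dot0l (x : 'rV[R]_3) : dot 0 x = 0.
Proof. by rewrite dotC dot0r. Qed.

Lemma dot_ge0 (x : 'rV[R]_3) : 0 <= dot x x.
Proof. by apply: sumr_ge0 => i _; rewrite -expr2 sqr_ge0. Qed.

Lemma dot_eq0 (x : 'rV[R]_3) : dot x x = 0 -> x = 0.
Proof.
move=> /eqP; rewrite psumr_eq0 => [/allP x0|i _]; last by rewrite -expr2 sqr_ge0.
apply/rowP => i; have := x0 i (mem_index_enum i).
by rewrite mulf_eq0 orbb mxE => /eqP.
Qed.

(** Pair [u] with its reflection in time. *)
Lemma metric_nondegenerate h p u : 0 < h p.1.1 -> p.1.1 != 0 -> tangent_space p u ->
  (forall w, tangent_space p w -> metric h p u w = 0) -> u = 0.
Proof.
move=> h0 r0 tu /(_ (u.1.1, u.1.2, - u.2)) /(_ tu); rewrite /metric /= => E.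
have E1 : 0 <= u.1.1 * u.1.1 / h p.1.1 by apply: divr_ge0; [rewrite -expr2 sqr_ge0|rewrite ltW].
have E2 : 0 <= p.1.1 ^+ 2 * dot u.1.2 u.1.2 by rewrite mulr_ge0 ?sqr_ge0 ?dot_ge0.
have E3 : 0 <= h p.1.1 * u.2 * u.2 by rewrite -mulrA; apply: mulr_ge0; [rewrite ltW|rewrite -expr2 sqr_ge0].
have F1 : u.1.1 * u.1.1 / h p.1.1 = 0 by move: E; rewrite mulrN; lra.
have F2 : p.1.1 ^+ 2 * dot u.1.2 u.1.2 = 0 by move: E; rewrite mulrN; lra.
have F3 : h p.1.1 * u.2 * u.2 = 0 by move: E; rewrite mulrN; lra.
have hn0 : h p.1.1 != 0 by rewrite gt_eqF.
move/eqP: F1; rewrite !mulf_eq0 invr_eq0 (negPf hn0) orbF orbb => /eqP u1.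
move/eqP: F2; rewrite mulf_eq0 expf_eq0 (negPf r0) /= => /eqP/dot_eq0 u2.
move/eqP: F3; rewrite -mulrA !mulf_eq0 (negPf hn0) orbb /= => /eqP u3.
by apply: pt_eq => [|i|]; rewrite ?u1 ?u2 ?u3.
Qed.

(** The difference [T] of two such connections is symmetric (no torsion) and
skew (metric compatibility), hence zero, by the usual permutation of three
arguments.  This makes the connection explicit: [nabla] only enters the theorem
through [static_connection]. *)
Lemma levi_civita_unique I h (nabla : pt R -> pt R -> (pt R -> pt R) -> pt R) p v Y :
  static_data I h -> levi_civita I h nabla -> spacetime I p ->
  tangent_space p v -> field_near I p Y -> nabla p v Y = static_connection h p v Y.
Proof.
move=> sd lc Mp tv fY; have [oI _ I0 sh h0] := sd; have [Ip p1] := Mp.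
have [[aT _ _ _] tor met] := lc p Mp.
have [[aT' _ _ _] tor' met'] := levi_civita_exists sd Mp.
have r0 : p.1.1 != 0 by apply: contra_notN I0 => /eqP <-.
pose T u X := nabla p u X - static_connection h p u X.
have fT u : field_near I p (tangent_extension u) by exact: tangent_extension_field.
have tF X : field_near I p X -> tangent_space p (X p).
  by move=> [U [_ Up] [_]]; apply.
have sym X Z : field_near I p X -> field_near I p Z -> T (X p) Z = T (Z p) X.
  move=> fX fZ; have := tor X Z fX fZ; rewrite -(tor' X Z fX fZ) => E.
  move/eqP: E; rewrite subr_eq /T => /eqP ->.
  by rewrite [X in X - _]addrC -addrA [X in _ + X]addrAC subrr add0r.
have skew u X Z : tangent_space p u -> field_near I p X -> field_near I p Z ->
    metric h p (T u X) (Z p) = - metric h p (T u Z) (X p).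
  move=> tu fX fZ; have := met u X Z tu fX fZ; rewrite (met' u X Z tu fX fZ).
  rewrite /T !metricBl !(metricC h p (X p)) => E.
  by apply/eqP; rewrite -subr_eq0 opprK; apply/eqP; lra.
suff : T v Y = 0 by move/eqP; rewrite subr_eq0 => /eqP.
have tT : tangent_space p (T v Y).
  have := aT' v Y tv fY; have := aT v Y tv fY; rewrite /tangent_space /T /= => E1 E2.
  rewrite [X in dot _ X](_ : _ = (nabla p v Y).1.2 - (static_connection h p v Y).1.2) //.
  by rewrite dotDr dotNr E1 E2 subrr.
apply: (metric_nondegenerate (h0 _ Ip) r0 tT) => w tw.
pose A := tangent_extension v; pose C := tangent_extension w.
have Av : A p = v by exact: tangent_extension_at.
have Cw : C p = w by exact: tangent_extension_at.
have fA : field_near I p A by exact: fT.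
have fC : field_near I p C by exact: fT.
have tA := tF _ fA; have tC := tF _ fC; have tY := tF _ fY.
suff : metric h p (T (A p) Y) (C p) = 0 by rewrite Av Cw.
have : metric h p (T (A p) Y) (C p) = - metric h p (T (A p) Y) (C p).
  rewrite {1}skew // (sym A C) // skew // opprK (sym C Y) // skew //.
  by rewrite (sym Y A).
lra.
Qed.

End Koszul.

(** * Cross products and derivatives of scalar expressions *)
Section Cross.
Context {R : realType}.
Implicit Types (x y z d : 'rV[R]_3).

Lemma rowE3 : (forall (a : R) x i, (a *: x) 0 i = a * x 0 i) * (forall x y i, (x + y) 0 i = x 0 i + y 0 i)
  * (forall x i, (- x) 0 i = - x 0 i) * (forall i, (0 : 'rV[R]_3) 0 i = 0).
Proof. by do !split; move=> *; rewrite mxE. Qed.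

Definition cross x y : 'rV[R]_3 :=
  (x 0 1 * y 0 2 - x 0 2 * y 0 1) *: delta_mx 0 0 +
  (x 0 2 * y 0 0 - x 0 0 * y 0 2) *: delta_mx 0 1 +
  (x 0 0 * y 0 1 - x 0 1 * y 0 0) *: delta_mx 0 2.

Lemma dot3 x y : dot x y = x 0 0 * y 0 0 + x 0 1 * y 0 1 + x 0 2 * y 0 2.
Proof.
rewrite /dot !big_ord_recl big_ord0 addr0 addrA.
by congr (_ + _ * _ + _ * _); congr (_ 0 _); apply: val_inj.
Qed.

(** A rewrite rule giving the three coordinates at once. *)
Lemma cross3 x y : ((cross x y 0 0 = x 0 1 * y 0 2 - x 0 2 * y 0 1) *
  (cross x y 0 1 = x 0 2 * y 0 0 - x 0 0 * y 0 2) *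
  (cross x y 0 2 = x 0 0 * y 0 1 - x 0 1 * y 0 0))%type.
Proof. by do !split; rewrite /cross !mxE /= !mulr0 ?mulr1 ?addr0 ?add0r. Qed.

Lemma row3P x y : x 0 0 = y 0 0 -> x 0 1 = y 0 1 -> x 0 2 = y 0 2 -> x = y.
Proof.
move=> E0 E1 E2; apply/rowP => i; case: i => -[|[|[|//]]] Hi.
- by rewrite (_ : Ordinal Hi = 0) //; apply: val_inj.
- by rewrite (_ : Ordinal Hi = 1) //; apply: val_inj.
- by rewrite (_ : Ordinal Hi = 2) //; apply: val_inj.
Qed.

Lemma dot_cross_l x z : dot x (cross x z) = 0.
Proof. by rewrite dot3 !cross3; ring. Qed.

Lemma dot_cross_r x z : dot z (cross x z) = 0.
Proof. by rewrite dot3 !cross3; ring. Qed.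

Lemma dot_cross_swap x z d : dot z (cross x d) = - dot d (cross x z).
Proof. by rewrite !dot3 !cross3; ring. Qed.

Lemma dot_cross_cross x z : dot (cross x z) (cross x z) = dot x x * dot z z - dot x z ^+ 2.
Proof. by rewrite !dot3 !cross3; ring. Qed.

Lemma cross_self x : cross x x = 0.
Proof. by apply: row3P; rewrite !cross3 mxE; ring. Qed.

Lemma crossZr x z (a : R) : cross x (a *: z) = a *: cross x z.
Proof. by apply: row3P; rewrite !(rowE3, cross3); ring. Qed.

(** [x], [z] and their cross product are orthogonal and nonzero.  The identity in the
proof is Lagrange's, for [d] and the cross product. *)
Lemma cross_frame x z d : dot x x = 1 -> dot x z = 0 -> dot z z != 0 ->
  dot d x = 0 -> dot d z = 0 -> dot d (cross x z) = 0 -> d = 0.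
Proof.
move=> x1 xz z0 dx dz dw; apply: dot_eq0.
have : dot d d * dot (cross x z) (cross x z) =
  dot d (cross x z) ^+ 2 + dot d z ^+ 2 * dot x x + dot d x ^+ 2 * dot z z - 2 * dot d z * dot d x * dot x z.
  by rewrite !dot3 !cross3; ring.
rewrite dot_cross_cross dw dz dx x1 xz => /eqP.
rewrite expr0n /= !(mul0r, mulr0, addr0, subr0, mul1r) mulf_eq0 (negPf z0) orbF.
by move/eqP.
Qed.

End Cross.

(** The rules of differentiation for functions written with an explicit variable, so
that derivatives of long expressions can be assembled as terms. *)
Section ScalarCalculus.
Context {R : realType}.
Implicit Types (V W : normedModType R).

Lemma is_derive_add V W (f g : V -> W) q u a b :
  is_derive q u f a -> is_derive q u g b -> is_derive q u (fun y => f y + g y) (a + b).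
Proof. exact: is_deriveD. Qed.

Lemma is_derive_opp V W (f : V -> W) q u a :
  is_derive q u f a -> is_derive q u (fun y => - f y) (- a).
Proof. exact: is_deriveN. Qed.

Lemma is_derive_sub V W (f g : V -> W) q u a b :
  is_derive q u f a -> is_derive q u g b -> is_derive q u (fun y => f y - g y) (a - b).
Proof. exact: is_deriveB. Qed.

Lemma is_derive_mul V (f g : V -> R^o) q u a b :
  is_derive q u f a -> is_derive q u g b ->
  is_derive q u (fun y => (f y : R) * g y : R^o) (a * g q + f q * b : R^o).
Proof. exact: is_derive_scale. Qed.

Lemma is_derive_inv V (f : V -> R^o) q u a : f q != 0 -> is_derive q u f a ->
  is_derive q u (fun y => (f y : R)^-1 : R^o) (- a / f q ^+ 2 : R^o).
Proof.
move=> f0 df; split; first by apply: derivableV => //; exact: ex_derive.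
rewrite deriveV //; have [_ ->] := df.
by rewrite scaleRE; field.
Qed.

Lemma is_derive_dotV V (f g : V -> 'rV[R]_3) q u a b :
  is_derive q u f a -> is_derive q u g b ->
  is_derive q u (fun y => dot (f y) (g y) : R^o) (dot a (g q) + dot (f q) b : R^o).
Proof.
move=> df dg.
have E (e : V -> 'rV[R]_3) d : is_derive q u e d -> is_derive q u (fun y => (0, e y, 0) : pt R) (0, d, 0).
  move=> de; apply: is_derive_pair (is_derive_cst (0 : R^o) q u).
  exact: is_derive_pair (is_derive_cst (0 : R^o) q u) de.
exact: is_derive_dot (E _ _ df) (E _ _ dg).
Qed.

Lemma is_derive_entry V (f : V -> 'rV[R]_3) q u a i :
  is_derive q u f a -> is_derive q u (fun y => f y 0 i : R^o) (a 0 i : R^o).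
Proof.
apply: (@is_derive_lin _ _ _ _ (fun y : 'rV[R]_3 => y 0 i : R^o)); first exact: coord_continuous.
by move=> k x y; rewrite !mxE.
Qed.

Lemma is_derive_cross V (f g : V -> 'rV[R]_3) q u a b :
  is_derive q u f a -> is_derive q u g b ->
  is_derive q u (fun y => cross (f y) (g y)) (cross a (g q) + cross (f q) b).
Proof.
move=> df dg; have F i := is_derive_entry i df; have G i := is_derive_entry i dg.
have M i j := is_derive_sub (is_derive_mul (F i) (G j)) (is_derive_mul (F j) (G i)).
have S i j k := is_derive_scale (M i j) (is_derive_cst (delta_mx 0 k : 'rV[R]_3) q u).
apply: is_derive_eq (is_derive_add (is_derive_add (S 1 2 0) (S 2 0 1)) (S 0 1 2)) _.
by rewrite /cross; apply: row3P; rewrite !rowE3; ring.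
Qed.

Lemma smooth_cross V (U : set V) (f g : V -> 'rV[R]_3) : open U ->
  smooth_on U f -> smooth_on U g -> smooth_on U (fun y => cross (f y) (g y)).
Proof.
move=> oU sf sg; have F i := smooth_coord oU i sf; have G i := smooth_coord oU i sg.
have M i j := smooth_sub oU (smooth_mul oU (F i) (G j)) (smooth_mul oU (F j) (G i)).
have S i j k := smooth_scale oU (M i j) (smooth_cst U (delta_mx 0 k : 'rV[R]_3)).
exact: smooth_add oU (smooth_add oU (S 1 2 0) (S 2 0 1)) (S 0 1 2).
Qed.

Lemma is_derive_radius (q u : pt R) : is_derive q u (fun y : pt R => y.1.1 : R^o) (u.1.1 : R^o).
Proof. exact: (@is_derive_r _ _ id _ _ _ (is_derive_id q u)). Qed.

Lemma is_derive_x3 V (Y : V -> pt R) q u a :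
  is_derive q u Y a -> is_derive q u (fun y => (Y y).1.2) a.1.2.
Proof.
apply: (@is_derive_lin _ _ _ _ (fun u : pt R => u.1.2)) => // v.
by apply: (@cvg_comp _ _ _ (fun u : pt R => u.1) snd); [apply: cvg_fst|apply: cvg_snd].
Qed.

Lemma is_derive_sphere (q u : pt R) : is_derive q u (fun y : pt R => y.1.2) u.1.2.
Proof. exact: is_derive_x3 (is_derive_id q u). Qed.

Lemma is_derive_time (q u : pt R) : is_derive q u (fun y : pt R => y.2 : R^o) (u.2 : R^o).
Proof. exact: (@is_derive_t _ _ id _ _ _ (is_derive_id q u)). Qed.

Lemma is_derive_radial (phi : R^o -> R^o) (q u : pt R) : differentiable phi q.1.1 ->
  is_derive q u (fun y : pt R => phi y.1.1) (u.1.1 * 'D_1 phi q.1.1 : R^o).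
Proof.
move=> dphi; have := is_derive_chain (is_derive_radius q u) dphi.
by rewrite derive_scale.
Qed.

Lemma smooth_along (U : set (pt R)) (f : pt R -> R^o) (X : pt R -> pt R) : open U ->
  smooth_on U f -> smooth_on U X -> smooth_on U (fun q => 'D_(X q) f q : R^o).
Proof.
move=> oU sf sX; have sx := smooth_x oU sX.
have S : smooth_on U (fun q => (X q).1.1 * 'D_e_r f q + \sum_(i < 3) (X q).1.2 0 i * 'D_(e_x i) f q
    + (X q).2 * 'D_ddt f q : R^o).
  apply: smooth_add => //; first apply: smooth_add => //.
  - by apply: smooth_mul => //; [exact: smooth_r|exact: smooth_derive].
  - apply: smooth_sum => // i.
    by apply: smooth_mul => //; [exact: smooth_coord|exact: smooth_derive].
  - by apply: smooth_mul => //; [exact: smooth_t|exact: smooth_derive].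
apply: smooth_eq S => // q Uq; apply/esym; apply: derive_coords.
exact: smooth_differentiable sf Uq.
Qed.

End ScalarCalculus.

(** * Implicit functions *)
Section ImplicitCurve.
Context {R : realType}.

(** Near 0 the function is [c * t] up to a small multiple of the norm of [(s, t)].  So
[G (s, -)] changes sign between [- `|s|] and [`|s|], which gives a zero by the
intermediate value theorem, and any such zero is o(s). *)
Lemma implicit_zero (G : R^o * R^o -> R^o) (c : R) :
  (\forall w \near (0 : R^o * R^o), differentiable G w) -> G 0 = 0 ->
  'D_((1, 0) : R^o * R^o) G 0 = 0 -> 'D_((0, 1) : R^o * R^o) G 0 = c -> c != 0 ->
  exists tau : R^o -> R^o, [/\ tau 0 = 0, is_derive (0 : R^o) (1 : R^o) tau 0 &
    \forall s \near (0 : R^o), G (s, tau s) = 0].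
Proof.
move=> dG G0 Gs Gt c0.
have dG0 : differentiable G 0 by exact: nbhs_singleton dG.
have linE (w : R^o * R^o) : 'd G 0 w = c * w.2 :> R.
  have D1 : 'd G 0 ((1, 0) : R^o * R^o) = 0 by rewrite -deriveE.
  have D2 : 'd G 0 ((0, 1) : R^o * R^o) = c by rewrite -deriveE.
  have wE : w = (w.1 : R) *: ((1, 0) : R^o * R^o) + (w.2 : R) *: ((0, 1) : R^o * R^o).
    case: w => a b; apply: (congr2 pair).
      by change (a = a * 1 + b * 0); rewrite mulr1 mulr0 addr0.
    by change (b = a * 0 + b * 1); rewrite mulr1 mulr0 add0r.
  rewrite [in LHS]wE linearD !linearZ /= D1 D2 scaler0 add0r.
  exact: mulrC.
have small (e : R) : 0 < e -> \forall w \near (0 : R^o * R^o), `|G w - c * w.2| <= e * `|w|.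
  move=> e0; have /eqaddoP/(_ e e0) := diff_locally dG0.
  apply: filterS => w; rewrite /= /shift !fctE /=. by rewrite linE G0 addr0 add0r.
have ac0 : 0 < `|c| by rewrite normr_gt0.
have ac20 : 0 < `|c| / 2 by rewrite divr_gt0.
have /nbhs_ballP[d /= d0 Bd] : \forall w \near (0 : R^o * R^o), differentiable G w /\ `|G w - c * w.2| <= `|c| / 2 * `|w|.
  by apply: filterS2 dG (small _ ac20) => w.
have inB (s t : R^o) : `|s| < d -> `|t| <= `|s| -> ball (0 : R^o * R^o) d (s, t).
  by move=> sd ts; rewrite -ball_normE /= sub0r normrN prod_normE /= gt_max sd (le_lt_trans ts).
have zero (s : R^o) : `|s| < d -> exists t : R^o, `|t| <= `|s| /\ G (s, t) = 0.
  move=> sd.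
  have E1 (t : R^o) : `|t| = `|s| -> `|G (s, t) - c * t| <= `|c| / 2 * `|s|.
    move=> ts; have [|_ H] := Bd (s, t) _; first by apply: inB => //; rewrite ts.
    by apply: le_trans H _; rewrite prod_normE /= ts maxxx.
  have /E1 : `|(`|s| : R^o)| = `|s| by rewrite normr_id.
  have /E1 : `|(- `|s| : R^o)| = `|s| by rewrite normrN normr_id.
  rewrite !ler_norml mulrN opprK => /andP[L1 L2] /andP[L3 L4].
  have ab : - `|s| <= `|s| by apply: le_trans (normr_ge0 s); rewrite oppr_le0.
  have [||t] := @IVT R (fun t : R => G (s, t)) (- `|s|) `|s| 0 ab.
  - apply: continuous_in_subspaceT => t; rewrite inE /= in_itv /= -ler_norml => ts.
    apply: (@differentiable_continuous R R^o R^o t (G \o (fun t : R^o => (s, t)))).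
    apply: differentiable_comp; last by have [] := Bd _ (inB _ _ sd ts).
    by apply: differentiable_pair; [exact: differentiable_cst|exact: ex_diff].
  - have s0 := normr_ge0 s.
    rewrite ge_min le_max.
    move: L1 L2 L3 L4 (mulr_ge0 (normr_ge0 c) s0).
    by case: (lerP 0 c) => hc; [rewrite (ger0_norm hc)|rewrite (ltr0_norm hc)] => L1 L2 L3 L4 L5;
      apply/andP; split; apply/orP; [left|right|right|left]; nra.
  by rewrite in_itv /= -ler_norml => ts Gst; exists t.
pose tau (s : R^o) : R^o := xget 0 [set t : R^o | `|t| <= `|s| /\ G (s, t) = 0].
have tauP s : `|s| < d -> `|tau s| <= `|s| /\ G (s, tau s) = 0.
  by move=> /zero; exact: (@xgetPex _ (0 : R^o) [set t : R^o | `|t| <= `|s| /\ G (s, t) = 0]).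
have tau0 : tau 0 = 0.
  by have [] := tauP 0; rewrite normr0 // normr_le0 => /eqP.
have nd : \forall s \near (0 : R^o), `|s| < d.
  by have := @nbhs0_lt _ R^o _ d0.
exists tau; split=> //; last first.
  by apply: filterS nd => s /tauP[].
have C : (fun h : R => h^-1 *: (tau (h *: (1 : R^o) + 0) - tau 0)) @ 0^' --> (0 : R^o).
  apply/cvgrPdist_le => e e0; apply: cvg_within.
  have ec : 0 < e * `|c| by rewrite mulr_gt0.
  have /nbhs_ballP[d' /= d'0 Bd'] := small _ ec.
  have nd' : \forall s \near (0 : R^o), `|s| < d' by have := @nbhs0_lt _ R^o _ d'0.
  apply: filterS2 nd nd' => h hd hd'.
  rewrite tau0 subr0 addr0 sub0r normrN scaleRE mulr1 normrM.
  have [-> //|h0] := eqVneq h 0; first by rewrite invr0 normr0 mul0r ltW.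
  have [th Gh] := tauP h hd.
  have := Bd' (h, tau h); rewrite -ball_normE /= sub0r normrN prod_normE /= Gh sub0r normrN.
  rewrite gt_max hd' (le_lt_trans th hd') => /(_ isT).
  rewrite (max_idPl th) normrM -mulrA [e * _]mulrC -mulrA ler_pM2l // [`|h| * e]mulrC => H.
  by rewrite normfV mulrC ler_pdivrMr // normr_gt0.
split; first by apply/cvg_ex; exists (0 : R^o).
exact/cvg_lim.
Qed.

End ImplicitCurve.

(** * Charts of the spacetime *)
Section Chart.
Context {R : realType}.
Implicit Types (I : set R) (h : R -> R) (p q u v w : pt R) (L U : set (pt R)) (x y : 'rV[R]_3).

Definition horizontal x y : 'rV[R]_3 := y - dot x y *: x.

(** The inverse of stereographic projection from the antipode of [x], scaled so as to
be tangent to the identity at 0.  It is rational, and defined on all of R^3, the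
component along [x] being discarded. *)
Definition stereo x y : 'rV[R]_3 :=
  let y' := horizontal x y in let rho := dot y' y' / 4 in
  (1 + rho)^-1 *: ((1 - rho) *: x + y').

Definition chart p w : pt R := (p.1.1 + w.1.1, stereo p.1.2 w.1.2, p.2 + w.2).

Lemma dot_horizontal x y : dot x x = 1 -> dot x (horizontal x y) = 0.
Proof. by move=> x1; rewrite !dotE x1 mulr1 subrr. Qed.

Lemma horizontal_id x y : dot x y = 0 -> horizontal x y = y.
Proof. by rewrite /horizontal => ->; rewrite scale0r subr0. Qed.

Lemma stereo_rho (x : 'rV[R]_3) : 1 + dot x x / 4 != 0.
Proof. by rewrite gt_eqF // ltr_pwDl // divr_ge0 // dot_ge0. Qed.

Lemma dot_stereo x y : dot x x = 1 -> dot (stereo x y) (stereo x y) = 1.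
Proof.
move=> x1; rewrite /stereo; move: (horizontal x y) (dot_horizontal y x1) => z xz.
have n0 := stereo_rho z.
rewrite !dotE x1 (dotC z x) xz; move: (dot z z) n0 => a n0.
field.
by apply: contra_neq n0 => E; rewrite (_ : 1 + a / 4 = (4 + a) / 4); [rewrite E mul0r|field].
Qed.

Lemma stereo0 x : stereo x 0 = x.
Proof.
rewrite /stereo horizontal_id; last by rewrite dot0r.
by rewrite dot0r mul0r addr0 invr1 scale1r subr0 scale1r addr0.
Qed.

Lemma chart0 p : chart p 0 = p.
Proof. by rewrite /chart /= stereo0 !addr0; case: p => -[]. Qed.

Lemma chart_spacetime I p w : spacetime I p -> I (p.1.1 + w.1.1) -> spacetime I (chart p w).
Proof. by move=> [_ p1] Iw; split => //=; exact: dot_stereo. Qed.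

Lemma smooth_stereo (V : normedModType R) (U : set V) x (f : V -> 'rV[R]_3) :
  open U -> smooth_on U f -> smooth_on U (fun z => stereo x (f z)).
Proof.
move=> oU sf.
have sh : smooth_on U (fun z => horizontal x (f z)).
  apply: smooth_sub => //; apply: smooth_scale => //; last exact: smooth_cst.
  by apply: smooth_dot => //; exact: smooth_cst.
have srho : smooth_on U (fun z => dot (horizontal x (f z)) (horizontal x (f z)) / 4 : R^o).
  by apply: smooth_mul => //; [exact: smooth_dot|exact: smooth_cst].
have s1 : smooth_on U (fun=> 1 : R^o) by exact: smooth_cst.
apply: smooth_scale => //.
  apply: smooth_inv => //; last exact: smooth_add.
  by move=> y _; exact: stereo_rho.
apply: smooth_add => //; apply: smooth_scale => //; last exact: smooth_cst.
exact: smooth_sub.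
Qed.

Lemma stereo_onto x y : dot x x = 1 -> dot y y = 1 -> 1 + dot x y != 0 ->
  stereo x ((2 / (1 + dot x y)) *: horizontal x y) = y.
Proof.
move=> x1 y1 n0; rewrite /stereo.
rewrite (@horizontal_id x (_ *: _)); last by rewrite dotZr dot_horizontal // mulr0.
have -> : dot ((2 / (1 + dot x y)) *: horizontal x y) ((2 / (1 + dot x y)) *: horizontal x y) / 4 =
    (1 - dot x y) / (1 + dot x y).
  by rewrite /horizontal !dotE x1 y1 (dotC y x); field.
have -> : 1 + (1 - dot x y) / (1 + dot x y) = 2 / (1 + dot x y) by field.
rewrite /horizontal; apply/rowP => i; rewrite !mxE; field.
exact: n0.
Qed.

Lemma is_derive_stereo x y : dot x y = 0 -> is_derive 0 y (stereo x) y.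
Proof.
move=> xy; apply/is_derive_line.
pose rho : R := dot y y / 4.
pose n : R^o -> R^o := fun s => (1 + s * (s * rho))^-1.
have E : (fun s : R^o => stereo x ((s : R) *: y + 0)) =
    (fun s => ((n s : R) *: ((fun s : R^o => (((1 - s * (s * rho) : R^o) : R) *: x + (s : R) *: y)) s))).
  apply/funext => s; rewrite addr0 /stereo horizontal_id; last by rewrite dotZr xy mulr0.
  by rewrite !dotE /n /rho !mulrA.
rewrite E.
have dr : is_derive (0 : R^o) (1 : R^o) (fun s : R^o => s * (s * rho) : R^o) 0.
  have := is_deriveM (is_derive_id (0 : R^o) (1 : R^o)) (is_derive_affine 0 rho (0 : R^o)).
  rewrite (_ : _ * _ = (fun s : R^o => s * (s * rho) : R^o)); last first.
    by apply/funext => s; rewrite !fctE add0r.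
  by rewrite scale0r add0r mul0r addr0 scale0r.
have d1 : is_derive (0 : R^o) (1 : R^o) (fun s : R^o => 1 + s * (s * rho) : R^o) 0.
  by have := is_deriveD (is_derive_cst (1 : R^o) (0 : R^o) (1 : R^o)) dr; rewrite addr0.
have d2 : is_derive (0 : R^o) (1 : R^o) (fun s : R^o => 1 - s * (s * rho) : R^o) 0.
  by have := is_deriveB (is_derive_cst (1 : R^o) (0 : R^o) (1 : R^o)) dr; rewrite subr0.
have dn : is_derive (0 : R^o) (1 : R^o) n 0.
  have := is_deriveV _ d1; rewrite scaler0; apply.
  by rewrite mul0r addr0 oner_eq0.
have dZ (z : 'rV[R]_3) (f : R^o -> R^o) (df : R^o) : is_derive (0 : R^o) (1 : R^o) f df ->
    is_derive (0 : R^o) (1 : R^o) (fun s => (f s : R) *: z) ((df : R) *: z).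
  apply: (@is_derive_lin _ _ _ _ (fun a : R^o => (a : R) *: z)); first exact: scalel_continuous.
  by move=> k a d; rewrite -scalerBl scalerA.
have := is_derive_scale dn (is_deriveD (dZ x _ _ d2) (dZ y _ _ (is_derive_id (0 : R^o) (1 : R^o)))).
have -> : n 0 = 1 by rewrite /n mul0r addr0 invr1.
by rewrite !scale0r !add0r !scale1r.
Qed.

Lemma smooth_chart p : smooth_on setT (chart p).
Proof.
have oT : open [set: pt R] by exact: openT.
have si : smooth_on setT (id : pt R -> pt R) by exact: smooth_id.
apply: smooth_pair => //; last by apply: smooth_add => //; [exact: smooth_cst|exact: smooth_t].
apply: smooth_pair => //; first by apply: smooth_add => //; [exact: smooth_cst|exact: smooth_r].
by apply: smooth_stereo => //; exact: smooth_x.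
Qed.

Lemma is_derive_chart_at p a b :
  is_derive a b (chart p) (b.1.1, 'D_b.1.2 (stereo p.1.2) a.1.2, b.2).
Proof.
have ss : differentiable (stereo p.1.2) a.1.2.
  have oT : open [set: 'rV[R]_3] by exact: openT.
  by apply: (@smooth_differentiable _ _ _ setT) => //; apply: smooth_stereo => //; exact: smooth_id.
apply: is_derive_pair; first apply: is_derive_pair.
- by have := is_deriveD (is_derive_cst (p.1.1 : R^o) a b) (is_derive_radius a b); rewrite add0r.
- exact: (is_derive_chain (is_derive_sphere a b) ss).
- by have := is_deriveD (is_derive_cst (p.2 : R^o) a b) (is_derive_time a b); rewrite add0r.
Qed.

Lemma is_derive_chart p v : tangent_space p v -> is_derive 0 v (chart p) v.
Proof.
move=> tv; have := is_derive_chart_at p 0 v; have [_ ->] := is_derive_stereo tv.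
by case: v {tv} => -[].
Qed.

Definition chart_inv p q : pt R :=
  (q.1.1 - p.1.1, (2 / (1 + dot p.1.2 q.1.2)) *: horizontal p.1.2 q.1.2, q.2 - p.2).

Lemma chart_invK I p q : spacetime I p -> spacetime I q -> 1 + dot p.1.2 q.1.2 != 0 ->
  chart p (chart_inv p q) = q.
Proof.
move=> [_ p1] [_ q1] n0; rewrite /chart /= stereo_onto //.
by rewrite !(addrC p.1.1) !(addrC p.2) !subrK; case: q {q1 n0} => -[].
Qed.

Lemma chart_inv_self p : dot p.1.2 p.1.2 = 1 -> chart_inv p p = 0.
Proof.
by move=> p1; rewrite /chart_inv !subrr /horizontal p1 scale1r subrr scaler0.
Qed.

Lemma chart_inv_continuous p : dot p.1.2 p.1.2 = 1 ->
  {for p, continuous (chart_inv p)} /\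
  (\forall q \near p, 1 + dot p.1.2 q.1.2 != 0).
Proof.
move=> p1; pose U : set (pt R) := [set q | 1 + dot p.1.2 q.1.2 != 0].
have oT : open [set: pt R] by exact: openT.
have sd : smooth_on setT (fun q : pt R => 1 + dot p.1.2 q.1.2 : R^o).
  apply: smooth_add => //; first exact: smooth_cst.
  apply: smooth_dot => //; first exact: smooth_cst.
  by apply: smooth_x => //; exact: smooth_id.
have oU : open U.
  rewrite (_ : U = (fun q : pt R => 1 + dot p.1.2 q.1.2 : R^o) @^-1` [set x | x != 0]) //.
  apply: open_comp; first by move=> q _; exact: smooth_continuous sd _.
  exact: open_neq0.
have Up : U p by rewrite /U /= p1 gt_eqF // addr_gt0.
split; last exact: near_open oU Up.
have si : smooth_on U (id : pt R -> pt R) by exact: smooth_id.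
have sx := smooth_x oU si.
apply: (@smooth_continuous _ _ _ U) => //.
apply: smooth_pair => //; last by apply: smooth_sub => //; [exact: smooth_t|exact: smooth_cst].
apply: smooth_pair => //; first by apply: smooth_sub => //; [exact: smooth_r|exact: smooth_cst].
apply: smooth_scale => //.
  apply: smooth_mul => //; first exact: smooth_cst.
  by apply: smooth_inv => //; exact: smooth_subset sd.
apply: smooth_sub => //; apply: smooth_scale => //; last exact: smooth_cst.
by apply: smooth_dot => //; exact: smooth_cst.
Qed.

End Chart.

(** * Tangent spaces of null hypersurfaces *)
Section Tangent.
Context {R : realType}.
Implicit Types (I : set R) (h : R -> R) (p q u v n : pt R) (L U : set (pt R)).

Lemma near_radius I p : open I -> I p.1.1 -> \forall q \near p, I q.1.1.
Proof.
move=> oI Ip; have cr : (fun q : pt R => q.1.1) @ p --> p.1.1.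
  by apply: (@cvg_comp _ _ _ (fun u : pt R => u.1) fst); apply: cvg_fst.
exact: cr _ (open_nbhs_nbhs (conj oI Ip)).
Qed.

Definition combine v n (w : R^o * R^o) : pt R := (w.1 : R) *: v + (w.2 : R) *: n.

Lemma is_derive_combine v n (w e : R^o * R^o) :
  is_derive w e (combine v n) (combine v n e).
Proof.
have d1 : is_derive w e (fun w : R^o * R^o => w.1) e.1.
  by apply: (@is_derive_lin _ _ _ _ (fun w : R^o * R^o => w.1) id) => // u; exact: cvg_fst.
have d2 : is_derive w e (fun w : R^o * R^o => w.2) e.2.
  by apply: (@is_derive_lin _ _ _ _ (fun w : R^o * R^o => w.2) id) => // u; exact: cvg_snd.
have := is_deriveD (is_derive_scale d1 (is_derive_cst v w e)) (is_derive_scale d2 (is_derive_cst n w e)).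
by rewrite !scaler0 !addr0.
Qed.

Lemma smooth_combine v n : smooth_on setT (combine v n).
Proof.
have oT : open [set: R^o * R^o] by exact: openT.
have si : smooth_on setT (id : R^o * R^o -> R^o * R^o) by exact: smooth_id.
apply: smooth_add => //; apply: smooth_scale => //; try exact: smooth_cst.
  by apply: (@smooth_linear _ _ _ _ _ (fun w : R^o * R^o => w.1) id) => // u; exact: cvg_fst.
by apply: (@smooth_linear _ _ _ _ _ (fun w : R^o * R^o => w.2) id) => // u; exact: cvg_snd.
Qed.

Lemma combine0 v n : combine v n 0 = 0.
Proof. by rewrite /combine !scale0r addr0. Qed.

(** In the chart at [p], restrict [F] to the plane spanned by [v] and the transverse
direction [n], and solve for the coordinate along [n]. *)
Lemma curve_in_zero_set I U (F : pt R -> R^o) p v n :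
  open I -> spacetime I p -> open U -> U p -> smooth_on U F -> F p = 0 ->
  tangent_space p n -> 'D_n F p != 0 -> tangent_space p v -> 'D_v F p = 0 ->
  exists gamma : R^o -> pt R, [/\ gamma 0 = p, is_derive (0 : R^o) (1 : R^o) gamma v &
    \forall s \near (0 : R^o), [/\ spacetime I (gamma s), U (gamma s) & F (gamma s) = 0]].
Proof.
move=> oI Mp oU Up sF Fp tn dn tv dv; have [Ip p1] := Mp.
pose A := chart p \o combine v n.
have dA w : differentiable A w.
  apply: differentiable_comp; first by apply: (@smooth_differentiable _ _ _ setT) => //; exact: smooth_combine.
  by apply: (@smooth_differentiable _ _ _ setT) => //; exact: smooth_chart.
have A0 : A 0 = p by rewrite /A /= combine0 chart0.
have cA : {for 0, continuous A} by exact: differentiable_continuous.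
have derA e : tangent_space p (combine v n e) -> is_derive 0 e A (combine v n e).
  move=> te; have := is_derive_combine v n 0 e => de.
  have dc : differentiable (chart p) (combine v n 0).
    by apply: (@smooth_differentiable _ _ _ setT) => //; exact: smooth_chart.
  have [_ E] := is_derive_chart te.
  by have := is_derive_chain de dc; rewrite combine0 E.
have dF : differentiable F (A 0) by rewrite A0; exact: smooth_differentiable sF Up.
have UA : \forall w \near (0 : R^o * R^o), U (A w) /\ I (A w).1.1.
  apply: (cA [set q | U q /\ I q.1.1]); rewrite /= A0; exact: filterI (near_open oU Up) (near_radius oI Ip).
pose G := F \o A.
have [tau [t0 dt Gt]] : exists tau : R^o -> R^o, [/\ tau 0 = 0, is_derive (0 : R^o) (1 : R^o) tau 0 &
    \forall s \near (0 : R^o), G (s, tau s) = 0].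
  apply: (@implicit_zero _ G ('D_n F p)) => //.
  - apply: filterS UA => w [Uw _]; apply: differentiable_comp; first exact: dA.
    exact: smooth_differentiable sF Uw.
  - by rewrite /G /= A0.
  - have E : combine v n (1, 0) = v by rewrite /combine /= scale1r scale0r addr0.
    have := derA (1, 0); rewrite E => /(_ tv) d1.
    by have [_ ->] := is_derive_chain d1 dF; rewrite A0.
  - have E : combine v n (0, 1) = n by rewrite /combine /= scale1r scale0r add0r.
    have := derA (0, 1); rewrite E => /(_ tn) d1.
    by have [_ ->] := is_derive_chain d1 dF; rewrite A0.
pose c (s : R^o) : R^o * R^o := (s, tau s).
have dc : is_derive (0 : R^o) (1 : R^o) c (1, 0) by apply: is_derive_pair => //; exact: is_derive_id.
have c0 : c 0 = 0 by rewrite /c t0.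
exists (A \o c); split.
- by rewrite /= c0 A0.
- have E : combine v n (1, 0) = v by rewrite /combine /= scale1r scale0r addr0.
  have := derA (1, 0); rewrite E => /(_ tv)[_ d1].
  by have := is_derive_chain dc (dA (c 0)); rewrite c0 d1.
have cc : c @ (0 : R^o) --> (0 : R^o * R^o).
  rewrite -[X in _ --> X]c0; apply: differentiable_continuous; apply/derivable1_diffP; exact: ex_derive.
have N : \forall s \near (0 : R^o), U (A (c s)) /\ I (A (c s)).1.1 by exact: (cc _ UA).
move: N Gt; apply: filterS2 => s [Us Is] Gs.
by split; [exact: chart_spacetime|exact: Us|exact: Gs].
Qed.

Lemma tangent_to_space I L p v : L `<=` spacetime I -> L p -> tangent_to L p v -> tangent_space p v.
Proof.
move=> LM Lp tv.
have dx (q w : pt R) : is_derive q w (fun q : pt R => dot q.1.2 q.1.2 : R^o) (2 * dot q.1.2 w.1.2).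
  have di := is_derive_id q w.
  apply: is_derive_eq (is_derive_dot di di) _.
  by rewrite (dotC w.1.2); ring.
have : 'D_v (fun q : pt R => dot q.1.2 q.1.2 : R^o) p = 'D_v (cst (1 : R^o)) p.
  apply: (tangent_derive_eq tv) => //.
  - by apply: filterE => q /LM[].
  - have oT : open [set: pt R] by exact: openT.
    apply: (@smooth_differentiable _ _ _ setT) => //.
    by apply: smooth_dot => //; apply: smooth_x => //; exact: smooth_id.
rewrite derive_cst; have [_ ->] := dx p v; move=> /eqP.
by rewrite mulf_eq0 pnatr_eq0 => /eqP.
Qed.

Lemma hypersurface_tangent I L p U (F : pt R -> R^o) n v :
  open I -> L `<=` spacetime I -> L p -> open U -> U p -> smooth_on U F ->
  (forall q, U q -> spacetime I q -> (L q <-> F q = 0)) ->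
  tangent_space p n -> 'D_n F p != 0 ->
  tangent_to L p v <-> tangent_space p v /\ 'D_v F p = 0.
Proof.
move=> oI LM Lp oU Up sF LF tn dn; have Mp := LM _ Lp.
split=> [tv|[tv dv]].
  split; first exact: tangent_to_space LM Lp tv.
  have -> : 'D_v F p = 'D_v (cst (0 : R^o)) p.
    apply: (tangent_derive_eq tv) => //; last exact: smooth_differentiable sF Up.
    by apply: filterS (near_open oU Up) => q Uq Lq; apply/(LF q Uq (LM _ Lq)).
  exact: derive_cst.
have Fp : F p = 0 by apply/(LF p Up Mp).
have [gam [g0 dg ng]] := curve_in_zero_set oI Mp oU Up sF Fp tn dn tv dv.
exists gam; split=> //; apply: filterS ng => s [Ms Us Fs].
exact/(LF _ Us Ms).
Qed.

Section NullNormal.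
Variables (I : set R) (h : R -> R).

(** Inside the orthogonal of [ddt] the metric is positive definite. *)
Lemma spacelike_eq0 p u : 0 < h p.1.1 -> p.1.1 != 0 -> u.2 = 0 ->
  metric h p u u = 0 -> u = 0.
Proof.
move=> h0 r0 u2; rewrite /metric u2 mulr0 subr0 => /eqP.
rewrite paddr_eq0; last 2 first.
- by apply: divr_ge0; [rewrite -expr2 sqr_ge0|rewrite ltW].
- by rewrite mulr_ge0 ?sqr_ge0 ?dot_ge0.
rewrite !mulf_eq0 invr_eq0 (negPf r0) (gt_eqF h0) orbF orbb /=.
move=> /andP[/eqP u1 /eqP/dot_eq0 ux].
by apply: pt_eq => [|i|]; rewrite ?u1 ?u2 ?ux.
Qed.

Lemma metricZl p (a : R) u v : metric h p (a *: u) v = a * metric h p u v.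
Proof. by rewrite /metric !ptE !dotE; ring. Qed.

Lemma metricZr p (a : R) u v : metric h p u (a *: v) = a * metric h p u v.
Proof. by rewrite metricC metricZl metricC. Qed.

Lemma null_neq0 p u : 0 < h p.1.1 -> p.1.1 != 0 -> metric h p u u = 0 -> u != 0 -> u.2 != 0.
Proof. by move=> h0 r0 uu; apply: contra_neq => u2; exact: (spacelike_eq0 h0 r0 u2 uu). Qed.

(** Subtract the multiple of [v] that cancels the time component: the rest is null
and spacelike, so it vanishes. *)
Lemma null_orthogonal p u v : 0 < h p.1.1 -> p.1.1 != 0 ->
  metric h p u u = 0 -> metric h p v v = 0 -> metric h p u v = 0 -> v.2 != 0 ->
  u = (u.2 / v.2) *: v.
Proof.
move=> h0 r0 uu vv uv v2.
apply/eqP; rewrite -subr_eq0; apply/eqP; apply: (spacelike_eq0 h0 r0).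
  by rewrite !ptE; field.
rewrite metricBl !metricBr !metricZl !metricZr uu vv (metricC h p v) uv.
by rewrite !mulr0 !subr0.
Qed.

Lemma metric_ddt p u : metric h p u ddt = - h p.1.1 * u.2.
Proof.
rewrite /metric /= mulr0 mul0r add0r mulr1.
by rewrite dot0r mulr0 add0r mulNr.
Qed.

(** The null direction [eta] that makes [L] null is proportional to [xi], so the
tangent space lies in the orthogonal of [xi].  If it were smaller, every vector
would differ from a tangent vector by a multiple of [v], and [xi] would be
orthogonal to [ddt]; but a nonzero null vector is not. *)
Lemma null_hypersurface_tangent L p xi v : static_data I h ->
  null_hypersurface I h L -> L p ->
  tangent_to L p xi -> xi != 0 -> metric h p xi xi = 0 ->
  tangent_to L p v <-> tangent_space p v /\ metric h p xi v = 0.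
Proof.
move=> [oI _ I0 _ hpos] [[LM Lreg] Lnull] Lp txi xi0 xixi.
have [Ip p1] := LM _ Lp.
have r0 : p.1.1 != 0 by apply: contra_notN I0 => /eqP <-.
have h0 := hpos _ Ip.
have [U [F [[oU Up] sF LF [n tn dn]]]] := Lreg p Lp.
have dF : differentiable F p by exact: smooth_differentiable sF Up.
have K u := @hypersurface_tangent I L p U F n u oI LM Lp oU Up sF LF tn dn.
have [eta [eta0 teta etaT]] := Lnull p Lp.
have etaeta := etaT _ teta.
have eta2 := null_neq0 h0 r0 etaeta eta0.
have xi2 := null_neq0 h0 r0 xixi xi0.
have xieta : xi = (xi.2 / eta.2) *: eta.
  by apply: (null_orthogonal h0 r0 xixi etaeta _ eta2); rewrite metricC; exact: etaT.
have xiT u : tangent_to L p u -> metric h p xi u = 0.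
  by move=> tu; rewrite xieta metricZl etaT // mulr0.
split=> [tv|[tv xiv]]; first by split; [exact: tangent_to_space LM Lp tv|exact: xiT].
apply/K; split=> //; apply/eqP; apply: contraT => dv.
have tddt : tangent_space p ddt by rewrite /tangent_space /= dot0r.
pose a : R := 'D_ddt F p / 'D_v F p.
have : metric h p xi (ddt - a *: v) = 0.
  apply/xiT/K; split.
    by move: tddt tv; rewrite /tangent_space /= => t1 t2; rewrite dotDr dotNr dotZr t1 t2 mulr0 subr0.
  by rewrite deriveE // linearB linearZ /= -!deriveE // /a scaleRE divfK // subrr.
rewrite metricBr metricZr xiv mulr0 subr0 metric_ddt => /eqP.
by rewrite mulf_eq0 oppr_eq0 (gt_eqF h0) (negPf xi2).
Qed.

End NullNormal.
End Tangent.

(** * Two Riccati equations along an umbilic null hypersurface *)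
Section Algebra.
Context {R : realType}.

(** Deduces an equation from another one that is proportional to it, leaving the
proportionality to the decision procedure for fields. *)
Lemma eq_scaled (A B C D : R) (k : R) : A = B -> k != 0 -> A - B = k * (C - D) -> C = D.
Proof.
move=> -> k0; rewrite subrr => /esym/eqP; rewrite mulf_eq0 (negPf k0) subr_eq0 /=.
by move/eqP.
Qed.

(** The next three lemmas solve, for the directions [W], [V] and [Z], the two linear
equations satisfied by the derivative [da] of [al] and by the product [zd] of [z]
with its derivative: one is the derivative of the null condition, the other comes
from umbilicity ([W], [V]) or from a tangent bracket ([Z]).  The null condition
makes the determinant of this system a nonzero constant. *)
Lemma shear_W (al s H r zd da : R) : r != 0 -> s != 0 -> al ^+ 2 + s * (H / r ^+ 2) = 1 ->
  s * da = al * zd -> 2 * al * da + 2 * (H / r ^+ 2) * zd = 0 -> zd = 0 /\ da = 0.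
Proof.
move=> r0 s0 N E1 E2.
have zd0 : zd = 0.
  rewrite -[zd]mulr1 -N.
  transitivity (al * (al * zd - s * da) + s / 2 * (2 * al * da + 2 * (H / r ^+ 2) * zd)); first by field.
  by rewrite E1 E2; ring.
by split=> //; apply: (mulfI s0); rewrite E1 zd0 !mulr0.
Qed.

Lemma shear_V (al s H r zd da c k : R) : r != 0 -> s != 0 -> al ^+ 2 + s * (H / r ^+ 2) = 1 ->
  s * da - al * zd = c * s - k * al * s ^+ 2 ->
  2 * al * da + 2 * (H / r ^+ 2) * zd - 2 * k / r ^+ 2 * s * (H * s) = 0 ->
  zd = k * s ^+ 2 - al * c * s /\ da = c * (H / r ^+ 2) * s.
Proof.
move=> r0 s0 N E1 E2.
have zdE : zd = k * s ^+ 2 - al * c * s.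
  apply/eqP; rewrite -subr_eq0; apply/eqP.
  transitivity (- al * (s * da - al * zd - (c * s - k * al * s ^+ 2))
    + s / 2 * (2 * al * da + 2 * (H / r ^+ 2) * zd - 2 * k / r ^+ 2 * s * (H * s))
    + (1 - (al ^+ 2 + s * (H / r ^+ 2))) * (zd - k * s ^+ 2)); first by field.
  by rewrite E1 E2 N; ring.
split=> //; apply: (mulfI s0); apply/eqP; rewrite -subr_eq0; apply/eqP.
transitivity ((s * da - al * zd - (c * s - k * al * s ^+ 2)) + al * (zd - (k * s ^+ 2 - al * c * s))
   + c * s * (1 - (al ^+ 2 + s * (H / r ^+ 2)))); first by field.
by rewrite E1 zdE N; ring.
Qed.

Lemma geodesic_V (al s H r zd da k : R) : r != 0 -> s != 0 -> al ^+ 2 + s * (H / r ^+ 2) = 1 ->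
  k * s ^+ 2 + al * zd - s * da = 0 ->
  2 * al * da + 2 * (H / r ^+ 2) * zd - 2 * k * s * al = 0 -> zd = 0 /\ da = k * s.
Proof.
move=> r0 s0 N E1 E2.
have zd0 : zd = 0.
  rewrite -[zd]mulr1 -N.
  transitivity (al * (k * s ^+ 2 + al * zd - s * da) +
    s / 2 * (2 * al * da + 2 * (H / r ^+ 2) * zd - 2 * k * s * al)); first by field.
  by rewrite E1 E2; ring.
split=> //; apply: (mulfI s0); apply/eqP; rewrite -subr_eq0; apply/eqP.
transitivity (- (k * s ^+ 2 + al * zd - s * da)); first by rewrite zd0; ring.
by rewrite E1 oppr0.
Qed.
End Algebra.

(** [L] is umbilic on the open set [N], with the null normal [(r ^+ 2 * al, z, r ^+ 2 / h r)],
whose covariant derivative along a screen vector [u] is [mu * u] up to a multiple of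
the normal.  The hypothesis [umbilic] is this equation, written out with
[static_connection]. *)
Section Shearfree.
Context {R : realType}.
Variables (I : set R) (h : R -> R) (sd : static_data I h).
Variables (L N : set (pt R)) (al mu : pt R -> R^o) (z : pt R -> 'rV[R]_3).
Hypotheses (LM : L `<=` spacetime I) (oN : open N) (NI : forall q, N q -> I q.1.1).
Hypotheses (sal : smooth_on N al) (smu : smooth_on N mu) (sz : smooth_on N z).
Hypothesis z_neq0 : forall q, N q -> dot (z q) (z q) != 0.
Hypothesis null_eq : forall q, L q -> N q ->
  al q ^+ 2 + dot (z q) (z q) * (h q.1.1 / q.1.1 ^+ 2) = 1.
Hypothesis z_tangent : forall q, L q -> N q -> dot q.1.2 (z q) = 0.
Hypothesis tangentE : forall q u, L q -> N q ->
  tangent_to L q u <-> tangent_space q u /\ al q * u.1.1 / h q.1.1 + dot (z q) u.1.2 = u.2.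
Hypothesis bracket_tangent : forall X Y, smooth_on N X -> smooth_on N Y ->
  (forall q, L q -> N q -> tangent_to L q (X q)) ->
  (forall q, L q -> N q -> tangent_to L q (Y q)) ->
  forall q, L q -> N q -> tangent_to L q (bracket X Y q).
Local Notation h' r := ('D_(1 : R^o) (h : R^o -> R^o) r : R).
Hypothesis umbilic : forall q u v, L q -> N q ->
  tangent_to L q u -> tangent_to L q v -> u.2 = 0 -> v.2 = 0 ->
  let r := q.1.1 in let H := h r in
  (2 * r * u.1.1 * al q + r ^+ 2 * ('D_u al q : R) - h' r / (2 * H) * u.1.1 * (r ^+ 2 * al q)
    - r * H * dot u.1.2 (z q)) * v.1.1 / H
  + r ^+ 2 * dot ('D_u z q) v.1.2 + r * u.1.1 * dot (z q) v.1.2 + r ^+ 3 * al q * dot u.1.2 v.1.2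
  = mu q * (u.1.1 * v.1.1 / H + r ^+ 2 * dot u.1.2 v.1.2).

(** [h] times the logarithmic derivative of the optical radius [r / sqrt (h r)].  So
[r ^+ 2 / h r] has logarithmic derivative [2 * bend r / h r]. *)
Definition bend (r : R) : R := h r / r - h' r / 2.

(* [c] is the expansion of the normal for the metric divided by r^2.  [W] and [V]
   span the screen: [W] is orthogonal to the plane of the light ray through the
   centre, [V] lies in that plane. *)
Let s q : R^o := dot (z q) (z q).
Let c q : R^o := (mu q : R) - q.1.1 * (al q : R).
Let Z q : pt R := (q.1.1 ^+ 2 * al q, z q, q.1.1 ^+ 2 / h q.1.1).
Let W q : pt R := (0, cross q.1.2 (z q), 0).
Let V q : pt R := (h q.1.1 * s q, - (al q : R) *: z q, 0).

Let r_neq0 q : N q -> q.1.1 != 0.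
Proof. by move=> /NI Iq; have [_ _ I0 _ _] := sd; apply: contra_notN I0 => /eqP <-. Qed.

Let h_neq0 q : N q -> h q.1.1 != 0.
Proof. by move=> /NI Iq; have [_ _ _ _ h0] := sd; rewrite gt_eqF // h0. Qed.

Let sx : smooth_on N (fun y : pt R => y.1.2).
Proof. by apply: smooth_x => //; exact: smooth_id. Qed.
Let sr : smooth_on N (fun y : pt R => y.1.1 : R^o).
Proof. by apply: smooth_r => //; exact: smooth_id. Qed.
Let sradial (phi : R^o -> R^o) : smooth_on (I : set R^o) phi -> smooth_on N (fun y : pt R => phi y.1.1).
Proof. by move=> sphi; apply: (smooth_comp1 oN NI sphi sr). Qed.
Let sh : smooth_on N (fun y : pt R => h y.1.1 : R^o).
Proof. by have [_ _ _ sh _] := sd; exact: sradial sh. Qed.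
Let sr2 : smooth_on N (fun y : pt R => y.1.1 ^+ 2 : R^o).
Proof. exact: smooth_mul oN sr sr. Qed.
Let shi : smooth_on N (fun y : pt R => (h y.1.1)^-1 : R^o).
Proof. by apply: smooth_inv => // q; exact: h_neq0. Qed.
Let sr2i : smooth_on N (fun y : pt R => (y.1.1 ^+ 2)^-1 : R^o).
Proof. by apply: (smooth_inv oN _ sr2) => q Nq; rewrite expf_eq0 r_neq0. Qed.
Let sF : smooth_on N (fun y : pt R => h y.1.1 / y.1.1 ^+ 2 : R^o).
Proof. exact: smooth_mul oN sh sr2i. Qed.
Let sG : smooth_on N (fun y : pt R => y.1.1 ^+ 2 / h y.1.1 : R^o).
Proof. exact: smooth_mul oN sr2 shi. Qed.
Let ss : smooth_on N s.
Proof. exact: smooth_dot. Qed.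
Let sc : smooth_on N c.
Proof. exact: smooth_sub oN smu (smooth_mul oN sr sal). Qed.
Let sw : smooth_on N (fun y : pt R => cross y.1.2 (z y)).
Proof. exact: smooth_cross. Qed.
Let sZ : smooth_on N Z.
Proof. exact: smooth_pair oN (smooth_pair oN (smooth_mul oN sr2 sal) sz) sG. Qed.
Let s0 : smooth_on N (fun=> 0 : R^o).
Proof. exact: smooth_cst. Qed.
Let sW : smooth_on N W.
Proof. exact: smooth_pair oN (smooth_pair oN s0 sw) s0. Qed.
Let sV : smooth_on N V.
Proof.
exact: smooth_pair oN (smooth_pair oN (smooth_mul oN sh ss) (smooth_scale oN (smooth_opp oN sal) sz)) s0.
Qed.

Let dal q u : N q -> is_derive q u al ('D_u al q).
Proof. by move=> Nq; exact: smooth_is_derive sal Nq. Qed.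
Let dz q u : N q -> is_derive q u z ('D_u z q).
Proof. by move=> Nq; exact: smooth_is_derive sz Nq. Qed.
Let ds q u : N q -> is_derive q u s (2 * dot (z q) ('D_u z q)).
Proof.
move=> Nq; apply: is_derive_eq (is_derive_dotV (dz u Nq) (dz u Nq)) _.
by rewrite (dotC ('D_u z q)); ring.
Qed.
Let dh q u : N q -> is_derive q u (fun y : pt R => h y.1.1 : R^o) (u.1.1 * h' q.1.1 : R^o).
Proof.
move=> Nq; have [_ _ _ hs _] := sd.
apply: (is_derive_radial (phi := h : R^o -> R^o)).
exact: (smooth_differentiable hs (NI Nq)).
Qed.
Let dr1 q u : is_derive q u (fun y : pt R => y.1.1 : R^o) (u.1.1 : R^o).
Proof. exact: is_derive_radius. Qed.
Let dr2 q u : is_derive q u (fun y : pt R => y.1.1 ^+ 2 : R^o) (2 * q.1.1 * u.1.1 : R^o).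
Proof. by apply: is_derive_eq (is_derive_mul (dr1 q u) (dr1 q u)) _; ring. Qed.

Let dF q u : N q -> is_derive q u (fun y : pt R => h y.1.1 / y.1.1 ^+ 2 : R^o)
  (- 2 * bend q.1.1 / q.1.1 ^+ 2 * u.1.1 : R^o).
Proof.
move=> Nq; have r0 := r_neq0 Nq.
have di : is_derive q u (fun y : pt R => (y.1.1 ^+ 2)^-1 : R^o) (- (2 * q.1.1 * u.1.1) / (q.1.1 ^+ 2) ^+ 2 : R^o).
  by apply: (is_derive_inv (f := fun y : pt R => y.1.1 ^+ 2 : R^o)); [rewrite expf_eq0|exact: dr2].
apply: is_derive_eq (is_derive_mul (dh u Nq) di) _.
by rewrite /bend; field.
Qed.

Let dG q u : N q -> is_derive q u (fun y : pt R => y.1.1 ^+ 2 / h y.1.1 : R^o)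
  (2 * q.1.1 ^+ 2 * bend q.1.1 / h q.1.1 ^+ 2 * u.1.1 : R^o).
Proof.
move=> Nq; have r0 := r_neq0 Nq; have h0 := h_neq0 Nq.
have di : is_derive q u (fun y : pt R => (h y.1.1)^-1 : R^o) (- (u.1.1 * h' q.1.1) / (h q.1.1) ^+ 2 : R^o).
  by apply: (is_derive_inv (f := fun y : pt R => h y.1.1 : R^o)) => //; exact: dh.
apply: is_derive_eq (is_derive_mul (dr2 q u) di) _.
by rewrite /bend; field; rewrite r0 h0.
Qed.

Let dZ q u : N q -> is_derive q u Z
  (2 * q.1.1 * u.1.1 * al q + q.1.1 ^+ 2 * 'D_u al q, 'D_u z q,
   2 * q.1.1 ^+ 2 * bend q.1.1 / h q.1.1 ^+ 2 * u.1.1).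
Proof.
move=> Nq; exact: is_derive_pair (is_derive_pair (is_derive_mul (dr2 q u) (dal u Nq)) (dz u Nq)) (dG u Nq).
Qed.

Let dw q u : N q -> is_derive q u (fun y : pt R => cross y.1.2 (z y)) (cross u.1.2 (z q) + cross q.1.2 ('D_u z q)).
Proof. by move=> Nq; exact: is_derive_cross (is_derive_sphere q u) (dz u Nq). Qed.

Let dW q u : N q -> is_derive q u W (0, cross u.1.2 (z q) + cross q.1.2 ('D_u z q), 0).
Proof.
move=> Nq. have D1 := is_derive_pair (is_derive_cst (0 : R^o) q u) (dw u Nq). have D2 := is_derive_pair D1 (is_derive_cst (0 : R^o) q u). exact: D2.
Qed.

Let dV q u : N q -> is_derive q u V
  (u.1.1 * h' q.1.1 * s q + h q.1.1 * (2 * dot (z q) ('D_u z q)),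
   - ('D_u al q : R) *: z q - (al q : R) *: 'D_u z q, 0).
Proof.
move=> Nq; have D := is_derive_scale (is_derive_opp (dal u Nq)) (dz u Nq).
rewrite (scaleNr (al q)) in D.
exact: is_derive_pair (is_derive_pair (is_derive_mul (dh u Nq) (ds u Nq)) D) (is_derive_cst (0 : R^o) q u).
Qed.

Lemma diff_along q u f g a b : L q -> N q -> tangent_to L q u ->
  (forall y, L y -> N y -> f y = g y) -> smooth_on N f -> smooth_on N g ->
  is_derive q u f a -> is_derive q u g b -> a = b :> R^o.
Proof.
move=> Lq Nq tu fg sf sg [_ <-] [_ <-].
apply: (tangent_derive_eq tu); [|exact: smooth_differentiable sf Nq|exact: smooth_differentiable sg Nq].
by apply: filterS (near_open oN Nq) => y Ny Ly; exact: fg.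
Qed.

Let W_tangent q : L q -> N q -> tangent_to L q (W q).
Proof.
move=> Lq Nq; apply/tangentE => //; split; first exact: dot_cross_l.
by rewrite /= dot_cross_r mulr0 mul0r addr0.
Qed.

Let V_tangent q : L q -> N q -> tangent_to L q (V q).
Proof.
move=> Lq Nq; have h0 := h_neq0 Nq; apply/tangentE => //; split.
  by rewrite /tangent_space /= dotZr z_tangent // mulr0.
by rewrite /= dotZr /s; field.
Qed.

Let Z_tangent q : L q -> N q -> tangent_to L q (Z q).
Proof.
move=> Lq Nq; have h0 := h_neq0 Nq; have r0 := r_neq0 Nq.
apply/tangentE => //; split; first exact: z_tangent.
rewrite /=; transitivity (q.1.1 ^+ 2 / h q.1.1 * (al q ^+ 2 + dot (z q) (z q) * (h q.1.1 / q.1.1 ^+ 2))).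
  by field; rewrite r0 h0.
by rewrite null_eq // mulr1.
Qed.

Lemma derive_along_eq q u (f g : pt R -> R^o) : L q -> N q -> tangent_to L q u ->
  (forall y, L y -> N y -> f y = g y) -> smooth_on N f -> smooth_on N g ->
  'D_u f q = 'D_u g q.
Proof.
move=> Lq Nq tu fg sf sg.
by apply: (diff_along Lq Nq tu fg sf sg); exact: smooth_is_derive.
Qed.

Lemma smooth_bend : smooth_on (I : set R^o) (bend : R^o -> R^o).
Proof.
have [oI _ I0 hs _] := sd; have oI' : open (I : set R^o) by [].
apply: smooth_sub => //; apply: smooth_mul => //; try exact: smooth_cst.
- apply: (smooth_inv (f := id)) => //; last exact: smooth_id.
  by move=> r Ir; apply: contra_notN I0 => /eqP <-.
- exact: smooth_derive.
Qed.

(* The derivatives along L of the null condition, and of the condition that z is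
   tangent to the sphere. *)
Let dnull q u : L q -> N q -> tangent_to L q u ->
  2 * al q * 'D_u al q + 2 * (h q.1.1 / q.1.1 ^+ 2) * dot (z q) ('D_u z q)
  - 2 * bend q.1.1 / q.1.1 ^+ 2 * s q * u.1.1 = 0.
Proof.
move=> Lq Nq tu.
have D := is_derive_add (is_derive_mul (dal u Nq) (dal u Nq)) (is_derive_mul (ds u Nq) (dF u Nq)).
have E := diff_along Lq Nq tu _ _ _ D (is_derive_cst (1 : R^o) q u).
rewrite -[RHS]E; first by rewrite /s; ring.
- exact: null_eq.
- exact: smooth_add oN (smooth_mul oN sal sal) (smooth_mul oN ss sF).
- exact: smooth_cst.
Qed.

Let dsphere q u : L q -> N q -> tangent_to L q u -> dot q.1.2 ('D_u z q) = - dot u.1.2 (z q).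
Proof.
move=> Lq Nq tu; have D := is_derive_dotV (is_derive_sphere q u) (dz u Nq).
have E := diff_along Lq Nq tu _ _ _ D (is_derive_cst (0 : R^o) q u).
apply/eqP; rewrite -addr_eq0 addrC E //.
- exact: smooth_dot.
Qed.

Let frame q d : L q -> N q -> dot d q.1.2 = 0 -> dot d (z q) = 0 ->
  dot d (cross q.1.2 (z q)) = 0 -> d = 0.
Proof.
by move=> Lq Nq; have [_ q1] := LM Lq; apply: cross_frame => //; [exact: z_tangent|exact: z_neq0].
Qed.

Let cross_norm q : L q -> N q -> dot (cross q.1.2 (z q)) (cross q.1.2 (z q)) = s q.
Proof.
move=> Lq Nq; have [_ q1] := LM Lq.
by rewrite dot_cross_cross q1 z_tangent // expr0n /= subr0 mul1r.
Qed.

(* Umbilicity tested on the pairs (W, W) and (W, V) gives the components of the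
   derivative of z along the cross product and along z; the component along the
   position comes from [dsphere]. *)
Let derive_W q : L q -> N q ->
  'D_(W q) al q = 0 /\ 'D_(W q) z q = (c q : R) *: cross q.1.2 (z q).
Proof.
move=> Lq Nq; have r0 := r_neq0 Nq; have h0 := h_neq0 Nq.
have tW := W_tangent Lq Nq; have tV := V_tangent Lq Nq.
have wz : dot (cross q.1.2 (z q)) (z q) = 0 by rewrite dotC dot_cross_r.
have wx : dot (cross q.1.2 (z q)) q.1.2 = 0 by rewrite dotC dot_cross_l.
have U1 := umbilic Lq Nq tW tW erefl erefl.
have U2 := umbilic Lq Nq tW tV erefl erefl.
have D1 := dnull Lq Nq tW; have D2 := dsphere Lq Nq tW.
move: U1 U2 D1 D2; rewrite /= wz cross_norm // !dotZr wz dot_cross_r.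
set Da : R := 'D_(W q) al q; set Dz := 'D_(W q) z q; rewrite (dotC (z q) Dz) -/(s q).
move=> U1 U2 D1 D2.
have r20 : q.1.1 ^+ 2 != 0 by rewrite expf_eq0.
have E1 : dot Dz (cross q.1.2 (z q)) = c q * s q.
  by apply: (eq_scaled U1 r20); rewrite /c; field.
have E2 : s q * Da = al q * dot Dz (z q).
  by apply: (eq_scaled U2 r20); field.
have E3 : 2 * al q * Da + 2 * (h q.1.1 / q.1.1 ^+ 2) * dot Dz (z q) = 0.
  by rewrite -D1; ring.
have [zd da] := shear_W r0 (z_neq0 Nq) (null_eq Lq Nq) E2 E3.
split=> //; apply/eqP; rewrite -subr_eq0; apply/eqP.
apply: (frame Lq Nq); rewrite dotDl dotNl dotZl.
- by rewrite wx mulr0 subr0 dotC D2 oppr0.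
- by rewrite wz mulr0 subr0.
- by rewrite E1 cross_norm // subrr.
Qed.

Let derive_V q : L q -> N q ->
  'D_(V q) al q = c q * (h q.1.1 / q.1.1 ^+ 2) * s q :> R /\
  'D_(V q) z q = (bend q.1.1 * s q - c q * al q) *: z q + (al q * s q) *: q.1.2.
Proof.
move=> Lq Nq; have r0 := r_neq0 Nq; have h0 := h_neq0 Nq.
have tW := W_tangent Lq Nq; have tV := V_tangent Lq Nq.
have wz : dot (cross q.1.2 (z q)) (z q) = 0 by rewrite dotC dot_cross_r.
have U1 := umbilic Lq Nq tV tW erefl erefl.
have U2 := umbilic Lq Nq tV tV erefl erefl.
have D1 := dnull Lq Nq tV; have D2 := dsphere Lq Nq tV.
move: U1 U2 D1 D2; rewrite /= !(dotZr, dotZl) dot_cross_r -/(s q).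
set Da : R := 'D_(V q) al q; set Dz := 'D_(V q) z q; rewrite (dotC (z q) Dz).
move=> U1 U2 D1 D2.
have r20 : q.1.1 ^+ 2 != 0 by rewrite expf_eq0.
have E1 : dot Dz (cross q.1.2 (z q)) = 0.
  by apply: (eq_scaled U1 r20); field.
have NE := null_eq Lq Nq; rewrite -/(s q) in NE.
have E2 : s q * Da - al q * dot Dz (z q) = c q * s q - bend q.1.1 * al q * s q ^+ 2.
  have K : mu q * (h q.1.1 * s q * (h q.1.1 * s q) / h q.1.1 + q.1.1 ^+ 2 * (- al q * (- al q * s q)))
     = mu q * q.1.1 ^+ 2 * s q * (al q ^+ 2 + s q * (h q.1.1 / q.1.1 ^+ 2)) by field; rewrite r0 h0.
  have K2 : al q ^+ 2 = 1 - s q * (h q.1.1 / q.1.1 ^+ 2) by rewrite -NE addrK.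
  rewrite K NE mulr1 in U2.
  have K3 : q.1.1 ^+ 3 * al q * (- al q * (- al q * s q)) =
      q.1.1 ^+ 3 * al q * s q * (1 - s q * (h q.1.1 / q.1.1 ^+ 2)) by rewrite -K2; ring.
  rewrite K3 in U2.
  by apply: (eq_scaled U2 r20); rewrite /c /bend; field; rewrite r0 h0.
have E3 : 2 * al q * Da + 2 * (h q.1.1 / q.1.1 ^+ 2) * dot Dz (z q) -
    2 * bend q.1.1 / q.1.1 ^+ 2 * s q * (h q.1.1 * s q) = 0.
  by rewrite -D1; ring.
have [zd da] := shear_V r0 (z_neq0 Nq) NE E2 E3.
split=> //; apply/eqP; rewrite -subr_eq0; apply/eqP.
have [_ q1] := LM Lq; have xz := z_tangent Lq Nq.
apply: (frame Lq Nq); rewrite dotDl dotNl dotDl !dotZl.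
- by rewrite (dotC Dz) D2 (dotC (z q)) xz q1; ring.
- by rewrite zd xz -/(s q); ring.
- by rewrite E1 dot_cross_r dot_cross_l; ring.
Qed.

(* The two brackets while the derivatives along Z are still unknown; that they are
   tangent to L then determines these derivatives in [derive_Z], which says that
   the integral curves of Z are geodesics up to parametrization. *)
Let bracket_ZW q : L q -> N q -> bracket Z W q =
  (0, cross q.1.2 ('D_(Z q) z q) - (c q : R) *: cross q.1.2 (z q), 0).
Proof.
move=> Lq Nq; have [da dzE] := derive_W Lq Nq.
rewrite /bracket; have [_ ->] := dW (Z q) Nq; have [_ ->] := dZ (W q) Nq.
rewrite da dzE; apply: pt_eq => [|i|]; rewrite !ptE /= ?rowE3 ?cross_self ?rowE3; ring.
Qed.

Let bracket_ZV q : L q -> N q -> bracket Z V q =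
  (q.1.1 ^+ 2 * al q * h' q.1.1 * s q + h q.1.1 * (2 * dot (z q) ('D_(Z q) z q))
     - (2 * q.1.1 * (h q.1.1 * s q) * al q + h q.1.1 * c q * s q),
   - ('D_(Z q) al q : R) *: z q - (al q : R) *: 'D_(Z q) z q
     - ((bend q.1.1 * s q - c q * al q) *: z q + (al q * s q) *: q.1.2),
   - (2 * q.1.1 ^+ 2 * bend q.1.1 / h q.1.1 * s q)).
Proof.
move=> Lq Nq; have [da dzE] := derive_V Lq Nq; have r0 := r_neq0 Nq; have h0 := h_neq0 Nq.
rewrite /bracket; have [_ ->] := dV (Z q) Nq; have [_ ->] := dZ (V q) Nq.
rewrite da dzE; apply: pt_eq => [|i|]; rewrite !ptE /= ?rowE3.
- by field.
- by ring.
- by field.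
Qed.

Let derive_Z q : L q -> N q ->
  'D_(Z q) al q = bend q.1.1 * s q :> R /\ 'D_(Z q) z q = - (s q : R) *: q.1.2.
Proof.
move=> Lq Nq; have r0 := r_neq0 Nq; have h0 := h_neq0 Nq; have [_ q1] := LM Lq.
have tZ := Z_tangent Lq Nq; have xz := z_tangent Lq Nq.
have /(tangentE _ Lq Nq)[_] := bracket_tangent sZ sW Z_tangent W_tangent Lq Nq.
rewrite (bracket_ZW Lq Nq) /= dotDr dotNr dotZr dot_cross_r dot_cross_swap.
set Dz := 'D_(Z q) z q.
move=> /eqP; rewrite !(mulr0, mul0r, add0r, subr0) oppr_eq0 => /eqP Ew.
have /(tangentE _ Lq Nq)[_] := bracket_tangent sZ sV Z_tangent V_tangent Lq Nq.
rewrite (bracket_ZV Lq Nq) /= !(dotDr, dotNr, dotZr) -/Dz (dotC (z q) q.1.2) xz -/(s q).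
set Da : R := 'D_(Z q) al q; rewrite (dotC (z q) Dz) => B.
have D1 := dnull Lq Nq tZ; have D2 := dsphere Lq Nq tZ.
rewrite -/Dz -/Da (dotC (z q) Dz) /= in D1; rewrite -/Dz /= -/(s q) in D2.
have NE := null_eq Lq Nq; rewrite -/(s q) in NE.
have E3 : 2 * al q * Da + 2 * (h q.1.1 / q.1.1 ^+ 2) * dot Dz (z q) - 2 * bend q.1.1 * s q * al q = 0.
  by rewrite -D1; field.
have E2 : bend q.1.1 * s q ^+ 2 + al q * dot Dz (z q) - s q * Da = 0.
  have B2 := congr2 (fun a b : R => a + 2 * q.1.1 ^+ 2 * bend q.1.1 * s q / h q.1.1 * b) B NE.
  by apply: (eq_scaled B2 (oner_neq0 _)); rewrite /bend; field; rewrite r0 h0.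
have [zd da] := geodesic_V r0 (z_neq0 Nq) NE E2 E3.
split=> //; apply/eqP; rewrite -subr_eq0; apply/eqP.
apply: (frame Lq Nq); rewrite dotDl dotNl dotZl.
- by rewrite (dotC Dz) D2 q1; ring.
- by rewrite zd xz; ring.
- by rewrite Ew dot_cross_l; ring.
Qed.

Let derive_s_Z q : L q -> N q -> 'D_(Z q) s q = 0.
Proof.
move=> Lq Nq; have [_ ->] := ds (Z q) Nq; have [_ ->] := derive_Z Lq Nq.
by rewrite dotZr dotC z_tangent // !mulr0.
Qed.

Lemma bracket_Z_W q : L q -> N q -> bracket Z W q = - (c q : R) *: W q.
Proof.
move=> Lq Nq; rewrite bracket_ZW //; have [_ ->] := derive_Z Lq Nq.
apply: pt_eq => [|i|]; rewrite !ptE /= ?rowE3 ?crossZr ?cross_self ?rowE3; ring.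
Qed.

Lemma bracket_Z_V q : L q -> N q ->
  bracket Z V q = - (c q : R) *: V q - (2 * bend q.1.1 * s q) *: Z q.
Proof.
move=> Lq Nq; have r0 := r_neq0 Nq; have h0 := h_neq0 Nq.
rewrite bracket_ZV //; have [-> ->] := derive_Z Lq Nq.
apply: pt_eq => [|i|]; rewrite !ptE /= ?dotZr ?(dotC (z q)) ?z_tangent // ?rowE3.
- by rewrite /bend; field.
- by ring.
- by field.
Qed.

Let derive_lin q (f : pt R -> R^o) (a b : R) u v : smooth_on N f -> N q ->
  'D_(a *: u - b *: v) f q = a * 'D_u f q - b * 'D_v f q.
Proof.
move=> sf Nq; have df := smooth_differentiable sf Nq.
by rewrite !(deriveE _ df) linearB !linearZ.
Qed.

(** The commutator of [Z] and [W] applied to the component of [z] along the value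
[w0] at [p] of the cross product.  The orbital plane is constant along [Z], so
only [c] is differentiated there, and along [W] only the position is, which is
where the curvature of the sphere enters. *)
Lemma riccati_W p : L p -> N p -> 'D_(Z p) c p + c p ^+ 2 = - s p :> R.
Proof.
move=> Lp Np; pose w0 := cross p.1.2 (z p).
pose f : pt R -> R^o := fun q => dot (z q) w0.
have sf : smooth_on N f by apply: smooth_dot => //; exact: smooth_cst.
have df q u : N q -> 'D_u f q = dot ('D_u z q) w0.
  move=> Nq; have [_ ->] := is_derive_dotV (dz u Nq) (is_derive_cst w0 q u).
  by rewrite dot0r addr0.
have dZp : differentiable Z p by exact: smooth_differentiable sZ Np.
have dWp : differentiable W p by exact: smooth_differentiable sW Np.
have B := derive_bracket oN sf Np dZp dWp.
have E1 : 'D_(Z p) (fun q => 'D_(W q) f q : R^o) p = 'D_(Z p) c p * s p.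
  have sg : smooth_on N (fun q => (c q : R) * dot (cross q.1.2 (z q)) w0 : R^o).
    by apply: smooth_mul => //; apply: smooth_dot => //; exact: smooth_cst.
  rewrite (derive_along_eq Lp Np (Z_tangent Lp Np) _ (smooth_along oN sf sW) sg); last first.
    by move=> q Lq Nq; rewrite df //; have [_ ->] := derive_W Lq Nq; rewrite dotZl.
  have D := is_derive_mul (smooth_is_derive (Z p) sc Np) (is_derive_dotV (dw (Z p) Np) (is_derive_cst w0 p (Z p))).
  have [_ ->] := D.
  have [_ ->] := derive_Z Lp Np.
  rewrite /= cross_norm // dot0r addr0 cross_self crossZr cross_self scaler0 addr0.
  by rewrite dot0l mulr0 addr0.
have E2 : 'D_(W p) (fun q => 'D_(Z q) f q : R^o) p = - s p * s p.
  have sg : smooth_on N (fun q => - s q * dot q.1.2 w0 : R^o).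
    apply: smooth_mul => //; first exact: smooth_opp.
    by apply: smooth_dot => //; exact: smooth_cst.
  rewrite (derive_along_eq Lp Np (W_tangent Lp Np) _ (smooth_along oN sf sZ) sg); last first.
    by move=> q Lq Nq; rewrite df //; have [_ ->] := derive_Z Lq Nq; rewrite dotZl.
  have D := is_derive_mul (is_derive_opp (ds (W p) Np)) (is_derive_dotV (is_derive_sphere p (W p)) (is_derive_cst w0 p (W p))).
  have [_ ->] := D.
  rewrite /= cross_norm // dot0r addr0 dot_cross_l.
  by rewrite mulr0 add0r.
have E3 : 'D_(bracket Z W p) f p = - c p * (c p * s p).
  rewrite bracket_Z_W // (deriveE _ (smooth_differentiable sf Np)) linearZ /= -(deriveE _ (smooth_differentiable sf Np)).
  by rewrite df //; have [_ ->] := derive_W Lp Np; rewrite dotZl cross_norm.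
rewrite E1 E2 E3 in B.
by apply: (eq_scaled B (z_neq0 Np)); rewrite -/(s p); ring.
Qed.

(** The commutator of [Z] and [V] applied to [al].  Everything takes place in the
plane of the light ray, and the derivative of [bend] along [V] is the curvature
term. *)
Lemma riccati_V p : L p -> N p ->
  'D_(Z p) c p + c p ^+ 2 = p.1.1 ^+ 2 * 'D_(1 : R^o) (bend : R^o -> R^o) p.1.1 * s p :> R.
Proof.
move=> Lp Np; have r0 := r_neq0 Np; have h0 := h_neq0 Np.
have dZp : differentiable Z p by exact: smooth_differentiable sZ Np.
have dVp : differentiable V p by exact: smooth_differentiable sV Np.
have B := derive_bracket oN sal Np dZp dVp.
set k' : R := 'D_(1 : R^o) (bend : R^o -> R^o) p.1.1.
have E1 : 'D_(Z p) (fun q => 'D_(V q) al q : R^o) p =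
    'D_(Z p) c p * (h p.1.1 / p.1.1 ^+ 2) * s p - 2 * bend p.1.1 * al p * c p * s p.
  have sg : smooth_on N (fun q => (c q : R) * (h q.1.1 / q.1.1 ^+ 2) * s q : R^o).
    by apply: smooth_mul => //; exact: smooth_mul.
  rewrite (derive_along_eq Lp Np (Z_tangent Lp Np) _ (smooth_along oN sal sV) sg); last first.
    by move=> q Lq Nq; have [-> _] := derive_V Lq Nq.
  have D := is_derive_mul (is_derive_mul (smooth_is_derive (Z p) sc Np) (dF (Z p) Np)) (smooth_is_derive (Z p) ss Np).
  have [_ ->] := D.
  by rewrite derive_s_Z //=; field.
have E2 : 'D_(V p) (fun q => 'D_(Z q) al q : R^o) p =
    h p.1.1 * s p * k' * s p + bend p.1.1 * (2 * (bend p.1.1 * s p ^+ 2 - c p * al p * s p)).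
  have sg : smooth_on N (fun q => bend q.1.1 * s q : R^o).
    by apply: smooth_mul => //; apply: sradial; exact: smooth_bend.
  rewrite (derive_along_eq Lp Np (V_tangent Lp Np) _ (smooth_along oN sal sZ) sg); last first.
    by move=> q Lq Nq; have [-> _] := derive_Z Lq Nq.
  have dbend : differentiable (bend : R^o -> R^o) p.1.1.
    exact: smooth_differentiable smooth_bend (NI Np).
  have D := is_derive_mul (is_derive_radial (V p) dbend) (ds (V p) Np).
  have [_ ->] := D.
  have [_ ->] := derive_V Lp Np.
  by rewrite /= dotDr !dotZr (dotC (z p) p.1.2) z_tangent // -/(s p) -/k'; ring.
have E3 : 'D_(bracket Z V p) al p = - c p * (c p * (h p.1.1 / p.1.1 ^+ 2) * s p)
    - 2 * bend p.1.1 * s p * (bend p.1.1 * s p).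
  rewrite bracket_Z_V // derive_lin //.
  by have [-> _] := derive_V Lp Np; have [-> _] := derive_Z Lp Np.
rewrite E1 E2 E3 in B.
have k0 : h p.1.1 / p.1.1 ^+ 2 * s p != 0.
  by rewrite !mulf_neq0 // ?invr_eq0 ?expf_eq0 // z_neq0.
by apply: (eq_scaled B k0); field.
Qed.

(** The two Riccati equations have the same left-hand side. *)
Lemma weyl_eq0 p : L p -> N p ->
  1 + p.1.1 ^+ 2 * 'D_(1 : R^o) (bend : R^o -> R^o) p.1.1 = 0 :> R.
Proof.
move=> Lp Np; have E := riccati_V Lp Np; rewrite riccati_W // in E.
by apply: (eq_scaled E (_ : - s p != 0)); [rewrite oppr_eq0; exact: z_neq0|ring].
Qed.

Lemma moves_radially p : L p -> N p -> exists u, tangent_to L p u /\ u.1.1 != 0.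
Proof.
move=> Lp Np; exists (V p); split; first exact: V_tangent.
by rewrite /= mulf_neq0 //; [exact: h_neq0|exact: z_neq0].
Qed.

End Shearfree.

(** * Umbilic null hypersurfaces are radial *)
Section BracketTangent.
Context {R : realType}.
Implicit Types (I : set R) (L N : set (pt R)) (p q u v : pt R) (X Y : pt R -> pt R).

(** The derivatives of [f] along [X] and [Y] vanish on [L], so their derivatives along
[L] vanish as well. *)
Lemma bracket_constant L N (f : pt R -> R^o) (a : R) X Y q :
  open N -> smooth_on N f -> smooth_on N X -> smooth_on N Y ->
  (forall y, L y -> N y -> f y = a) ->
  (forall y, L y -> N y -> tangent_to L y (X y)) ->
  (forall y, L y -> N y -> tangent_to L y (Y y)) ->
  L q -> N q -> 'D_(bracket X Y q) f q = 0.
Proof.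
move=> oN sf sX sY fa tX tY Lq Nq.
have Z0 (T : pt R -> pt R) : (forall y, L y -> N y -> tangent_to L y (T y)) ->
    forall y, L y -> N y -> 'D_(T y) f y = 0.
  move=> tT y Ly Ny.
  rewrite (tangent_derive_eq (g := cst (a : R^o)) (tT _ Ly Ny)) ?derive_cst //.
    by apply: filterS (near_open oN Ny) => y' Ny' Ly'; exact: fa.
  exact: smooth_differentiable sf Ny.
have D (S T : pt R -> pt R) : smooth_on N T -> (forall y, L y -> N y -> tangent_to L y (S y)) ->
    (forall y, L y -> N y -> tangent_to L y (T y)) -> 'D_(S q) (fun y => 'D_(T y) f y : R^o) q = 0.
  move=> sT tS tT.
  rewrite (tangent_derive_eq (g := cst (0 : R^o)) (tS _ Lq Nq)) ?derive_cst //.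
    by apply: filterS (near_open oN Nq) => y Ny Ly; exact: Z0.
  exact: smooth_differentiable (smooth_along oN sf sT) Nq.
have B := derive_bracket oN sf Nq (smooth_differentiable sX Nq) (smooth_differentiable sY Nq).
by rewrite -B (D X Y) // (D Y X) // subrr.
Qed.

(** Apply [bracket_constant] to a defining function of [L], and to the function whose
level set is the sphere. *)
Lemma hypersurface_bracket I L N X Y q : open I -> hypersurface I L ->
  open N -> smooth_on N X -> smooth_on N Y ->
  (forall y, L y -> N y -> tangent_to L y (X y)) ->
  (forall y, L y -> N y -> tangent_to L y (Y y)) ->
  L q -> N q -> tangent_to L q (bracket X Y q).
Proof.
move=> oI [LM Lreg] oN sX sY tX tY Lq Nq.
have [U [F [[oU Uq] sF LF [n tn dn]]]] := Lreg q Lq.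
apply/(hypersurface_tangent _ oI LM Lq oU Uq sF LF tn dn).
have oNU : open (N `&` U) by exact: openI.
have sX' : smooth_on (N `&` U) X by apply: smooth_subset sX => y [].
have sY' : smooth_on (N `&` U) Y by apply: smooth_subset sY => y [].
have tX' y : L y -> (N `&` U) y -> tangent_to L y (X y) by move=> Ly [Ny _]; exact: tX.
have tY' y : L y -> (N `&` U) y -> tangent_to L y (Y y) by move=> Ly [Ny _]; exact: tY.
split; last first.
  apply: (bracket_constant (a := 0) oNU _ sX' sY' _ tX' tY') => //.
    by apply: smooth_subset sF => y [].
  by move=> y Ly [_ Uy]; apply/(LF y Uy (LM _ Ly)).
have sx : smooth_on (N `&` U) (fun y : pt R => y.1.2).
  by apply: smooth_x => //; exact: smooth_id.
have E : 'D_(bracket X Y q) (fun y : pt R => dot y.1.2 y.1.2 : R^o) q = 0.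
  apply: (bracket_constant (a := 1) oNU _ sX' sY' _ tX' tY') => //.
    exact: smooth_dot.
  by move=> y /LM[].
have [_ E'] := is_derive_dotV (is_derive_sphere q (bracket X Y q)) (is_derive_sphere q (bracket X Y q)).
move: E; rewrite E' (dotC _ q.1.2) -mulr2n -mulr_natl => /eqP.
by rewrite mulf_eq0 pnatr_eq0 => /eqP.
Qed.

End BracketTangent.

Section Radial.
Context {R : realType}.
Variables (I : set R) (h : R -> R) (sd : static_data I h).
Variable nabla : pt R -> pt R -> (pt R -> pt R) -> pt R.
Hypothesis lc : levi_civita I h nabla.

(** Up to the factor -1/2 this is r^2 h'' - 2 r h' + 2 h - 2, to which the Weyl tensor
of the static metric is proportional. *)
Definition weyl (r : R) : R := 1 + r ^+ 2 * 'D_(1 : R^o) (bend h : R^o -> R^o) r.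

Hypothesis weyl_simple : forall r, I r -> weyl r = 0 -> 'D_(1 : R^o) (weyl : R^o -> R^o) r != 0.

Variables (L : set (pt R)) (xi : pt R -> pt R) (rho : pt R -> R^o) (U U' : set (pt R)).
Hypotheses (nullL : null_hypersurface I h L) (oU : open U) (LU : L `<=` U) (fxi : field_on I U xi).
Hypothesis xiL : forall p, L p -> [/\ tangent_to L p (xi p), xi p != 0 & metric h p (xi p) (xi p) = 0].
Hypotheses (oU' : open U') (LU' : L `<=` U') (srho : smooth_on U' rho).
Hypothesis umb : forall p u v, L p -> screen h L p u -> screen h L p v ->
      null_second_form h nabla xi p u v = rho p * metric h p u v.

Let LM : L `<=` spacetime I. Proof. by case: nullL => -[]. Qed.

(* xi is f times the normal in the scaling of the preceding part. *)
Let f q : R^o := h q.1.1 * (xi q).2 / q.1.1 ^+ 2.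
Let al q : R^o := (xi q).1.1 / (h q.1.1 * (xi q).2).
Let z q : 'rV[R]_3 := (f q : R)^-1 *: (xi q).1.2.
Let mu q : R^o := - (rho q : R) / f q.

Let good q := [/\ U q, U' q, I q.1.1, (xi q).2 != 0 & dot (xi q).1.2 (xi q).1.2 != 0].
Let N := interior good.

(** Otherwise the preceding part applies near [p], with [weyl] vanishing at all radii
reached by [L] near [p].  As [L] moves in the radial direction at [p], the derivative of
[weyl] vanishes there too. *)
Lemma radial p : L p -> (xi p).1.2 = 0.
Proof.
move=> Lp; apply: dot_eq0; apply/eqP; apply: contraT => y0.
have [oI _ I0 hs hpos] := sd; have [sxi txi] := fxi.
have oN : open N by exact: open_interior.
have Ngood q : N q -> good q by exact: interior_subset.
have [Ip p1] := LM Lp.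
have h0 (q : pt R) : I q.1.1 -> h q.1.1 != 0 by move=> Iq; rewrite gt_eqF // hpos.
have r0 (q : pt R) : I q.1.1 -> q.1.1 != 0 by move=> Iq; apply: contra_notN I0 => /eqP <-.
have Np : N p.
  have Up := LU Lp.
  have [_ xi0 nxi] := xiL Lp.
  have b0 := null_neq0 (hpos _ Ip) (r0 _ Ip) nxi xi0.
  have near_neq0 (g : pt R -> R^o) : smooth_on U g -> g p != 0 -> \forall q \near p, g q != 0.
    move=> sg g0; have cg := smooth_continuous sg Up.
    have H : nbhs (g p) ([set x | x != 0] : set R^o) by apply: open_nbhs_nbhs; split; [exact: open_neq0|exact: g0].
    exact: (cg _ H).
  have nb := near_neq0 _ (smooth_t oU sxi) b0.
  have ny := near_neq0 _ (smooth_dot oU (smooth_x oU sxi) (smooth_x oU sxi)) y0.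
  have nI := near_radius oI Ip.
  have : \forall q \near p, good q.
    near=> q; split.
    - by near: q; exact: near_open oU Up.
    - by near: q; exact: near_open oU' (LU' Lp).
    - by near: q.
    - by near: q.
    - by near: q.
  by [].
have NI q : N q -> I q.1.1 by move=> /Ngood[].
have sxiN : smooth_on N xi by apply: smooth_subset sxi => q /Ngood[].
have sr : smooth_on N (fun q : pt R => q.1.1 : R^o) by apply: smooth_r => //; exact: smooth_id.
have sh : smooth_on N (fun q : pt R => h q.1.1 : R^o) by exact: (smooth_comp1 oN NI hs sr).
have shb : smooth_on N (fun q => h q.1.1 * (xi q).2 : R^o).
  by apply: smooth_mul => //; exact: smooth_t.
have hb0 q : N q -> h q.1.1 * (xi q).2 != 0.
  by move=> /Ngood[_ _ Iq b0 _]; rewrite mulf_neq0 // h0.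
have sf : smooth_on N f.
  apply: smooth_mul => //; apply: (smooth_inv oN _ (smooth_mul oN sr sr)) => q Nq.
  by rewrite mulf_neq0 // r0 //; exact: NI.
have f0 q : N q -> f q != 0.
  by move=> Nq; rewrite /f mulf_neq0 ?hb0 // invr_eq0 expf_eq0 /= r0 //; exact: NI.
have sal : smooth_on N al by apply: smooth_mul => //; [exact: smooth_r|exact: smooth_inv].
have sz : smooth_on N z by apply: smooth_scale => //; [exact: smooth_inv|exact: smooth_x].
have smu : smooth_on N mu.
  apply: smooth_mul => //; last exact: smooth_inv.
  by apply: smooth_opp => //; apply: smooth_subset srho => q /Ngood[].
have z0 q : N q -> dot (z q) (z q) != 0.
  by move=> Nq; rewrite dotZl dotZr !mulf_neq0 // ?invr_eq0 ?f0 //; have [] := Ngood _ Nq.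
have xiE q : N q -> xi q = (f q * (q.1.1 ^+ 2 * al q), (f q : R) *: z q, f q * (q.1.1 ^+ 2 / h q.1.1)).
  move=> Nq; have [_ _ Iq b0 _] := Ngood _ Nq.
  have h0q := h0 q Iq; have r0q := r0 q Iq.
  apply: pt_eq => [|i|] /=.
  - by rewrite /f /al; field; rewrite r0q h0q b0.
  - by rewrite /z scalerA divff ?f0 // scale1r.
  - by rewrite /f; field; rewrite r0q h0q.
have gxi q u : N q -> metric h q (xi q) u =
    f q * q.1.1 ^+ 2 * (al q * u.1.1 / h q.1.1 + dot (z q) u.1.2 - u.2).
  move=> Nq; have h0q := h0 q (NI _ Nq).
  by rewrite /metric (xiE q Nq) /= dotZl; field.
have fr0 q : N q -> f q * q.1.1 ^+ 2 != 0.
  by move=> Nq; rewrite mulf_neq0 ?f0 // expf_eq0 /= r0 //; exact: NI.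
have tangentE q u : L q -> N q ->
  tangent_to L q u <-> tangent_space q u /\ al q * u.1.1 / h q.1.1 + dot (z q) u.1.2 = u.2.
  move=> Lq Nq; have [txiq xi0 nxi] := xiL Lq.
  have K := @null_hypersurface_tangent _ _ _ L q (xi q) u sd nullL Lq txiq xi0 nxi.
  split=> [/K[tu]|[tu E]].
    rewrite gxi // => /eqP; rewrite mulf_eq0 (negPf (fr0 q Nq)) subr_eq0 /= => /eqP E.
    by split.
  by apply/K; split=> //; rewrite gxi // E subrr mulr0.
have null_eq q : L q -> N q -> al q ^+ 2 + dot (z q) (z q) * (h q.1.1 / q.1.1 ^+ 2) = 1.
  move=> Lq Nq; have [_ _ nxi] := xiL Lq.
  have h0q := h0 q (NI _ Nq); have r0q := r0 q (NI _ Nq).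
  rewrite gxi // (xiE q Nq) /= dotZr in nxi.
  have k0 : f q ^+ 2 * q.1.1 ^+ 4 / h q.1.1 != 0.
    by apply: mulf_neq0; [apply: mulf_neq0; apply: expf_neq0 => //; exact: f0|rewrite invr_eq0].
  by apply: (eq_scaled nxi k0); field; rewrite r0q h0q.
have zt q : L q -> N q -> dot q.1.2 (z q) = 0.
  move=> Lq Nq; have [Uq _ _ _ _] := Ngood _ Nq.
  by have := txi q Uq (LM Lq); rewrite /tangent_space /= dotZr => ->; rewrite mulr0.
have br X Y : smooth_on N X -> smooth_on N Y ->
  (forall q, L q -> N q -> tangent_to L q (X q)) ->
  (forall q, L q -> N q -> tangent_to L q (Y q)) ->
  forall q, L q -> N q -> tangent_to L q (bracket X Y q).
  by case: nullL => hypL _ sX sY tX tY q Lq Nq; apply: (hypersurface_bracket oI hypL oN sX sY).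
have um q u v : L q -> N q ->
  tangent_to L q u -> tangent_to L q v -> u.2 = 0 -> v.2 = 0 ->
  let r := q.1.1 in let H := h r in
  (2 * r * u.1.1 * al q + r ^+ 2 * ('D_u al q : R) - 'D_(1 : R^o) (h : R^o -> R^o) r / (2 * H) * u.1.1 * (r ^+ 2 * al q)
    - r * H * dot u.1.2 (z q)) * v.1.1 / H
  + r ^+ 2 * dot ('D_u z q) v.1.2 + r * u.1.1 * dot (z q) v.1.2 + r ^+ 3 * al q * dot u.1.2 v.1.2
  = mu q * (u.1.1 * v.1.1 / H + r ^+ 2 * dot u.1.2 v.1.2).
  move=> Lq Nq tu tv u2 v2 r H.
  have h0q : H != 0 := h0 q (NI _ Nq); have r0q : r != 0 := r0 q (NI _ Nq).
  have scr w : tangent_to L q w -> w.2 = 0 -> screen h L q w.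
    by move=> tw w2; split => //; rewrite metric_ddt w2 mulr0.
  have := umb Lq (scr u tu u2) (scr v tv v2).
  have [tsu _] := (tangentE q u Lq Nq).1 tu.
  have [tsv Ev] := (tangentE q v Lq Nq).1 tv.
  rewrite /null_second_form (levi_civita_unique sd lc (LM Lq) tsu); last first.
    by exists U => //; split=> //; exact: LU.
  rewrite v2 in Ev.
  have D1 : ('D_u xi q).1.1 = 'D_u f q * (r ^+ 2 * al q) + f q * (2 * r * u.1.1 * al q + r ^+ 2 * 'D_u al q) :> R.
    have dr2 : is_derive q u (fun y : pt R => y.1.1 ^+ 2 : R^o) (2 * q.1.1 * u.1.1 : R^o).
      by apply: is_derive_eq (is_derive_mul (is_derive_radius q u) (is_derive_radius q u)) _; ring.
    have D := is_derive_mul (smooth_is_derive u sf Nq) (is_derive_mul dr2 (smooth_is_derive u sal Nq)).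
    have [_ <-] := D; have [_ <-] := is_derive_r (smooth_is_derive u sxiN Nq).
    by apply: near_eq_derive; apply: filterS (near_open oN Nq) => y Ny; rewrite xiE.
  have D2 : ('D_u xi q).1.2 = ('D_u f q : R) *: z q + (f q : R) *: 'D_u z q.
    have D := is_derive_scale (smooth_is_derive u sf Nq) (smooth_is_derive u sz Nq).
    have [_ <-] := D; have dx2 := is_derive_x3 (smooth_is_derive u sxiN Nq).
    have [_ <-] := dx2.
    by apply: near_eq_derive; apply: filterS (near_open oN Nq) => y Ny; rewrite [in LHS]xiE.
  rewrite /metric /static_connection /= D1 D2 u2 v2.
  have xv : dot q.1.2 v.1.2 = 0 by exact: tsv.
  rewrite (xiE q Nq) /=.
  (* z q unfolds to a multiple of the component of xi, which the linearity rules would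
     expand; only its name is needed here. *)
  have [zq zqE] : exists y, y = z q by exists (z q).
  rewrite -zqE in Ev *; move: ('D_u z q) => dzq.
  rewrite !(dotDl, dotNl, dotZl, dotDr, dotZr) xv.
  have zv : dot zq v.1.2 = - (al q * v.1.1 / h q.1.1) by apply/eqP; rewrite -addr_eq0 addrC Ev.
  rewrite zv -/H -/r => E.
  have fk : - f q != 0 by rewrite oppr_eq0; exact: f0.
  have fq0 := f0 q Nq.
  by apply: (eq_scaled E fk); rewrite /mu; field; rewrite r0q h0q fq0.
have W q : L q -> N q -> weyl q.1.1 = 0.
  by move=> Lq Nq; exact: (weyl_eq0 sd LM oN NI sal smu sz z0 null_eq zt tangentE br um Lq Nq).
have [u [tu u1]] := moves_radially sd NI z0 zt tangentE Lp Np.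
have dweyl : differentiable (weyl : R^o -> R^o) p.1.1.
  have oI' : open (I : set R^o) by [].
  apply: (@smooth_differentiable _ _ _ (I : set R^o)) => //.
  apply: smooth_add => //; first exact: smooth_cst.
  have si : smooth_on (I : set R^o) (id : R^o -> R^o) by exact: smooth_id.
  apply: smooth_mul => //; first exact: (smooth_mul oI' si si).
  by apply: smooth_derive; exact: smooth_bend.
have D := is_derive_radial u dweyl.
have : 'D_u (fun q : pt R => weyl q.1.1 : R^o) p = 'D_u (cst (0 : R^o)) p.
  apply: (tangent_derive_eq tu) => //.
    by apply: filterS (near_open oN Np) => q Nq Lq; exact: W.
  apply: (@differentiable_comp _ _ _ _ (fun q : pt R => q.1.1 : R^o) (weyl : R^o -> R^o)); last exact: dweyl.
  exact: smooth_differentiable sr Np.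
have [_ ->] := D; rewrite derive_cst => /eqP.
by rewrite mulf_eq0 (negPf u1) (negPf (weyl_simple Ip (W p Lp Np))).
Unshelve. all: by end_near. Qed.

End Radial.

(** * Radial null hypersurfaces near a point *)
Section LeafLocal.
Context {R : realType}.
Implicit Types (I : set R) (p q u v : pt R) (L U : set (pt R)).

Lemma chart_velocity_tangent p a b : dot p.1.2 p.1.2 = 1 ->
  tangent_space (chart p a) (b.1.1, 'D_b.1.2 (stereo p.1.2) a.1.2, b.2).
Proof.
move=> p1; have D := is_derive_x3 (is_derive_chart_at p a b).
have [_ E] := is_derive_dotV D D.
have : 'D_b (fun y : pt R => dot (chart p y).1.2 (chart p y).1.2 : R^o) a = 0.
  rewrite (_ : (fun y => _) = cst (1 : R^o)) ?derive_cst //.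
  by apply/funext => y; rewrite dot_stereo.
rewrite E (dotC _ (chart p a).1.2) -mulr2n -mulr_natl => /eqP.
by rewrite mulf_eq0 pnatr_eq0 => /eqP.
Qed.

Lemma graph_eq (a w e t1 t0 : R) : (a + w - e * t1 = a - e * t0) <-> (w = e * (t1 - t0)).
Proof. by split=> [E|->]; [rewrite -(addKr (a - e * t1) w)|]; lra. Qed.

Section Local.
Variables (I : set R) (h T : R -> R) (eps : R) (L : set (pt R)) (p : pt R).
Hypotheses (oI : open I) (hypL : hypersurface I L) (Lp : L p).
Hypothesis dT : forall r, I r -> is_derive (r : R^o) (1 : R^o) (T : R^o -> R^o) (h r)^-1.
Hypothesis tanL : \forall q \near p, L q -> forall u, tangent_to L q u <->
  tangent_space q u /\ u.2 = eps * u.1.1 / h q.1.1.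

(** In the chart at [p], [L] is a graph over the space coordinates, since [ddt] is
transverse to it.  Follow the height [f s] of this graph along the segment from the
centre to the point below [q].  By [implicit_zero] and the uniqueness of the
height, [f] is differentiable, with the derivative [kappa] prescribed by the tangent
spaces.  This is also the derivative of [eps * T] along the segment, so [f] and
[eps * T] differ by a constant. *)
Lemma leaf_local : \forall q \near p, spacetime I q ->
  (L q <-> q.2 - eps * T q.1.1 = p.2 - eps * T p.1.1).
Proof.
have [LM Lreg] := hypL; have Mp := LM _ Lp; have [Ip p1] := Mp.
have [U [F [[oU Up] sF LF [n tn dn]]]] := Lreg p Lp.
set c : R := 'D_ddt F p.
have kerL u q : U q -> L q -> tangent_to L q u -> 'D_u F q = 0.
  move=> Uq Lq tu; rewrite (tangent_derive_eq (g := cst (0 : R^o)) tu) ?derive_cst //.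
    by apply: filterS (near_open oU Uq) => y Uy Ly; apply/(LF y Uy (LM _ Ly)).
  exact: smooth_differentiable sF Uq.
have c0 : c != 0.
  apply/eqP => c0; have tp := nbhs_singleton tanL Lp.
  have : tangent_to L p ddt.
    apply/(hypersurface_tangent _ oI LM Lp oU Up sF LF tn dn); split=> //.
    by rewrite /tangent_space /= dot0r.
  move/(tp _).1 => [_] /=; rewrite mulr0 mul0r => /eqP.
  by rewrite oner_eq0.
pose G := F \o chart p.
pose good q := [/\ U q, I q.1.1, 0 < c * 'D_ddt F q &
  L q -> forall u, tangent_to L q u <-> tangent_space q u /\ u.2 = eps * u.1.1 / h q.1.1].
have ngood : \forall q \near p, good q.
  have cdF : {for p, continuous (fun q => c * 'D_ddt F q : R^o)}.
    have := smooth_continuous (smooth_mul oU (smooth_cst U (c : R^o)) (smooth_derive ddt sF)) Up; exact.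
  have cpos : \forall q \near p, 0 < c * 'D_ddt F q.
    have H : nbhs (c * 'D_ddt F p : R^o) ([set x | 0 < x] : set R^o).
      by apply: open_nbhs_nbhs; split; [exact: open_gt|rewrite /= -expr2 exprn_even_gt0].
    exact: (cdF _ H).
  near=> q; split.
  - by near: q; exact: near_open oU Up.
  - by near: q; exact: near_radius oI Ip.
  - by near: q.
  - by near: q; exact: tanL.
have cchart : {for 0, continuous (chart p)}.
  by apply: (@smooth_continuous _ _ _ setT) => //; exact: smooth_chart.
have [d /= d0 Bd] : exists2 d : R, 0 < d & forall w : pt R, `|w| < d -> good (chart p w).
  have : \forall w \near (0 : pt R), good (chart p w).
    by apply: cchart; rewrite chart0.
  move=> /nbhs_ballP[d d0 Bd]; exists d => // w wd; apply: Bd.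
  by rewrite -ball_normE /= sub0r normrN.
have dG w : `|w| < d -> differentiable G w.
  move=> /Bd[Uw _ _ _]; apply: differentiable_comp; last exact: smooth_differentiable sF Uw.
  by apply: (@smooth_differentiable _ _ _ setT) => //; exact: smooth_chart.
have DG w b : `|w| < d -> 'D_b G w = 'D_(b.1.1, 'D_b.1.2 (stereo p.1.2) w.1.2, b.2) F (chart p w).
  move=> /Bd[Uw _ _ _].
  by have [_ ->] := is_derive_chain (is_derive_chart_at p w b) (smooth_differentiable sF Uw).
have DGt w : `|w| < d -> 0 < c * 'D_ddt G w.
  move=> wd; rewrite DG // derive0; by have [] := Bd _ wd.
have nrm (b : pt R) (t : R) : b.2 = 0 -> `|b.1| < d -> `|t| < d -> `|t *: ddt + b| < d.
  move=> b2 b1 td; rewrite prod_normE /= b2 addr0 gt_max.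
  rewrite (_ : t *: 0 + b.1 = b.1) ?b1; last by rewrite scaler0 add0r.
  by rewrite scaleRE mulr1 td.
have dline (b : pt R) (t : R) : b.2 = 0 -> `|b.1| < d -> `|t| < d ->
    is_derive (t : R^o) (1 : R^o) (fun t : R^o => G ((t : R) *: ddt + b)) ('D_ddt G (t *: ddt + b)).
  by move=> b2 b1 td; apply: is_derive_ray; apply: dG; exact: nrm.
have cline (b : pt R) (t1 t2 : R) : b.2 = 0 -> `|b.1| < d -> - d < t1 -> t2 < d ->
    {within `[t1, t2], continuous (fun t : R => G (t *: ddt + b))}.
  move=> b2 b1 dt1 t2d; apply: derivable_within_continuous => t; rewrite in_itv /= => /andP[t1t tt2].
  have td : `|t| < d by rewrite ltr_norml (lt_le_trans dt1) // (le_lt_trans tt2).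
  by have [] := dline b t b2 b1 td.
have rise (b : pt R) (t1 t2 : R) : b.2 = 0 -> `|b.1| < d -> - d < t1 -> t2 < d -> t1 < t2 ->
    0 < c * (G (t2 *: ddt + b) - G (t1 *: ddt + b)).
  move=> b2 b1 dt1 t2d t12.
  have [t||t tt ->] := @MVT R (fun t : R => G (t *: ddt + b)) (fun t : R => 'D_ddt G (t *: ddt + b)) _ _ t12.
  - rewrite in_itv /= => /andP[t1t tt2]; apply: dline => //.
    by rewrite ltr_norml (lt_trans dt1) // (lt_trans tt2).
  - exact: cline.
  - move: tt; rewrite in_itv /= => /andP[t1t tt2].
    rewrite mulrA mulr_gt0 ?subr_gt0 //; apply: DGt; apply: nrm => //.
    by rewrite ltr_norml (lt_trans dt1) // (lt_trans tt2).
have uniq (b : pt R) (t1 t2 : R) : b.2 = 0 -> `|b.1| < d -> `|t1| < d -> `|t2| < d ->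
    G (t1 *: ddt + b) = G (t2 *: ddt + b) -> t1 = t2.
  move=> b2 b1; rewrite !ltr_norml => /andP[l1 r1] /andP[l2 r2] E.
  case: (ltgtP t1 t2) => // t12.
    by have := rise b t1 t2 b2 b1 l1 r2 t12; rewrite E subrr mulr0 ltxx.
  by have := rise b t2 t1 b2 b1 l2 r1 t12; rewrite E subrr mulr0 ltxx.
have Fp : F p = 0 by apply/(LF p Up Mp).
have G0 : G 0 = 0 by rewrite /G /= chart0.
have g0 : G (0 *: ddt + 0) = 0 by rewrite scale0r addr0.
pose e := d / 2.
have e0 : 0 < e by rewrite divr_gt0.
have ed : e < d by rewrite ltr_pdivrMr // ltr_pMr // ltr1n.
have z1 : `|(0 : pt R).1| < d by rewrite normr0.
(* Heights range over [-e, e]; over space coordinates smaller than d' the function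
   has opposite signs at the two ends. *)
have [d' [d'0 d'd Bd']] : exists d' : R, [/\ 0 < d', d' <= d & forall b : pt R, b.2 = 0 -> `|b.1| < d' ->
    0 < c * G (e *: ddt + b) /\ c * G (- e *: ddt + b) < 0].
  have cG (t : R) : `|t| < d -> {for 0, continuous (fun b : pt R => c * G (t *: ddt + b) : R^o)}.
    move=> td; apply: differentiable_continuous.
    apply: (@differentiable_scale _ _ _ (fun=> c : R^o)); first exact: differentiable_cst.
    apply: (@differentiable_comp _ _ _ _ (fun b : pt R => t *: ddt + b) G); first exact: ex_diff.
    by apply: dG; apply: nrm.
  have N1 : \forall b \near (0 : pt R), 0 < c * G (e *: ddt + b).
    have H : 0 < c * G (e *: ddt + 0).
      have := rise 0 0 e erefl z1; rewrite g0 subr0; apply=> //.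
      by rewrite oppr_lt0.
    have K : nbhs (c * G (e *: ddt + 0) : R^o) ([set x | 0 < x] : set R^o).
      by apply: open_nbhs_nbhs; split; [exact: open_gt|exact: H].
    have ced : `|e| < d by rewrite gtr0_norm.
    exact: (cG e ced _ K).
  have N2 : \forall b \near (0 : pt R), c * G (- e *: ddt + b) < 0.
    have H : c * G (- e *: ddt + 0) < 0.
      have := rise 0 (- e) 0 erefl z1; rewrite g0 sub0r mulrN oppr_gt0; apply=> //.
        by rewrite ltrN2.
      by rewrite oppr_lt0.
    have K : nbhs (c * G (- e *: ddt + 0) : R^o) ([set x | x < 0] : set R^o).
      by apply: open_nbhs_nbhs; split; [exact: open_lt|exact: H].
    have ced : `|- e| < d by rewrite normrN gtr0_norm.
    exact: (cG (- e) ced _ K).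
  have N : \forall b \near (0 : pt R), 0 < c * G (e *: ddt + b) /\ c * G (- e *: ddt + b) < 0.
    by move: N1 N2; apply: filterS2.
  move: N => /nbhs_ballP[d1 /= d10 Bd1].
  exists (Num.min d d1); split; first by rewrite lt_min d0.
    by rewrite ge_min lexx.
  move=> b b2; rewrite lt_min => /andP[_ bd1]; apply: Bd1.
  by rewrite -ball_normE /= sub0r normrN prod_normE b2 normr0 gt_max bd1.
have zero (b : pt R) : b.2 = 0 -> `|b.1| < d' -> exists t : R, `|t| <= e /\ G (t *: ddt + b) = 0.
  move=> b2 b1; have [P1 P2] := Bd' b b2 b1.
  have b1d : `|b.1| < d by exact: lt_le_trans d'd.
  have ee : - e <= e by apply: (@le_trans _ _ 0); rewrite ?oppr_le0 ltW.
  have [||t te Gt] := @IVT R (fun t : R => c * G (t *: ddt + b)) (- e) e 0 ee.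
  - apply: derivable_within_continuous => t; rewrite in_itv /= => /andP[l r].
    have td : `|t| < d by rewrite ltr_norml (lt_le_trans _ l) ?ltrN2 // (le_lt_trans r).
    by have [D _] := dline b t b2 b1d td; have D2 := @derivableZ _ _ _ _ c _ _ D; exact: D2.
  - by rewrite ge_min le_max (ltW P1) (ltW P2) orbT.
  - exists t; split; first by move: te; rewrite in_itv /= ler_norml.
    by apply: (mulfI c0); rewrite Gt mulr0.
have [cinv nchart] := chart_inv_continuous p1.
have m0 : 0 < Num.min d' d by rewrite lt_min d'0 d0.
have ninv : \forall q \near p, `|chart_inv p q| < Num.min d' d.
  have K : nbhs (chart_inv p p) [set w : pt R | `|w| < Num.min d' d].
    by rewrite chart_inv_self //; exact: (@nbhs0_lt R (R^o * 'rV[R]_3 * R^o)%type _ m0).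
  exact: (cinv _ K).
near=> q => Mq.
have wq : chart p (chart_inv p q) = q by apply: (chart_invK Mp Mq); near: q.
have : `|chart_inv p q| < Num.min d' d by near: q.
have q1E : q.1.1 = p.1.1 + (chart_inv p q).1.1 by rewrite -[in LHS]wq.
have q2E : q.2 = p.2 + (chart_inv p q).2 by rewrite -[in LHS]wq.
move: (chart_inv p q) wq q1E q2E => w wq q1E q2E.
rewrite prod_normE gt_max !lt_min => /andP[/andP[w1d' w1d] /andP[_ w2d]].
pose b (s : R) : pt R := (s * w.1.1, s *: w.1.2, 0).
have b2 s : (b s).2 = 0 by [].
have b1 s : `|(b s).1| = `|s| * `|w.1|.
  by rewrite -normrZ; congr `|_|.
pose f (s : R^o) : R^o := xget 0 [set t : R^o | `|t| <= e /\ G (t *: ddt + b s) = 0].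
have fP (s : R) : `|s| * `|w.1| < d' -> `|f s| <= e /\ G (f s *: ddt + b s) = 0.
  rewrite -b1 => sd; have := zero (b s) (b2 s) sd.
  exact: (@xgetPex _ (0 : R^o) [set t : R^o | `|t| <= e /\ G (t *: ddt + b s) = 0]).
have b1d s : `|s| * `|w.1| < d' -> `|(b s).1| < d by rewrite b1 => sd; exact: lt_le_trans d'd.
have funiq (s t : R) : `|s| * `|w.1| < d' -> `|t| < d -> G (t *: ddt + b s) = 0 -> f s = t.
  move=> sd td Gt; have [fe Gf] := fP s sd.
  apply: (uniq (b s)) => //; [exact: b1d|exact: le_lt_trans fe ed|by rewrite Gf].
pose kappa (s : R) : R := eps * w.1.1 / h (p.1.1 + s * w.1.1).
have df (s : R) : `|s| * `|w.1| < d' -> is_derive (s : R^o) (1 : R^o) f (kappa s : R^o).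
  move=> sd; have [fe Gf] := fP s sd.
  pose a := f s *: ddt + b s.
  have a11 : a.1.1 = s * w.1.1 by rewrite /a !ptE /= mulr0 add0r.
  have ad : `|a| < d by apply: nrm => //; [exact: b1d|exact: le_lt_trans fe ed].
  pose V : pt R := (w.1.1, w.1.2, kappa s).
  pose A (x : R^o * R^o) := a + combine V ddt x.
  have A0 : A 0 = a by rewrite /A combine0 addr0.
  have dA x y : is_derive x y A (combine V ddt y).
    by have := is_deriveD (is_derive_cst a x y) (is_derive_combine V ddt x y); rewrite add0r.
  have diffA x : differentiable A x.
    apply: differentiableD; first exact: differentiable_cst.
    by apply: (@smooth_differentiable _ _ _ setT) => //; exact: smooth_combine.
  have nA : \forall x \near (0 : R^o * R^o), `|A x| < d.
    have K : nbhs (A 0) [set y : pt R | `|y| < d].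
      rewrite A0; apply: (@open_nbhs_nbhs _ a [set y : pt R | `|y| < d]); split; last exact: ad.
      exact: (open_comp (fun y _ => @norm_continuous _ _ y) (@open_lt _ d)).
    exact: (differentiable_continuous (diffA 0) K).
  have [Ua Ia ca ta] := Bd a ad.
  have La : L (chart p a) by apply/(LF _ Ua (chart_spacetime Mp Ia)).
  have [tau [tau0 dtau Gtau]] : exists tau : R^o -> R^o, [/\ tau 0 = 0,
      is_derive (0 : R^o) (1 : R^o) tau 0 & \forall x \near (0 : R^o), (G \o A) (x, tau x) = 0].
    apply: (@implicit_zero _ (G \o A) ('D_ddt G a)).
    - by apply: filterS nA => x xd; apply: differentiable_comp => //; exact: dG.
    - by rewrite /= A0.
    - have dGA : differentiable G (A 0) by rewrite A0; exact: dG.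
      have [_ ->] := is_derive_chain (dA 0 (1, 0)) dGA.
      rewrite /combine /= scale1r scale0r addr0 A0 DG //.
      apply: kerL => //; apply/(ta La); split; first exact: chart_velocity_tangent.
      by change (kappa s = eps * w.1.1 / h (p.1.1 + a.1.1)); rewrite a11.
    - have dGA : differentiable G (A 0) by rewrite A0; exact: dG.
      have [_ ->] := is_derive_chain (dA 0 (0, 1)) dGA.
      by rewrite /combine /= scale1r scale0r add0r A0.
    - by apply/eqP => E; have := DGt a ad; rewrite E mulr0 ltxx.
  have near_f : \forall x \near (0 : R^o), f (x *: 1 + s) = f s + x * kappa s + tau x.
    have nsd : \forall x \near (0 : R^o), `|x + s| * `|w.1| < d'.
      have cn : {for (0 : R^o), continuous (fun x : R^o => `|x + s| * `|w.1| : R^o)}.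
        apply: cvgM; last exact: cvg_cst.
        by apply: cvg_norm; apply: cvgD; [exact: cvg_id|exact: cvg_cst].
      have K : nbhs (`|0 + s| * `|w.1| : R^o) ([set x | x < d'] : set R^o).
        by apply: open_nbhs_nbhs; split; [exact: open_lt|rewrite /= add0r].
      exact: (cn _ K).
    have ntau : \forall x \near (0 : R^o), `|f s + x * kappa s + tau x| < d.
      have cn : {for (0 : R^o), continuous (fun x : R^o => `|f s + x * kappa s + tau x| : R^o)}.
        apply: cvg_norm; apply: cvgD; last first.
          by apply: differentiable_continuous; apply/derivable1_diffP; exact: ex_derive.
        by apply: cvgD; [exact: cvg_cst|apply: cvgM; [exact: cvg_id|exact: cvg_cst]].
      have K : nbhs (`|f s + 0 * kappa s + tau 0| : R^o) ([set x | x < d] : set R^o).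
        apply: open_nbhs_nbhs; split; first exact: open_lt.
        by rewrite /= tau0 mul0r !addr0; exact: le_lt_trans fe ed.
      exact: (cn _ K).
    near=> x; rewrite [x *: 1]mulr1; apply: funiq.
    - by near: x.
    - by near: x.
    - have : (G \o A) (x, tau x) = 0 by near: x.
      rewrite /= /A /a /combine /= => <-; congr G.
      apply: pt_eq => [|i|]; rewrite !ptE /= ?mxE; ring.
  apply/is_derive_line.
  have D := is_deriveD (is_derive_affine (f s) (kappa s) (0 : R^o)) dtau.
  rewrite addr0 in D; apply: near_eq_is_derive D.
  by move: near_f; apply: filterS => x ->.
have w1d1 : `|1| * `|w.1| < d' by rewrite normr1 mul1r.
have sd (s : R) : 0 <= s <= 1 -> `|s| * `|w.1| < d'.
  move=> /andP[s0 s1]; rewrite ger0_norm //; apply: le_lt_trans w1d'.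
  by rewrite ler_piMl.
have Is (s : R) : 0 <= s <= 1 -> I (p.1.1 + s * w.1.1).
  move=> s01; have := b1d s (sd s s01) => bd.
  have bsd : `|b s| < d.
    have := nrm (b s) 0 (b2 s) bd; rewrite scale0r add0r normr0; exact.
  by have [_ Ib _ _] := Bd _ bsd.
pose H (s : R^o) : R^o := f s - eps * T (p.1.1 + s * w.1.1).
have dH (s : R) : 0 <= s <= 1 -> is_derive (s : R^o) (1 : R^o) H 0.
  move=> s01; have df1 := df s (sd s s01).
  have dT1 := dT (Is s s01).
  have diffT : differentiable (T : R^o -> R^o) (p.1.1 + s * w.1.1).
    by apply/derivable1_diffP; exact: ex_derive.
  have D2 := is_derive_chain (is_derive_affine p.1.1 w.1.1 (s : R^o)) diffT.
  rewrite derive_scale // in D2; have [_ TE] := dT1; rewrite TE in D2.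
  have := is_deriveB df1 (is_deriveZ eps D2).
  rewrite /kappa !scaleRE mulrA subrr.
  exact.
have H10 : H 1 = H 0.
  have [s||s s01] := @MVT R H (fun=> 0) 0 1 ltr01.
  - by rewrite in_itv /= => /andP[s0 s1]; apply: dH; rewrite !ltW.
  - apply: derivable_within_continuous => s'; rewrite in_itv /= => s01'.
    by have [] := dH s' s01'.
  - by move=> /eqP; rewrite mul0r subr_eq0 => /eqP.
have f00 : f 0 = 0.
  apply: funiq; first by rewrite normr0 mul0r.
    by rewrite normr0.
  rewrite (_ : b 0 = 0) ?g0 //.
  by apply: pt_eq => [|i|] //=; rewrite ?mul0r // scale0r.
have wE : w = w.2 *: ddt + b 1.
  by apply: pt_eq => [|i|]; rewrite !ptE /= ?mxE; ring.
have f1 : f 1 = eps * (T q.1.1 - T p.1.1).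
  move: H10; rewrite /H f00 mul0r addr0 mul1r -q1E => /eqP.
  by rewrite subr_eq => /eqP ->; ring.
have -> : (q.2 - eps * T q.1.1 = p.2 - eps * T p.1.1) <-> (w.2 = f 1).
  by rewrite f1 q2E; exact: graph_eq.
have w0d : `|w| < d by rewrite prod_normE gt_max w1d w2d.
have [Uq _ _ _] := Bd w w0d; rewrite wq in Uq.
have -> : L q <-> G w = 0 by rewrite /G /= wq; exact: LF.
split=> [Gw|w2E].
  by apply/esym; apply: funiq => //; rewrite -wE.
by have [_ Gf] := fP 1 w1d1; rewrite wE w2E.
Unshelve. all: by end_near. Qed.

End Local.
End LeafLocal.

(** * Primitives of continuous functions *)
Section Antiderivative.
Context {R : realType}.
Local Notation mu := (@lebesgue_measure R).

(** The integral from [r0], with a sign below [r0].  Near a given [x] it is the integral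
from a point [a] below both [x] and [r0], up to a constant, which treats the three
positions of [x] with respect to [r0] at once. *)
Lemma antiderivative (I : set R) (g : R -> R) (r0 : R) : open I -> is_interval I -> I r0 ->
  (forall r, I r -> {for r, continuous g}) ->
  exists T : R -> R, forall r, I r -> is_derive (r : R^o) (1 : R^o) (T : R^o -> R^o) (g r).
Proof.
move=> oI itvI Ir0 cg.
pose T (x : R) : R := if r0 <= x then \int[mu]_(t in [set` Interval (BRight r0) (BRight x)]) g t
  else - \int[mu]_(t in [set` Interval (BRight x) (BRight r0)]) g t.
have room (x : R) : I x -> exists a b : R, [/\ I a, I b, a < x & x < b].
  move=> Ix; have /nbhs_ballP[e /= e0 Be] : nbhs x I by exact: open_nbhs_nbhs.
  exists (x - e / 2), (x + e / 2); have e20 : 0 < e / 2 by rewrite divr_gt0.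
  have ee : e / 2 < e by rewrite ltr_pdivrMr // ltr_pMr // ltr1n.
  split; [apply: Be|apply: Be|by rewrite ltrBlDr ltrDl|by rewrite ltrDl].
  - by rewrite -ball_normE /= opprB addrC subrK gtr0_norm.
  - by rewrite -ball_normE /= opprD addrA subrr sub0r normrN gtr0_norm.
exists T => x Ix.
have [a1 [b1 [Ia1 Ib1 ax1 xb1]]] := room x Ix.
have [a2 [b2 [Ia2 Ib2 ax2 xb2]]] := room r0 Ir0.
pose a := Num.min a1 a2; pose b := Num.max b1 b2.
have Ia : I a by rewrite /a; case: leP.
have Ib : I b by rewrite /b; case: leP.
have [ax ar0] : a < x /\ a < r0 by rewrite /a !gt_min ax1 ax2 orbT.
have [xb r0b] : x < b /\ r0 < b by rewrite /b !lt_max xb1 xb2 orbT.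
have ig : mu.-integrable `[a, b] (EFin \o g).
  apply: continuous_compact_integrable; first exact: segment_compact.
  apply: continuous_in_subspaceT => y; rewrite inE /= in_itv /= => /andP[ay yb].
  by apply: cg; apply: (itvI a b) => //; rewrite ay yb.
have igy (y : R) : y <= b -> mu.-integrable `[a, y] (EFin \o g).
  move=> yb; apply: integrableS ig => //; apply: subset_itvl; by rewrite bnd_simp.
pose P (y : R) : R := \int[mu]_(t in [set` `[a, y]]) g t.
have TE (y : R) : a < y -> y < b -> T y = P y - P r0.
  move=> ay yb; rewrite /T; case: leP => yr0.
    rewrite (@Rintegral_itvB _ g (BLeft a) (BRight y) r0) //.
    - exact: igy (ltW yb).
    - by rewrite bnd_simp ltW.
  rewrite -(@Rintegral_itvB _ g (BLeft a) (BRight r0) y) ?opprB //.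
  - exact: igy (ltW r0b).
  - by rewrite bnd_simp ltW.
  - by rewrite bnd_simp ltW.
have [dP PE] := continuous_FTC1_closed xb ig ax (cg _ Ix).
have DP : is_derive (x : R^o) (1 : R^o) (P : R^o -> R^o) (g x).
  by split=> //; rewrite -PE derive1E.
have D : is_derive (x : R^o) (1 : R^o) (fun y : R^o => P y - P r0 : R^o) (g x).
  by have := is_deriveB DP (is_derive_cst (P r0 : R^o) (x : R^o) (1 : R^o)); rewrite subr0.
apply: near_eq_is_derive D.
near=> y; apply/esym/TE; near: y.
- exact: lt_nbhsr.
- exact: lt_nbhsl.
Unshelve. all: by end_near. Qed.

End Antiderivative.

(** * The two families of radial null hypersurfaces *)
Section Leaf.
Context {R : realType}.
Variables (I : set R) (h : R -> R) (sd : static_data I h).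
Variable nabla : pt R -> pt R -> (pt R -> pt R) -> pt R.
Hypothesis lc : levi_civita I h nabla.
Variables (T : R -> R) (eps : R).
Hypothesis dT : forall r, I r -> is_derive (r : R^o) (1 : R^o) (T : R^o -> R^o) (h r)^-1.
Hypothesis eps2 : eps * eps = 1.

Definition leaf (p : pt R) : set (pt R) :=
  [set q | spacetime I q /\ q.2 - eps * T q.1.1 = p.2 - eps * T p.1.1].

Definition leaf_normal (q : pt R) : pt R := (eps * h q.1.1, 0, 1).

Let U : set (pt R) := [set q | I q.1.1].

Let oI : open I. Proof. by case: sd. Qed.

Let oU : open U.
Proof.
apply: open_comp => // q _.
by apply: (@cvg_comp _ _ _ (fun u : pt R => u.1) fst); apply: cvg_fst.
Qed.

Let r_neq0 (q : pt R) : I q.1.1 -> q.1.1 != 0.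
Proof. by have [_ _ I0 _ _] := sd => Iq; apply: contra_notN I0 => /eqP <-. Qed.

Let h_gt0 (q : pt R) : I q.1.1 -> 0 < h q.1.1.
Proof. by have [_ _ _ _ h0] := sd; exact: h0. Qed.

Let sr : smooth_on U (fun q : pt R => q.1.1 : R^o).
Proof. by apply: smooth_r => //; exact: smooth_id. Qed.

Let sh : smooth_on U (fun q : pt R => h q.1.1 : R^o).
Proof. by have [_ _ _ hs _] := sd; apply: (smooth_comp1 oU (fun q Uq => Uq) hs sr). Qed.

(** The derivative [1 / h] is smooth. *)
Lemma smooth_primitive : smooth_on (I : set R^o) (T : R^o -> R^o).
Proof.
have oI' : open (I : set R^o) by [].
have dT' r : I r -> differentiable (T : R^o -> R^o) r.
  by move=> Ir; apply/derivable1_diffP; have [] := dT Ir.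
have si : smooth_on (I : set R^o) (fun r : R^o => (h r)^-1 : R^o).
  have [_ _ _ hs h0] := sd; apply: (smooth_inv oI' _ hs) => r Ir.
  by rewrite gt_eqF // h0.
case=> [|n]; first by move=> r /dT'; exact: differentiable_continuous.
split=> // v; apply: (@Cn_on_eq _ _ _ _ _ (fun r : R^o => (v : R) * (h r)^-1 : R^o)) => //.
  by move=> r Ir; rewrite (derive_scale _ (dT' r Ir)); have [_ ->] := dT Ir.
exact: (smooth_mul oI' (smooth_cst _ (v : R^o)) si n).
Qed.

Section Through.
Variables (p : pt R) (Mp : spacetime I p).
Local Notation L := (leaf p).

Let F (q : pt R) : R^o := q.2 - eps * T q.1.1 - (p.2 - eps * T p.1.1).

Let sF : smooth_on U F.
Proof.
apply: smooth_sub => //; last exact: smooth_cst.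
apply: smooth_sub => //; first by apply: smooth_t => //; exact: smooth_id.
apply: smooth_mul => //; first exact: smooth_cst.
exact: (smooth_comp1 oU (fun q Uq => Uq) smooth_primitive sr).
Qed.

Let dF q u : I q.1.1 -> 'D_u F q = u.2 - eps * (u.1.1 / h q.1.1).
Proof.
move=> Iq; have Td : differentiable (T : R^o -> R^o) q.1.1.
  by apply/derivable1_diffP; have [] := dT Iq.
have D := is_derive_sub (is_derive_sub (is_derive_time q u)
  (is_derive_mul (is_derive_cst (eps : R^o) q u) (is_derive_radial u Td)))
  (is_derive_cst (p.2 - eps * T p.1.1 : R^o) q u).
have [_ ->] := D; have [_ ->] := dT Iq.
by rewrite mul0r add0r subr0.
Qed.

Let FE q : U q -> spacetime I q -> (L q <-> F q = 0).
Proof.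
move=> Uq Mq; split=> [[_ E]|E]; first by rewrite /F E subrr.
by split=> //; apply/eqP; rewrite -subr_eq0; apply/eqP.
Qed.

Let ddt_tangent q : tangent_space q (ddt : pt R).
Proof. by rewrite /tangent_space /= dot0r. Qed.

Let ddtF q : I q.1.1 -> 'D_ddt F q != 0.
Proof. by move=> Iq; rewrite dF //= mul0r mulr0 subr0 oner_neq0. Qed.

Lemma leaf_hypersurface : hypersurface I L.
Proof.
split=> [q []//|q [[Iq q1] _]]; exists U, F; split=> //.
by exists ddt; [exact: ddt_tangent|exact: ddtF].
Qed.

Lemma leaf_tangent q u : L q ->
  tangent_to L q u <-> tangent_space q u /\ u.2 = eps * u.1.1 / h q.1.1.
Proof.
move=> Lq; have [[Iq q1] _] := Lq.
have LM : L `<=` spacetime I by move=> ? [].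
have K := hypersurface_tangent u oI LM Lq oU Iq sF FE (ddt_tangent q) (ddtF Iq).
rewrite dF // mulrA in K; split=> [/K[tu /eqP]|[tu E]].
  by rewrite subr_eq0 => /eqP.
by apply/K; split=> //; rewrite E subrr.
Qed.

Lemma leaf_normal_tangent q : L q -> tangent_to L q (leaf_normal q).
Proof.
move=> Lq; have [[Iq q1] _] := Lq; have h0 := h_gt0 Iq.
apply/leaf_tangent => //; split; first by rewrite /tangent_space /= dot0r.
by rewrite /= mulrA eps2 mul1r divff // gt_eqF.
Qed.

Lemma metric_leaf_normal q u : I q.1.1 ->
  metric h q (leaf_normal q) u = eps * u.1.1 - h q.1.1 * u.2.
Proof.
move=> Iq; have h0 : h q.1.1 != 0 by rewrite gt_eqF // h_gt0.
rewrite /metric /= mulr1 dot0l mulr0 addr0.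
by field.
Qed.

Lemma leaf_normal_orthogonal q u : L q -> tangent_to L q u -> metric h q (leaf_normal q) u = 0.
Proof.
move=> Lq; have [[Iq _] _] := Lq; move=> /(leaf_tangent _ Lq)[_ u2].
have h0 : h q.1.1 != 0 by rewrite gt_eqF // h_gt0.
by rewrite metric_leaf_normal // u2; field.
Qed.

Lemma leaf_null : null_hypersurface I h L.
Proof.
split=> [|q Lq]; first exact: leaf_hypersurface.
exists (leaf_normal q); split.
- by apply/eqP => /(congr1 snd)/eqP; rewrite oner_eq0.
- exact: leaf_normal_tangent.
- by move=> w; exact: leaf_normal_orthogonal.
Qed.

Let screenE q u : L q -> screen h L q u -> [/\ dot q.1.2 u.1.2 = 0, u.1.1 = 0 & u.2 = 0].
Proof.
move=> Lq [/(leaf_tangent _ Lq)[tu u2] /eqP]; have [[Iq _] _] := Lq.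
have h0 : h q.1.1 != 0 by rewrite gt_eqF // h_gt0.
rewrite metric_ddt mulf_eq0 oppr_eq0 (negPf h0) => /eqP u20; split=> //.
move: u2; rewrite u20 => /esym/eqP.
have e0 : eps != 0 by apply/eqP => e0; move/eqP: eps2; rewrite e0 mul0r eq_sym oner_eq0.
by rewrite !mulf_eq0 invr_eq0 (negPf h0) (negPf e0) orbF => /eqP.
Qed.

(** On the screen the time and radial components vanish, so that only the term of
the connection coming from the growth of the spheres remains. *)
Lemma leaf_umbilic : totally_umbilic I h nabla L.
Proof.
have LU : L `<=` U by move=> q [[]].
have sX : smooth_on U leaf_normal.
  apply: smooth_pair => //; last exact: smooth_cst.
  apply: smooth_pair => //; last exact: smooth_cst.
  by apply: smooth_mul => //; exact: smooth_cst.
have fX : field_on I U leaf_normal.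
  by split=> // q _ _; rewrite /tangent_space /= dot0r.
exists leaf_normal; split.
  split; first by exists U.
  move=> q Lq; have tX := leaf_normal_tangent Lq; split=> //.
  - by apply/eqP => /(congr1 snd)/eqP; rewrite oner_eq0.
  - exact: leaf_normal_orthogonal.
exists (fun q => - (eps * h q.1.1 / q.1.1) : R^o); split.
  exists U; split=> //; apply: smooth_opp => //; apply: smooth_mul => //.
    by apply: smooth_mul => //; exact: smooth_cst.
  by apply: smooth_inv => // q; exact: r_neq0.
move=> q u v Lq /(screenE Lq)[xu u1 u2] /(screenE Lq)[xv v1 v2].
have [Mq _] := Lq; have [Iq q1] := Mq.
have r0 := r_neq0 Iq; have h0 : h q.1.1 != 0 by rewrite gt_eqF // h_gt0.
rewrite /null_second_form (levi_civita_unique sd lc Mq xu); last by exists U.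
have hd : differentiable (h : R^o -> R^o) q.1.1.
  by have [_ _ _ hs _] := sd; exact: (smooth_differentiable hs Iq).
have DX : 'D_u leaf_normal q = 0.
  have D := is_derive_pair (is_derive_pair (is_derive_mul (is_derive_cst (eps : R^o) q u) (is_derive_radial u hd))
    (is_derive_cst (0 : 'rV[R]_3) q u)) (is_derive_cst (1 : R^o) q u).
  have [_ E] := D; apply: (etrans E).
  by rewrite u1 !mul0r mulr0 addr0.
rewrite /metric /static_connection DX /= u1 u2 v1 v2.
rewrite !(dotDl, dotNl, dotZl, dot0r, dot0l); field.
by apply/andP; split; [exact: h0|exact: r0].
Qed.

Lemma orthogonal_exists (x : 'rV[R]_3) : exists y, dot x y = 0 /\ y != 0.
Proof.
have [x0|x0] := eqVneq (x 0 0) 0.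
  exists (delta_mx 0 0); split; first by rewrite dot3 !mxE x0 /= !mulr0 mul0r !addr0.
  by apply/eqP => /(congr1 (fun y : 'rV[R]_3 => y 0 0))/eqP; rewrite !mxE /= oner_eq0.
exists (cross x (delta_mx 0 2)); split; first exact: dot_cross_l.
apply/eqP => /(congr1 (fun y : 'rV[R]_3 => y 0 1))/eqP; rewrite cross3 !mxE /=.
by rewrite mulr0 mulr1 sub0r oppr_eq0 (negPf x0).
Qed.

(** Every null field on the leaf is radial, so its second form on a vector tangent to
the sphere is [r] times its nonzero radial component times the squared length. *)
Lemma leaf_not_geodesic : ~ totally_geodesic I h nabla L.
Proof.
move=> [xi [[[V [oV LV fxi]] xiL] geo]].
have Lp : L p by split.
have [Ip p1] := Mp; have r0 := r_neq0 Ip; have h0 : h p.1.1 != 0 by rewrite gt_eqF // h_gt0.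
have radial q : L q -> (xi q).1.2 = 0.
  move=> Lq; have [[Iq _] _] := Lq; have [/(leaf_tangent _ Lq)[_ b] _] := xiL _ Lq.
  have h0q : h q.1.1 != 0 by rewrite gt_eqF // h_gt0.
  rewrite /metric b => E; apply: dot_eq0.
  apply: (mulfI (_ : q.1.1 ^+ 2 != 0)); first by rewrite expf_eq0 r_neq0.
  rewrite mulr0 -E.
  transitivity (q.1.1 ^+ 2 * dot (xi q).1.2 (xi q).1.2 + (xi q).1.1 ^+ 2 / h q.1.1 * (1 - eps * eps)).
    by rewrite eps2 subrr mulr0 addr0.
  by field.
have [txi xi0 _] := xiL _ Lp.
have a0 : (xi p).1.1 != 0.
  apply: contra_neq xi0 => a0; have /(leaf_tangent _ Lp)[_ b] := txi.
  by apply: pt_eq => [|i|]; rewrite ?a0 ?(radial p Lp) // b a0 mulr0 mul0r.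
have [y [xy y0]] := orthogonal_exists p.1.2.
pose u : pt R := (0, y, 0).
have tu : tangent_to L p u.
  by apply/(leaf_tangent _ Lp); split=> //=; rewrite mulr0 mul0r.
have su : screen h L p u by split=> //; rewrite metric_ddt mulr0.
have := geo p u u Lp su su.
have fxi' : field_near I p xi by exists V => //; split=> //; exact: LV.
rewrite /null_second_form (levi_civita_unique (v := u) sd lc Mp xy fxi').
have [sxi _] := fxi; have Vp := LV _ Lp.
have D2 : ('D_u xi p).1.2 = 0.
  have [_ <-] := is_derive_x3 (smooth_is_derive u sxi Vp).
  rewrite (tangent_derive_eq (g := cst (0 : 'rV[R]_3)) tu) ?derive_cst //.
    by apply: filterE => q; exact: radial.
  exact: smooth_differentiable (smooth_x oV sxi) Vp.
rewrite /metric /static_connection /= D2 (radial p Lp).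
rewrite !(dotDl, dotNl, dotZl, dot0r, dot0l) => E.
have : p.1.1 * (xi p).1.1 * dot y y = 0.
  by rewrite -[RHS]oppr0 -E; field; apply/andP; split; [exact: h0|exact: r0].
move/eqP; rewrite !mulf_eq0 (negPf r0) (negPf a0) /= => /eqP/dot_eq0 y0'.
by rewrite y0' eqxx in y0.
Qed.

Lemma leaf_umbilic_not_geodesic : umbilic_not_geodesic I h nabla L.
Proof. by split; [exact: leaf_null|exact: leaf_umbilic|exact: leaf_not_geodesic]. Qed.

End Through.
End Leaf.

(** * Connectedness and germs of the leaves *)
Section Connected.
Context {R : realType}.

Definition sphere : set 'rV[R]_3 := [set x | dot x x = 1].

Lemma connected_range (V : normedModType R) (f : R^o -> V) : continuous f -> connected (range f).
Proof.
move=> cf; apply: connected_continuous_connected; last exact: continuous_subspaceT.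
by apply/connected_intervalP => x y.
Qed.

(** A union of images of lines through 0. *)
Lemma stereo_connected (a : 'rV[R]_3) : connected (range (stereo a)).
Proof.
rewrite (_ : range (stereo a) = \bigcup_(y in setT) range (fun s : R^o => stereo a ((s : R) *: y))).
  apply: bigcup_connected.
    by exists a => y _; exists 0 => //; rewrite scale0r stereo0.
  move=> y _; apply: connected_range => s.
  have oT : open [set: R^o] by exact: openT.
  apply: (@smooth_continuous _ _ _ setT) => //; apply: smooth_stereo => //.
  by apply: smooth_scale => //; [exact: smooth_id|exact: smooth_cst].
apply/seteqP; split=> [x [y _ <-]|x [y _ [s _ <-]]]; last by exists (s *: y).
by exists y => //; exists 1 => //; rewrite scale1r.
Qed.

(** The ranges of two stereographic parametrizations omit different points. *)
Lemma sphere_connected : connected sphere.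
Proof.
have e1 (i : 'I_3) : dot (delta_mx 0 i) (delta_mx 0 i) = 1 :> R.
  rewrite /dot (bigD1 i) //= big1 => [|j ji]; first by rewrite !mxE !eqxx mulr1 addr0.
  by rewrite !mxE eqxx (negPf ji) mulr0.
pose a : 'rV[R]_3 := delta_mx 0 0; pose b : 'rV[R]_3 := delta_mx 0 1.
have ab : dot a b = 0 by rewrite dot3 !mxE /= !(mulr0, mul0r, addr0).
rewrite (_ : sphere = range (stereo a) `|` range (stereo b)).
  apply: connectedU; [|exact: stereo_connected|exact: stereo_connected].
  exists a; split; first by exists 0 => //; rewrite stereo0.
  exists ((2 / (1 + dot b a)) *: horizontal b a) => //.
  by apply: stereo_onto; rewrite ?e1 // dotC ab addr0 oner_neq0.
apply/seteqP; split=> x; last by case=> -[y _ <-]; apply: dot_stereo; exact: e1.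
move=> x1; have [ax|ax] := eqVneq (1 + dot a x) 0; last first.
  left; exists ((2 / (1 + dot a x)) *: horizontal a x) => //.
  by apply: stereo_onto => //; exact: e1.
right; exists ((2 / (1 + dot b x)) *: horizontal b x) => //.
apply: stereo_onto => //; first exact: e1.
have xE : x 0 0 = -1.
  by apply/eqP; rewrite -addr_eq0 addrC -ax dot3 !mxE /= !(mul0r, mul1r, addr0).
have : x 0 1 ^+ 2 + x 0 2 ^+ 2 = 0.
  by move: x1; rewrite /sphere /= dot3 xE mulrNN mulr1 -addrA -!expr2 => /eqP; rewrite -subr_eq0 addrAC subrr add0r => /eqP.
move/eqP; rewrite paddr_eq0 ?sqr_ge0 // !sqrf_eq0 => /andP[/eqP x01 _].
by rewrite dot3 !mxE /= x01 !(mul0r, mulr0, addr0) oner_neq0.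
Qed.

Section LeafConnected.
Variables (I : set R) (h T : R -> R) (eps : R) (p : pt R).
Hypotheses (itvI : is_interval I) (Mp : spacetime I p).
Hypothesis dT : forall r, I r -> is_derive (r : R^o) (1 : R^o) (T : R^o -> R^o) (h r)^-1.

Let place (r : R) (x : 'rV[R]_3) : pt R := (r, x, p.2 - eps * T p.1.1 + eps * T r).

Let place_leaf r x : I r -> dot x x = 1 -> leaf I T eps p (place r x).
Proof. by move=> Ir x1; split=> //=; rewrite addrK. Qed.

(** The union, over the points [x] of the sphere, of the light ray through [x] and the
sphere of the leaf that contains [p]. *)
Lemma leaf_connected : connected (leaf I T eps p).
Proof.
have [Ip p1] := Mp.
have pE : place p.1.1 p.1.2 = p by rewrite /place subrK; case: (p) => -[].
pose ray x := (fun r : R^o => place r x) @` I.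
pose orb := place p.1.1 @` sphere.
have cray x : connected (ray x).
  apply: connected_continuous_connected; first exact/connected_intervalP.
  apply: continuous_in_subspaceT => r; rewrite inE => Ir.
  apply: (@differentiable_continuous R R^o (pt R)).
  have dTr : differentiable (T : R^o -> R^o) r by apply/derivable1_diffP; have [] := dT Ir.
  apply: differentiable_pair.
    by apply: differentiable_pair; [exact: ex_diff|exact: differentiable_cst].
  apply: differentiableD; first exact: differentiable_cst.
  by apply: (@differentiable_scale _ _ _ (fun=> eps : R^o)) => //; exact: differentiable_cst.
have corb : connected orb.
  apply: connected_continuous_connected; first exact: sphere_connected.
  apply: continuous_subspaceT => x.
  apply: (@differentiable_continuous R _ (pt R)).
  apply: differentiable_pair; last exact: differentiable_cst.
  by apply: differentiable_pair; [exact: differentiable_cst|exact: ex_diff].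
rewrite (_ : leaf I T eps p = \bigcup_(x in sphere) (ray x `|` orb)).
  apply: bigcup_connected.
    by exists p => x x1; right; exists p.1.2.
  move=> x x1; apply: connectedU => //.
  by exists (place p.1.1 x); split; [exists p.1.1|exists x].
apply/seteqP; split=> [q [[Iq q1] E]|q [x x1 [[r Ir <-]|[y y1 <-]]]].
- exists q.1.2 => //; left; exists q.1.1 => //.
  rewrite /place -E subrK; by case: (q) => -[].
- exact: place_leaf.
- exact: place_leaf.
Qed.

End LeafConnected.

Section Count.
Variables (I : set R) (h : R -> R) (sd : static_data I h).
Variable nabla : pt R -> pt R -> (pt R -> pt R) -> pt R.
Hypothesis lc : levi_civita I h nabla.
Variable T : R -> R.
Hypothesis dT : forall r, I r -> is_derive (r : R^o) (1 : R^o) (T : R^o -> R^o) (h r)^-1.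

(** On a common germ both [T] and [- T] would be constant near the radius of [p],
but the derivative of [T] is not zero. *)
Lemma leaves_distinct p : spacetime I p -> ~ same_germ p (leaf I T 1 p) (leaf I T (-1) p).
Proof.
move=> [Ip p1] germ; have [oI _ _ _ hpos] := sd.
pose gam (r : R^o) : pt R := (r, p.1.2, p.2 - T p.1.1 + T r).
have dTp : differentiable (T : R^o -> R^o) p.1.1 by apply/derivable1_diffP; have [] := dT Ip.
have gam0 : gam p.1.1 = p by rewrite /gam subrK; case: (p) => -[].
have cgam : gam @ (p.1.1 : R^o) --> p.
  rewrite -[X in _ --> X]gam0; apply: differentiable_continuous.
  apply: differentiable_pair.
    by apply: differentiable_pair; [exact: ex_diff|exact: differentiable_cst].
  by apply: differentiableD; first exact: differentiable_cst.
have nI : \forall r \near (p.1.1 : R^o), I r by exact: open_nbhs_nbhs.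
have Tc : \forall r \near (p.1.1 : R^o), T r = T p.1.1.
  have nG : \forall r \near (p.1.1 : R^o), leaf I T 1 p (gam r) <-> leaf I T (-1) p (gam r) by exact: (cgam _ germ).
  move: nI nG; apply: filterS2 => r Ir [G _].
  have [|_] := G; first by split; [split|rewrite /=; ring].
  by rewrite /= => E; lra.
have : 'D_(1 : R^o) (T : R^o -> R^o) p.1.1 = 0.
  by rewrite (near_eq_derive (g := cst (T p.1.1 : R^o))) ?derive_cst.
have [_ ->] := dT Ip => /eqP; rewrite invr_eq0 gt_eqF //.
exact: hpos.
Qed.

End Count.
End Connected.

(** * Counting umbilic null hypersurfaces through a point *)
Section ExactlyTwo.
Context {R : realType}.
Variables (I : set R) (h : R -> R) (sd : static_data I h).
Variable nabla : pt R -> pt R -> (pt R -> pt R) -> pt R.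
Hypothesis lc : levi_civita I h nabla.
Hypothesis weyl_simple : forall r, I r -> weyl h r = 0 -> 'D_(1 : R^o) (weyl h : R^o -> R^o) r != 0.
Variable T : R -> R.
Hypothesis dT : forall r, I r -> is_derive (r : R^o) (1 : R^o) (T : R^o -> R^o) (h r)^-1.

(** The sign is the ratio of the radial component of the null field to [h] times its
time component.  It is continuous and its square is 1 on [L], so it is locally constant. *)
Lemma umbilic_germ L : null_hypersurface I h L -> totally_umbilic I h nabla L ->
  exists sg : pt R -> R, forall q, L q ->
    [/\ sg q * sg q = 1, \forall y \near q, L y -> sg y = sg q &
        \forall y \near q, L y <-> leaf I T (sg q) q y].
Proof.
move=> nullL [xi [[[U [oU LU fxi]] xiL] [rho [[U' [oU' LU' srho]] umb]]]].
have y0 := radial sd lc weyl_simple nullL oU LU fxi xiL oU' LU' srho umb.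
have [[LM _] _] := nullL; have [oI _ I0 hs hpos] := sd; have [sxi _] := fxi.
pose sg (q : pt R) : R^o := (xi q).1.1 / (h q.1.1 * (xi q).2).
have aux q : L q -> [/\ I q.1.1, h q.1.1 != 0, q.1.1 != 0, (xi q).2 != 0 & sg q * sg q = 1].
  move=> Lq; have [Iq _] := LM _ Lq; have [_ xi0 nxi] := xiL _ Lq.
  have h0 : h q.1.1 != 0 by rewrite gt_eqF // hpos.
  have r0 : q.1.1 != 0 by apply: contra_notN I0 => /eqP <-.
  have b0 := null_neq0 (hpos _ Iq) r0 nxi xi0.
  split=> //; rewrite /metric (y0 _ Lq) dot0l mulr0 addr0 in nxi.
  have k0 : h q.1.1 * (xi q).2 ^+ 2 != 0 by rewrite mulf_neq0 // expf_neq0.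
  by apply: (eq_scaled nxi k0); rewrite /sg; field; rewrite h0 b0.
have sgc q : L q -> \forall y \near q, L y -> sg y = sg q.
  move=> Lq; have [Iq h0 r0 b0 s1] := aux q Lq.
  have cq : {for q, continuous sg}.
    have dh : differentiable (h : R^o -> R^o) q.1.1 by exact: (smooth_differentiable hs Iq).
    have dxi : differentiable xi q by exact: smooth_differentiable sxi (LU _ Lq).
    have cr : {for q, continuous (fun y : pt R => h y.1.1 : R^o)}.
      apply: (@continuous_comp _ _ _ (fun y : pt R => y.1.1) (h : R^o -> R^o)).
        by apply: (@cvg_comp _ _ _ (fun u : pt R => u.1) fst); apply: cvg_fst.
      exact: differentiable_continuous dh.
    have c1 := smooth_continuous (smooth_r oU sxi) (LU _ Lq).
    have c2 := smooth_continuous (smooth_t oU sxi) (LU _ Lq).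
    apply: cvgM; first exact: c1.
    by apply: cvgV; [rewrite mulf_neq0|apply: cvgM; [exact: cr|exact: c2]].
  have : \forall y \near q, `|sg q - sg y| < 1 by move/cvgrPdist_lt: cq; apply.
  apply: filterS => y d Ly; have [_ _ _ _ sy] := aux y Ly.
  have : (sg y - sg q) * (sg y + sg q) = 0 by rewrite mulrBl !mulrDr s1 sy mulrC; ring.
  move/eqP; rewrite mulf_eq0 subr_eq0 addr_eq0 => /orP[/eqP //|/eqP E].
  move: d; rewrite E opprK => d; exfalso.
  have : `|sg q + sg q| * `|sg q + sg q| < 1.
    by rewrite -[ltRHS]mulr1 ltr_pM.
  rewrite -normrM mulrDl !mulrDr s1 ger0_norm; last by rewrite !addr_ge0.
  by lra.
exists sg => q Lq; have [Iq h0 r0 b0 s1] := aux q Lq; split=> //; first exact: sgc.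
have tanL : \forall y \near q, L y -> forall u, tangent_to L y u <->
    tangent_space y u /\ u.2 = sg q * u.1.1 / h y.1.1.
  apply: filterS (sgc q Lq) => y sy Ly u; have [Iy hy ry byy s1y] := aux y Ly.
  have [txi xi0 nxi] := xiL _ Ly.
  have K := null_hypersurface_tangent u sd nullL Ly txi xi0 nxi.
  have E : metric h y (xi y) u = h y.1.1 * (xi y).2 * (sg y * u.1.1 / h y.1.1 - u.2).
    rewrite /metric (y0 _ Ly) dot0l mulr0 addr0 /sg; field.
    by apply/andP.
  rewrite -(sy Ly); split=> [/K[tu /eqP]|[tu uE]].
    rewrite E mulf_eq0 mulf_eq0 (negPf hy) (negPf byy) subr_eq0 /= => /eqP ->.
    by split.
  by apply/K; split=> //; rewrite E uE subrr mulr0.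
have hypL : hypersurface I L by case: nullL.
have := leaf_local oI hypL Lq dT tanL.
apply: filterS => y H; split=> [Ly|[My E]].
  by have My := LM _ Ly; split=> //; apply/(H My).
exact/(H My).
Qed.

(** For the containment, let [B] be the set of points of [L] on the given leaf with
the given sign.  By [umbilic_germ], membership in [B] is locally constant on [L]. *)
Lemma exactly_two p : spacetime I p -> exactly_two_through I h nabla p.
Proof.
move=> Mp; have [oI itvI _ _ _] := sd.
have e1 : (1 : R) * 1 = 1 by rewrite mulr1.
have e2 : (-1 : R) * -1 = 1 by rewrite mulrNN mulr1.
exists (leaf I T 1 p), (leaf I T (-1) p); split.
- split; [exact: leaf_umbilic_not_geodesic|exact: leaf_connected dT|by split].
- split; [exact: leaf_umbilic_not_geodesic|exact: leaf_connected dT|by split].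
- exact: leaves_distinct.
move=> L [nullL umbL _] Lp; have [sg germ] := umbilic_germ nullL umbL.
have [sp _ gp] := germ p Lp.
have sub : connected L -> L `<=` leaf I T (sg p) p.
  move=> cL; pose B : set (pt R) := [set q | [/\ L q, leaf I T (sg p) p q & sg q = sg p]].
  have Bloc q : L q -> \forall y \near q, L y -> (B y <-> B q).
    move=> Lq; have [_ sq gq] := germ q Lq.
    move: sq gq; apply: filterS2 => y sy gy Ly.
    have [My Ey] := (gy.1 Ly); have Mq : spacetime I q by case: nullL => -[LM _] _; exact: LM.
    split=> -[_ [_ E] S].
      have S' : sg q = sg p by rewrite -(sy Ly).
      by rewrite S' in Ey; split=> //; split=> //; exact: etrans (esym Ey) E.
    rewrite S in Ey; split=> //; last by rewrite sy.
    by split=> //; exact: etrans Ey E.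
  suff <- : B = L by move=> q [].
  apply: cL.
  - by exists p; split=> //; split.
  - exists (interior [set y | L y -> B y]); first exact: open_interior.
    apply/seteqP; split=> [q Bq|q [Lq /interior_subset]]; last exact.
    have Lq : L q by case: Bq.
    split=> //; have := Bloc q Lq; apply: filterS => y H Ly; exact/(H Ly).
  - exists (~` interior [set y | L y -> ~ B y]); first exact/open_closedC/open_interior.
    apply/seteqP; split=> [q Bq|q [Lq nq]].
      have Lq : L q by case: Bq.
      by split=> // /interior_subset /(_ Lq).
    apply: contrapT => nB; apply: nq; have := Bloc q Lq; apply: filterS => y H Ly.
    by move=> By; apply: nB; exact/(H Ly).
have : (sg p - 1) * (sg p + 1) = 0 by rewrite mulrBl !mulrDr sp !mulr1 mul1r; ring.
move/eqP; rewrite mulf_eq0 subr_eq0 addr_eq0 => /orP[]/eqP E; rewrite E in sub gp.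
  by left.
by right.
Qed.

End ExactlyTwo.

(** * Reissner-Nordstrom and De Sitter-Schwarzschild *)
Section Examples.
Context {R : realType}.

Lemma static_two_through (I : set R) (h : R -> R) nabla p :
  static_data I h -> levi_civita I h nabla ->
  (forall r, I r -> weyl h r = 0 -> 'D_(1 : R^o) (weyl h : R^o -> R^o) r != 0) ->
  spacetime I p -> exactly_two_through I h nabla p.
Proof.
move=> sd lc W Mp; have [oI itvI _ hs hpos] := sd; have [Ip _] := Mp.
have hi r : I r -> {for r, continuous (fun x : R => (h x)^-1)}.
  move=> Ir; have h0 : h r != 0 by rewrite gt_eqF // hpos.
  apply: cvgV => //.
  by apply: (differentiable_continuous (V := R^o) (W := R^o)); exact: (smooth_differentiable hs Ir).
have [T dT] := antiderivative oI itvI Ip hi.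
exact: (exactly_two sd lc W dT Mp).
Qed.

(** A common generalization of the two families. *)
Definition reissner_de_sitter (M C K r : R) : R := 1 - M / r + C / r ^+ 2 + K * r ^+ 2.

Lemma near_neq0 (r : R) : r != 0 -> \forall x \near (r : R^o), x != 0.
Proof. by move=> r0; apply: open_nbhs_nbhs; split; [exact: open_neq0|]. Qed.

(** The functions [h], [bend h] and [weyl h] all have this form. *)
Lemma is_derive_powers (a0 a1 a2 a3 b1 b2 r : R) : r != 0 ->
  is_derive (r : R^o) (1 : R^o)
    (fun x : R^o => a0 + a1 * x^-1 + a2 * (x^-1 * x^-1) + a3 * (x^-1 * x^-1 * x^-1)
      + b1 * x + b2 * (x * x) : R^o)
    (- a1 / r ^+ 2 - 2 * a2 / r ^+ 3 - 3 * a3 / r ^+ 4 + b1 + 2 * b2 * r : R^o).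
Proof.
move=> r0; have di := is_derive_id (r : R^o) (1 : R^o).
have c a := is_derive_cst (a : R^o) (r : R^o) (1 : R^o).
have dv := is_derive_inv (f := id) r0 di.
have dv2 := is_derive_mul dv dv; have dv3 := is_derive_mul dv2 dv.
have D := is_derive_add (is_derive_add (is_derive_add (is_derive_add (is_derive_add (c a0)
  (is_derive_mul (c a1) dv)) (is_derive_mul (c a2) dv2)) (is_derive_mul (c a3) dv3))
  (is_derive_mul (c b1) di)) (is_derive_mul (c b2) (is_derive_mul di di)).
apply: is_derive_eq D _; rewrite /=; field.
exact: r0.
Qed.

Lemma derive_powers (f : R -> R) (a0 a1 a2 a3 b1 b2 r : R) : r != 0 ->
  (forall x, x != 0 -> f x = a0 + a1 * x^-1 + a2 * (x^-1 * x^-1) + a3 * (x^-1 * x^-1 * x^-1)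
      + b1 * x + b2 * (x * x)) ->
  'D_(1 : R^o) (f : R^o -> R^o) r = - a1 / r ^+ 2 - 2 * a2 / r ^+ 3 - 3 * a3 / r ^+ 4 + b1 + 2 * b2 * r.
Proof.
move=> r0 fE; have [_ <-] := is_derive_powers a0 a1 a2 a3 b1 b2 r0.
by apply: near_eq_derive; apply: filterS (near_neq0 r0) => x /fE.
Qed.

Lemma reissner_bend (M C K r : R) : r != 0 ->
  bend (reissner_de_sitter M C K) r = 0 + 1 * r^-1 + (- (3 / 2) * M) * (r^-1 * r^-1)
     + (2 * C) * (r^-1 * r^-1 * r^-1) + 0 * r + 0 * (r * r).
Proof.
move=> r0; rewrite /bend (@derive_powers _ 1 (- M) C 0 0 K r r0); last first.
  by move=> x x0; rewrite /reissner_de_sitter; field.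
by rewrite /reissner_de_sitter; field.
Qed.

Lemma reissner_weyl (M C K r : R) : r != 0 ->
  weyl (reissner_de_sitter M C K) r = 0 + (3 * M) * r^-1 + (- 6 * C) * (r^-1 * r^-1)
     + 0 * (r^-1 * r^-1 * r^-1) + 0 * r + 0 * (r * r).
Proof.
move=> r0; rewrite /weyl (derive_powers r0 (@reissner_bend M C K)).
by field.
Qed.

(** At a zero of [weyl] one has [M * r = 2 * C], and then the derivative is
[6 * C / r ^+ 3]. *)
Lemma reissner_weyl_simple (M C K r : R) : r != 0 -> (M != 0) || (C != 0) ->
  weyl (reissner_de_sitter M C K) r = 0 ->
  'D_(1 : R^o) (weyl (reissner_de_sitter M C K) : R^o -> R^o) r != 0.
Proof.
move=> r0 MC; rewrite reissner_weyl // => W.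
rewrite (derive_powers r0 (@reissner_weyl M C K)).
have MrE : M * r = 2 * C.
  have k0 : 3 / r ^+ 2 != 0 by rewrite mulf_neq0 // ?invr_eq0 ?expf_neq0 // pnatr_eq0.
  by apply: (eq_scaled W k0); field.
apply/eqP => D.
have C0 : C = 0.
  have k0 : 6 / r ^+ 3 != 0 by rewrite mulf_neq0 // ?invr_eq0 ?expf_neq0 // pnatr_eq0.
  have D2 := congr2 (fun a b : R => a + 3 / r ^+ 3 * b) D MrE.
  by apply: (eq_scaled D2 k0); field.
have M0 : M = 0 by apply: (mulIf r0); rewrite MrE C0 mulr0 mul0r.
by move: MC; rewrite M0 C0 eqxx.
Qed.

Lemma reissner_two_through (I : set R) (M C K : R) nabla p : (M != 0) || (C != 0) ->
  static_data I (reissner_de_sitter M C K) -> levi_civita I (reissner_de_sitter M C K) nabla ->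
  spacetime I p -> exactly_two_through I (reissner_de_sitter M C K) nabla p.
Proof.
move=> MC sd lc Mp; apply: static_two_through => // r Ir.
apply: reissner_weyl_simple => //; have [_ _ I0 _ _] := sd.
by apply: contra_notN I0 => /eqP <-.
Qed.

End Examples.

Theorem corollary5p6 (R : realType) (I : set R) :
  (forall (m k : R) (nabla : pt R -> pt R -> (pt R -> pt R) -> pt R) (p : pt R),
     m != 0 ->
     static_data I (de_sitter_schwarzschild m k) ->
     levi_civita I (de_sitter_schwarzschild m k) nabla ->
     spacetime I p ->
     exactly_two_through I (de_sitter_schwarzschild m k) nabla p) /\
  (forall (m c : R) (nabla : pt R -> pt R -> (pt R -> pt R) -> pt R) (p : pt R),
     (m != 0) || (c != 0) ->
     static_data I (reissner_nordstrom m c) ->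
     levi_civita I (reissner_nordstrom m c) nabla ->
     spacetime I p ->
     exactly_two_through I (reissner_nordstrom m c) nabla p).
Proof.
split=> [m k nabla p m0|m c nabla p mc0].
  have -> : de_sitter_schwarzschild m k = reissner_de_sitter (m ^+ 2) 0 k.
    by apply/funext => r; rewrite /reissner_de_sitter mul0r addr0.
  by apply: reissner_two_through; rewrite sqrf_eq0 m0.
have -> : reissner_nordstrom m c = reissner_de_sitter (m ^+ 2) (c ^+ 2) 0.
  by apply/funext => r; rewrite /reissner_de_sitter mul0r addr0.
by apply: reissner_two_through; rewrite !sqrf_eq0.
Qed.
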